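(* Let $p$ be an odd prime, $G$ a finite abelian group such that $p$ is the smallest prime divisor of $|G|$, $\Bbbk$ an algebraically closed field of characteristic $0$, and $\triangleleft$ an action of $C_p$ on $G$. Then there is a bijection between the set of $\mathcal{G}(\triangleleft)$-orbits in $$\mathbb{X}(G,\triangleleft)=H^2(C_p,\widehat G,\bullet)\times H^2_N(G,\Bbbk^{\times})\simeq \widehat G^{C_p}/N(\widehat G)\times \mathrm{Alt}_N(G)$$ that are not contained in $\widehat G^{C_p}/N(\widehat G)$ and the set of isomorphism types of noncocommutative Hopf algebras in $\mathrm{Ext}_{[\triangleleft]}(\Bbbk C_p,\Bbbk^G)$.
   Context: Actions. $C_p=\langle t\rangle$ is cyclic of order $p$. An action $\triangleleft$ of $C_p$ on $G$ is a right action by group automorphisms. For $k$ prime to $p$ let $\alpha_k\in A_p=\mathrm{Aut}(C_p)$ be $x\mapsto x^k$; for $\alpha\in A_p$, $\triangleleft^{\alpha}$ is the action $a\triangleleft^{\alpha}x=a\triangleleft\alpha(x)$. Automorphisms of $G$ are written on the right. $I(\triangleleft,\triangleleft')$ is the set of automorphisms $\lambda$ of $G$ with $(a\triangleleft x)\lambda=a\lambda\triangleleft' x$; $\triangleleft\simeq\triangleleft'$ means $I(\triangleleft,\triangleleft')\ne\emptyset$. Put $C(\triangleleft)=\{\alpha\in A_p:\triangleleft^{\alpha}\simeq\triangleleft\}$ and $[\triangleleft]=\{\triangleleft':\triangleleft'\simeq\triangleleft^\alpha\text{ for some }\alpha\in A_p\}$. Extensions. An extension of $\Bbbk C_p$ by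 $\Bbbk^G$ (functions on $G$) is a sequence of Hopf maps $\Bbbk^G\overset{\iota}{\rightarrowtail}H\overset{\pi}{\twoheadrightarrow}\Bbbk C_p$ with $\iota$ injective, $\pi$ surjective, $\iota(\Bbbk^G)$ normal in $H$ and $\ker\pi=\iota(\Bbbk^G)^+H$. Such $H$ is a crossed product of $\Bbbk C_p$ over $\Bbbk^G$, and the resulting action of $C_p$ on $\Bbbk^G$ has the form $(x.f)(a)=f(a\triangleleft x)$ for an action $\triangleleft$ of $C_p$ on $G$, called the action of the extension. $\mathrm{Ext}_{[\triangleleft]}(\Bbbk C_p,\Bbbk^G)$ is the set of equivalence classes of extensions whose action belongs to $[\triangleleft]$. Isomorphism types are with respect to Hopf algebra isomorphism. The group $\mathbb{X}(G,\triangleleft)$. $\widehat G=\mathrm{Hom}(G,\Bbbk^\times)$ with $C_p$-action $(x.\chi)(a)=\chi(a\triangleleft x)$ (denoted $\bullet$); $\mathrm{Alt}(G)$ is the group of bimultiplicative $\beta:G\times G\to\Bbbk^\times$ with $\beta(a,a)=1$ for all $a$, with $(x.\beta)(a,b)=\beta(a\triangleleft x,b\triangleleft x)$; it is identified $C_p$-equivariantly with $H^2(G,\Bbbk^\times)$ (trivial action of $G$ on $\Bbbk^\times$) by antisymmetrization of cocycles. For $i\ge1$ put $\phi_i=1+t+\dots+t^{i-1}\in\mathbb{Z}C_p$. For a $\mathbb{Z}C_p$-module $M$, $N:M\to M$ is $N(m)=\phi_p.m$ and $M_N=\ker N$; $\mathrm{Alt}_N(G)=\mathrm{Alt}(G)_N$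 and $H^2_N(G,\Bbbk^\times)=H^2(G,\Bbbk^\times)_N$. $\widehat G^{C_p}$ is the group of fixed points, and $H^2(C_p,\widehat G,\bullet)\simeq\widehat G^{C_p}/N(\widehat G)$. The group $\mathcal{G}(\triangleleft)$. If $\triangleleft$ is nontrivial, $\mathcal{G}(\triangleleft)$ is the subgroup of $\mathrm{Aut}(G)$ generated by $I(\triangleleft,\triangleleft)$ and one element of $I(\triangleleft,\triangleleft^{\alpha})$ for each $\alpha\in C(\triangleleft)$; it is the disjoint union of the sets $I(\triangleleft,\triangleleft^\alpha)$, $\alpha\in C(\triangleleft)$. An element $\lambda\in I(\triangleleft,\triangleleft^{\alpha_k})$ acts on each of the two factors of $\mathbb{X}(G,\triangleleft)$ by $z\mapsto(\phi_l.z).\lambda$, where $1\le l\le p-1$, $kl\equiv1\pmod p$, and $(\chi.\lambda)(a)=\chi(a\lambda^{-1})$, $(\beta.\lambda)(a,b)=\beta(a\lambda^{-1},b\lambda^{-1})$. If $\triangleleft$ is trivial, $\mathcal{G}(\triangleleft)=\mathrm{Aut}(G)\times A_p$, and $(\lambda,\alpha_k)$ acts by the same formula. *)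

(* Defs.v *)
From HB Require Import structures.
From mathcomp Require Import all_boot all_order all_algebra all_fingroup.
From mathcomp Require Import boolp classical_sets functions.

Set Implicit Arguments.
Unset Strict Implicit.
Unset Printing Implicit Defensive.

Import GRing.Theory.
Local Open Scope ring_scope.

(* [set_bij] stated for bare predicates: the library's [set] cannot be applied to
   the type of Hopf algebras below for universe reasons. *)
Definition pred_bij (A B : Type) (P : A -> Prop) (Q : B -> Prop) (f : A -> B) :=
  [/\ forall x, P x -> Q (f x),
      forall x y, P x -> P y -> f x = f y -> x = y
    & forall y, Q y -> exists2 x, P x & f x = y].

(* An element of [U (x) V] is given by a formal sum [\sum_i u_i (x) v_i], that is
   a list of pairs.  Two formal sums denote the same tensor iff every bilinear
   map takes the same value on them (universal property of [U (x) V]). *)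
Definition tens (U V : Type) : Type := seq (U * V).

Definition tens_eq (k : fieldType) (U V : lmodType k) (s s' : tens U V) : Prop :=
  forall (W : lmodType k) (b : U -> V -> W),
    (forall u, linear (b u)) -> (forall v, linear (b^~ v)) ->
    \sum_(x <- s) b x.1 x.2 = \sum_(x <- s') b x.1 x.2.

Definition tens3_eq (k : fieldType) (U V T : lmodType k)
    (s s' : seq (U * V * T)) : Prop :=
  forall (W : lmodType k) (b : U -> V -> T -> W),
    (forall u v, linear (b u v)) -> (forall u w, linear (fun v => b u v w)) ->
    (forall v w, linear (fun u => b u v w)) ->
    \sum_(x <- s) b x.1.1 x.1.2 x.2 = \sum_(x <- s') b x.1.1 x.1.2 x.2.

HB.mixin Record Algebra_isHopf (k : fieldType) H of GRing.Algebra k H := {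
  comul : H -> tens H H;
  counit : H -> k;
  antipode : H -> H;
  comul_linear : forall (c : k) (x y : H),
    tens_eq (comul (c *: x + y))
      ([seq (c *: z.1, z.2) | z <- comul x] ++ comul y);
  comul1 : tens_eq (comul 1) [:: (1, 1)];
  comulM : forall x y : H,
    tens_eq (comul (x * y))
      [seq (z.1 * w.1, z.2 * w.2) | z <- comul x, w <- comul y];
  comulA : forall x : H,
    tens3_eq [seq (w.1, w.2, z.2) | z <- comul x, w <- comul z.1]
             [seq (z.1, w.1, w.2) | z <- comul x, w <- comul z.2];
  counit_linear : forall (c : k) (x y : H),
    counit (c *: x + y) = c * counit x + counit y;
  counit1 : counit 1 = 1;
  counitM : forall x y : H, counit (x * y) = counit x * counit y;
  counitl : forall x : H, \sum_(z <- comul x) counit z.1 *: z.2 = x;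
  counitr : forall x : H, \sum_(z <- comul x) counit z.2 *: z.1 = x;
  antipode_linear : linear antipode;
  antipodel : forall x : H,
    \sum_(z <- comul x) antipode z.1 * z.2 = (counit x)%:A;
  antipoder : forall x : H,
    \sum_(z <- comul x) z.1 * antipode z.2 = (counit x)%:A
}.

#[short(type="hopfAlgType")]
HB.structure Definition HopfAlgebra (k : fieldType) :=
  { H of GRing.Algebra k H & Algebra_isHopf k H }.

Section HopfMaps.
Variable k : fieldType.
Implicit Types A B H : hopfAlgType k.

Definition hopf_map A B (f : A -> B) : Prop :=
  [/\ linear f, monoid_morphism f,
      forall x, tens_eq (comul (f x)) [seq (f z.1, f z.2) | z <- comul x],
      forall x, counit (f x) = counit x
    & forall x, f (antipode x) = antipode (f x)].

Definition hopf_iso A B : Prop :=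
  exists2 f : A -> B, hopf_map f & bijective f.

Definition isomorphism_type H : hopfAlgType k -> Prop :=
  fun H' => hopf_iso H H'.

Definition cocommutative H : Prop :=
  forall h : H, tens_eq (comul h) [seq (z.2, z.1) | z <- comul h].

(* Stability under both adjoint actions of [H]. *)
Definition normal_image A H (iota : A -> H) : Prop :=
  forall (h : H) (a : A),
    (exists a', \sum_(z <- comul h) z.1 * iota a * antipode z.2 = iota a') /\
    (exists a', \sum_(z <- comul h) antipode z.1 * iota a * z.2 = iota a').

(* Membership in the right ideal [iota(A)^+ H], where [A^+ = ker counit]. *)
Definition augmentation_ideal A H (iota : A -> H) (h : H) : Prop :=
  exists2 s : seq (A * H), (forall z, z \in s -> counit z.1 = 0)
                         & h = \sum_(z <- s) iota z.1 * z.2.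

Definition hopf_extension A H B (iota : A -> H) (pi : H -> B) : Prop :=
  [/\ hopf_map iota, hopf_map pi,
      injective iota /\ (forall b, exists h, pi h = b),
      normal_image iota
    & forall h, pi h = 0 <-> augmentation_ideal iota h].

(* [gamma] is a section exhibiting [H] as a crossed product over the coinvariants
   of the coaction [(id (x) pi) comul]: it is right [B]-colinear, with convolution
   inverse [gamma']. *)
Definition cleaving H B (pi : H -> B) (gamma gamma' : B -> H) : Prop :=
  [/\ linear gamma, linear gamma',
      forall b, tens_eq [seq (z.1, pi z.2) | z <- comul (gamma b)]
                        [seq (gamma z.1, z.2) | z <- comul b],
      forall b, \sum_(z <- comul b) gamma z.1 * gamma' z.2 = (counit b)%:A
    & forall b, \sum_(z <- comul b) gamma' z.1 * gamma z.2 = (counit b)%:A].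

(* [act b a] is the action [b.a] of the crossed product given by [gamma]. *)
Definition crossed_action A H B (iota : A -> H) (gamma gamma' : B -> H)
    (act : B -> A -> A) : Prop :=
  forall b a,
    iota (act b a) = \sum_(z <- comul b) gamma z.1 * iota a * gamma' z.2.

End HopfMaps.

Definition fun_algebra (k : fieldType) (gT : finGroupType) :=
  {ffun gT -> k^o}.

(* [f] stands for [\sum_x f x x]. *)
Definition group_algebra (k : fieldType) (gT : finGroupType) :=
  {ffun gT -> k^o}.

Section LinearFor.
Variables (k : fieldType) (U V : lmodType k) (f : U -> V).
Hypothesis lf : linear f.

Lemma lin_add (x y : U) : f (x + y) = f x + f y.
Proof. by have := lf 1 x y; rewrite !scale1r. Qed.

Lemma lin_zero : f 0 = 0.
Proof. by apply: (addrI (f 0)); rewrite -lin_add !addr0. Qed.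

Lemma lin_scale (c : k) (x : U) : f (c *: x) = c *: f x.
Proof. by have := lf c x 0; rewrite lin_zero !addr0. Qed.

Lemma lin_sum I (r : seq I) (F : I -> U) :
  f (\sum_(i <- r) F i) = \sum_(i <- r) f (F i).
Proof. exact: (big_morph f lin_add lin_zero). Qed.

End LinearFor.

Section FunAlgebra.
Variables (k : fieldType) (gT : finGroupType).
Local Notation A := (fun_algebra k gT).

HB.instance Definition _ := GRing.Lmodule.copy A {ffun gT -> k^o}.

Definition fun_one : A := [ffun => 1].
Definition fun_mul (f g : A) : A := [ffun x => f x * g x].

Fact fun_mulA : associative fun_mul.
Proof. by move=> f g h; apply/ffunP=> x; rewrite !ffunE mulrA. Qed.
Fact fun_mul1l : left_id fun_one fun_mul.
Proof. by move=> f; apply/ffunP=> x; rewrite !ffunE mul1r. Qed.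
Fact fun_mul1r : right_id fun_one fun_mul.
Proof. by move=> f; apply/ffunP=> x; rewrite !ffunE mulr1. Qed.
Fact fun_mulDl : left_distributive fun_mul +%R.
Proof. by move=> f g h; apply/ffunP=> x; rewrite !ffunE mulrDl. Qed.
Fact fun_mulDr : right_distributive fun_mul +%R.
Proof. by move=> f g h; apply/ffunP=> x; rewrite !ffunE mulrDr. Qed.
Fact fun_one_neq0 : fun_one != 0.
Proof. by apply/eqP => /ffunP/(_ 1%g)/eqP; rewrite !ffunE oner_eq0. Qed.

HB.instance Definition _ := GRing.Zmodule_isNzRing.Build A
  fun_mulA fun_mul1l fun_mul1r fun_mulDl fun_mulDr fun_one_neq0.

Fact fun_scalerAl (c : k) (f g : A) : c *: (f * g) = (c *: f) * g.
Proof. by apply/ffunP=> x; rewrite !ffunE scalerAl. Qed.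
HB.instance Definition _ := GRing.Lmodule_isLalgebra.Build k A fun_scalerAl.

Fact fun_scalerAr (c : k) (f g : A) : c *: (f * g) = f * (c *: g).
Proof. by apply/ffunP=> x; rewrite !ffunE scalerAr. Qed.
HB.instance Definition _ := GRing.Lalgebra_isAlgebra.Build k A fun_scalerAr.

Definition fun_delta (a : gT) : A := [ffun x => (x == a)%:R].

Lemma fun_delta_mul (a : gT) (f : A) : fun_delta a * f = f a *: fun_delta a.
Proof.
apply/ffunP=> x; rewrite !ffunE; have [->|_] := eqVneq x a.
  by rewrite mul1r [RHS]mulr1.
by rewrite mul0r [RHS]mulr0.
Qed.

Lemma fun_expand (f : A) : f = \sum_a f a *: fun_delta a.
Proof.
apply/ffunP=> x; rewrite sum_ffunE (bigD1 x) //= !ffunE eqxx /= big1 ?addr0.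
  by rewrite [RHS]mulr1.
by move=> a nax; rewrite !ffunE eq_sym (negPf nax); apply: mulr0.
Qed.

(* The function [(a, b) |-> f (ab)] on [G x G]. *)
Definition fun_comul (f : A) : tens A A :=
  [seq (f (a * b)%g *: fun_delta a, fun_delta b) | a <- enum gT, b <- enum gT].
Definition fun_counit (f : A) : k := f 1%g.
Definition fun_antipode (f : A) : A := [ffun a => f a^-1%g].

Lemma fun_comul_sum (W : nmodType) (F : A * A -> W) (f : A) :
  \sum_(z <- fun_comul f) F z =
  \sum_a \sum_b F (f (a * b)%g *: fun_delta a, fun_delta b).
Proof. by rewrite big_allpairs_dep big_enum; apply: eq_bigr => a _; rewrite big_enum. Qed.

Lemma fun_expand2 (W : lmodType k) (b : A -> A -> W) (f g : A) :
    (forall u, linear (b u)) -> (forall v, linear (b^~ v)) ->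
  b f g = \sum_x \sum_y (f x * g y) *: b (fun_delta x) (fun_delta y).
Proof.
move=> br bl; rewrite {1}(fun_expand f) (lin_sum (bl g)); apply: eq_bigr => x _.
rewrite (lin_scale (bl _)) {1}(fun_expand g) (lin_sum (br _)) scaler_sumr.
by apply: eq_bigr => y _; rewrite (lin_scale (br _)) scalerA.
Qed.

Fact fun_comul_linear (c : k) (f g : A) :
  tens_eq (fun_comul (c *: f + g))
    ([seq (c *: z.1, z.2) | z <- fun_comul f] ++ fun_comul g).
Proof.
move=> W b br bl; rewrite big_cat big_map /= !fun_comul_sum -big_split.
apply: eq_bigr => x _; rewrite -big_split; apply: eq_bigr => y _ /=.
by rewrite !(lin_scale (bl _)) !ffunE scalerDl -scalerA.
Qed.

Fact fun_comul1 : tens_eq (fun_comul 1) [:: (1, 1)].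
Proof.
move=> W b br bl; rewrite big_seq1 fun_comul_sum (fun_expand2 1 1 br bl).
apply: eq_bigr => x _; apply: eq_bigr => y _ /=.
by rewrite (lin_scale (bl _)) !ffunE mulr1.
Qed.

Fact fun_comulM (f g : A) :
  tens_eq (fun_comul (f * g))
    [seq (z.1 * w.1, z.2 * w.2) | z <- fun_comul f, w <- fun_comul g].
Proof.
move=> W b br bl; rewrite [LHS]fun_comul_sum [RHS]big_allpairs_dep [RHS]fun_comul_sum.
apply: eq_bigr => x _; apply: eq_bigr => y _ /=.
rewrite fun_comul_sum (bigD1 x) //= (bigD1 y) //= !fun_delta_mul.
rewrite [X in _ + X + _]big1 ?[X in _ + X]big1 ?addr0.
- rewrite -scalerAl fun_delta_mul !(lin_scale (bl _)) !(lin_scale (br _)) !ffunE.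
  by rewrite !scalerA !eqxx !mulr1 [_ *: 1]mulr1.
- move=> i nix; rewrite big1 // => j _; rewrite -scalerAl.
  rewrite [fun_delta x * _]fun_delta_mul !(lin_scale (bl _)) !ffunE [x == i]eq_sym.
  by rewrite (negPf nix) [_ *: 0]mulr0 scale0r scaler0.
- move=> j njy; rewrite [fun_delta y * _]fun_delta_mul ffunE [y == j]eq_sym.
  by rewrite (negPf njy) (lin_scale (br _)) scale0r.
Qed.

Fact fun_comulA (f : A) :
  tens3_eq [seq (w.1, w.2, z.2) | z <- fun_comul f, w <- fun_comul z.1]
           [seq (z.1, w.1, w.2) | z <- fun_comul f, w <- fun_comul z.2].
Proof.
move=> W b b3 b2 b1; rewrite [LHS]big_allpairs_dep [RHS]big_allpairs_dep.
rewrite [LHS]fun_comul_sum [RHS]fun_comul_sum /=.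
under eq_bigr => x _ do under eq_bigr => y _ do rewrite fun_comul_sum /=.
under [RHS]eq_bigr => x _ do under eq_bigr => y _ do rewrite fun_comul_sum /=.
transitivity (\sum_x \sum_y \sum_z
   f (x * y * z)%g *: b (fun_delta x) (fun_delta y) (fun_delta z)).
  under eq_bigr => u _ do rewrite exchange_big.
  rewrite exchange_big; apply: eq_bigr => x _ /=.
  under eq_bigr => u _ do rewrite exchange_big.
  rewrite exchange_big; apply: eq_bigr => y _ /=.
  rewrite exchange_big; apply: eq_bigr => z _ /=.
  rewrite (bigD1 (x * y)%g) //= big1 ?addr0.
    by rewrite (lin_scale (b1 _ _)) !ffunE eqxx [_ *: 1]mulr1.
  move=> u nu; rewrite (lin_scale (b1 _ _)) !ffunE [_ == u]eq_sym (negPf nu).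
  by rewrite [_ *: 0]mulr0 scale0r.
apply: eq_bigr => x _.
transitivity (\sum_y \sum_z \sum_u f (x * u)%g *:
     (((y * z)%g == u)%:R *: b (fun_delta x) (fun_delta y) (fun_delta z))); last first.
  rewrite exchange_big.
  under eq_bigr => u _ do rewrite exchange_big.
  rewrite exchange_big; apply: eq_bigr => z _ /=.
  rewrite exchange_big; apply: eq_bigr => y _ /=.
  apply: eq_bigr => u _.
  by rewrite (lin_scale (b1 _ _)) (lin_scale (b2 _ _)) !ffunE.
apply: eq_bigr => y _; apply: eq_bigr => z _.
rewrite (bigD1 (y * z)%g) //= big1 ?addr0 ?eqxx ?scale1r ?mulgA //.
by move=> u nu; rewrite [_ == u]eq_sym (negPf nu) scale0r scaler0.
Qed.

Fact fun_counit_linear (c : k) (f g : A) :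
  fun_counit (c *: f + g) = c * fun_counit f + fun_counit g.
Proof. by rewrite /fun_counit !ffunE. Qed.

Fact fun_counit1 : fun_counit 1 = 1.
Proof. by rewrite /fun_counit ffunE. Qed.

Fact fun_counitM (f g : A) : fun_counit (f * g) = fun_counit f * fun_counit g.
Proof. by rewrite /fun_counit ffunE. Qed.

Fact fun_counitl (f : A) :
  \sum_(z <- fun_comul f) fun_counit z.1 *: z.2 = f.
Proof.
rewrite fun_comul_sum (bigD1 1%g) //= [X in _ + X]big1 ?addr0.
  rewrite [RHS]fun_expand; apply: eq_bigr => y _.
  by rewrite /fun_counit !ffunE eqxx mul1g [_ *: 1]mulr1.
move=> x nx; rewrite big1 // => y _.
by rewrite /fun_counit !ffunE [_ == x]eq_sym (negPf nx) [_ *: 0]mulr0 scale0r.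
Qed.

Fact fun_counitr (f : A) :
  \sum_(z <- fun_comul f) fun_counit z.2 *: z.1 = f.
Proof.
rewrite fun_comul_sum [RHS]fun_expand; apply: eq_bigr => x _.
rewrite (bigD1 1%g) //= [X in _ + X]big1 ?addr0.
  by rewrite /fun_counit !ffunE eqxx mulg1 scale1r.
by move=> y ny; rewrite /fun_counit !ffunE [_ == y]eq_sym (negPf ny) scale0r.
Qed.

Fact fun_antipode_linear : linear fun_antipode.
Proof. by move=> c f g; apply/ffunP=> x; rewrite !ffunE. Qed.

Fact fun_antipode_delta (a : gT) : fun_antipode (fun_delta a) = fun_delta a^-1%g.
Proof. by apply/ffunP=> x; rewrite !ffunE (can2_eq invgK invgK). Qed.

Lemma fun_alg1 : 1 = \sum_a fun_delta a.
Proof. by rewrite {1}[1]fun_expand; apply: eq_bigr => a _; rewrite ffunE scale1r. Qed.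

Fact fun_antipodel (f : A) :
  \sum_(z <- fun_comul f) fun_antipode z.1 * z.2 = (fun_counit f)%:A.
Proof.
rewrite fun_comul_sum exchange_big fun_alg1 scaler_sumr; apply: eq_bigr => y _ /=.
rewrite (bigD1 y^-1%g) //= big1 ?addr0.
  rewrite (lin_scale fun_antipode_linear) fun_antipode_delta invgK -scalerAl.
  by rewrite fun_delta_mul ffunE eqxx scale1r mulVg.
move=> x nx; rewrite (lin_scale fun_antipode_linear) fun_antipode_delta -scalerAl.
rewrite fun_delta_mul ffunE (can2_eq invgK invgK) (negPf nx) scale0r.
exact: scaler0.
Qed.

Fact fun_antipoder (f : A) :
  \sum_(z <- fun_comul f) z.1 * fun_antipode z.2 = (fun_counit f)%:A.
Proof.
rewrite fun_comul_sum fun_alg1 scaler_sumr; apply: eq_bigr => x _ /=.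
rewrite (bigD1 x^-1%g) //= big1 ?addr0.
  by rewrite fun_antipode_delta invgK -scalerAl fun_delta_mul ffunE eqxx scale1r mulgV.
move=> y ny; rewrite fun_antipode_delta -scalerAl fun_delta_mul ffunE.
by rewrite eq_sym (can2_eq invgK invgK) (negPf ny) scale0r scaler0.
Qed.

HB.instance Definition _ := Algebra_isHopf.Build k A
  fun_comul_linear fun_comul1 fun_comulM fun_comulA fun_counit_linear
  fun_counit1 fun_counitM fun_counitl fun_counitr fun_antipode_linear
  fun_antipodel fun_antipoder.

End FunAlgebra.

Section GroupAlgebra.
Variables (k : fieldType) (gT : finGroupType).
Local Notation A := (group_algebra k gT).

HB.instance Definition _ := GRing.Lmodule.copy A {ffun gT -> k^o}.

Definition group_elt (x : gT) : A := [ffun y => (y == x)%:R].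
Definition group_mul (f g : A) : A :=
  [ffun z => \sum_x f x * g (x^-1 * z)%g].

Fact group_mulDl : left_distributive group_mul +%R.
Proof.
move=> f g h; apply/ffunP=> z; rewrite !ffunE -big_split /=.
by apply: eq_bigr => x _; rewrite !ffunE mulrDl.
Qed.

Fact group_mulDr : right_distributive group_mul +%R.
Proof.
move=> f g h; apply/ffunP=> z; rewrite !ffunE -big_split /=.
by apply: eq_bigr => x _; rewrite !ffunE mulrDr.
Qed.

Fact group_mulA : associative group_mul.
Proof.
move=> f g h; apply/ffunP=> z; rewrite !ffunE.
under eq_bigr => x _ do rewrite ffunE mulr_sumr.
under [RHS]eq_bigr => y _ do rewrite ffunE mulr_suml.
rewrite [RHS]exchange_big; apply: eq_bigr => x _ /=.
rewrite [RHS](reindex_inj (mulgI x)); apply: eq_bigr => y _ /=.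
by rewrite mulKg mulrA invMg mulgA.
Qed.

Fact group_mul1l : left_id (group_elt 1) group_mul.
Proof.
move=> f; apply/ffunP=> z; rewrite ffunE (bigD1 1%g) //= big1 ?addr0.
  by rewrite ffunE eqxx mul1r invg1 mul1g.
by move=> x nx; rewrite ffunE (negPf nx) mul0r.
Qed.

Fact group_mul1r : right_id (group_elt 1) group_mul.
Proof.
move=> f; apply/ffunP=> z; rewrite ffunE (bigD1 z) //= big1 ?addr0.
  by rewrite ffunE mulVg eqxx mulr1.
by move=> x nx; rewrite ffunE -eq_mulVg1 (negPf nx) mulr0.
Qed.

Fact group_one_neq0 : group_elt 1 != 0.
Proof. by apply/eqP => /ffunP/(_ 1%g)/eqP; rewrite !ffunE eqxx oner_eq0. Qed.

HB.instance Definition _ := GRing.Zmodule_isNzRing.Build A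
  group_mulA group_mul1l group_mul1r group_mulDl group_mulDr group_one_neq0.

Fact group_scalerAl (c : k) (f g : A) : c *: (f * g) = (c *: f) * g.
Proof.
apply/ffunP=> z; rewrite !ffunE scaler_sumr.
by apply: eq_bigr => x _; rewrite ffunE scalerAl.
Qed.
HB.instance Definition _ := GRing.Lmodule_isLalgebra.Build k A group_scalerAl.

Fact group_scalerAr (c : k) (f g : A) : c *: (f * g) = f * (c *: g).
Proof.
apply/ffunP=> z; rewrite !ffunE scaler_sumr.
by apply: eq_bigr => x _; rewrite ffunE scalerAr.
Qed.
HB.instance Definition _ := GRing.Lalgebra_isAlgebra.Build k A group_scalerAr.

Lemma group_alg1 : 1 = group_elt 1. Proof. by []. Qed.

Lemma group_eltM (x y : gT) : group_elt x * group_elt y = group_elt (x * y)%g.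
Proof.
apply/ffunP=> z; rewrite !ffunE (bigD1 x) //= big1 ?addr0.
  by rewrite !ffunE eqxx mul1r -(can2_eq (mulKVg x) (mulKg x)) eq_sym.
by move=> u nu; rewrite ffunE (negPf nu) mul0r.
Qed.

Lemma group_expand (f : A) : f = \sum_x f x *: group_elt x.
Proof.
apply/ffunP=> x; rewrite sum_ffunE (bigD1 x) //= !ffunE eqxx /= big1 ?addr0.
  by rewrite [RHS]mulr1.
by move=> a nax; rewrite !ffunE eq_sym (negPf nax); apply: mulr0.
Qed.

Definition group_comul (f : A) : tens A A :=
  [seq (f x *: group_elt x, group_elt x) | x <- enum gT].
Definition group_counit (f : A) : k := \sum_x f x.
Definition group_antipode (f : A) : A := [ffun x => f x^-1%g].

Lemma group_comul_sum (W : nmodType) (F : A * A -> W) (f : A) :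
  \sum_(z <- group_comul f) F z = \sum_x F (f x *: group_elt x, group_elt x).
Proof. by rewrite big_map big_enum. Qed.

Lemma group_counit_scale (c : k) (x : gT) :
  group_counit (c *: group_elt x) = c.
Proof.
rewrite /group_counit (bigD1 x) //= !ffunE eqxx big1 ?addr0; first exact: mulr1.
by move=> y ny; rewrite !ffunE (negPf ny); apply: mulr0.
Qed.

Fact group_comul_linear (c : k) (f g : A) :
  tens_eq (group_comul (c *: f + g))
    ([seq (c *: z.1, z.2) | z <- group_comul f] ++ group_comul g).
Proof.
move=> W b br bl; rewrite [LHS]group_comul_sum big_cat /= [X in _ = _ + X]group_comul_sum.
rewrite big_map group_comul_sum -big_split /=.
apply: eq_bigr => x _ /=.
by rewrite !(lin_scale (bl _)) !ffunE scalerDl -scalerA.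
Qed.

Fact group_comul1 : tens_eq (group_comul 1) [:: (1, 1)].
Proof.
move=> W b br bl; rewrite big_seq1 group_comul_sum (bigD1 1%g) //= big1 ?addr0.
  by rewrite !ffunE eqxx scale1r.
by move=> x nx; rewrite (lin_scale (bl _)) !ffunE (negPf nx) scale0r.
Qed.

Fact group_comulM (f g : A) :
  tens_eq (group_comul (f * g))
    [seq (z.1 * w.1, z.2 * w.2) | z <- group_comul f, w <- group_comul g].
Proof.
move=> W b br bl.
rewrite [LHS]group_comul_sum [RHS]big_allpairs_dep [RHS]group_comul_sum.
under [RHS]eq_bigr => x _ do rewrite group_comul_sum /=.
transitivity (\sum_z \sum_x
    (f x * g (x^-1 * z)%g) *: b (group_elt z) (group_elt z)).
  by apply: eq_bigr => z _ /=; rewrite (lin_scale (bl _)) ffunE scaler_suml.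
rewrite exchange_big; apply: eq_bigr => x _ /=.
rewrite (reindex_inj (mulgI x)); apply: eq_bigr => y _ /=.
by rewrite mulKg -scalerAl -scalerAr scalerA group_eltM (lin_scale (bl _)).
Qed.

Fact group_comulA (f : A) :
  tens3_eq [seq (w.1, w.2, z.2) | z <- group_comul f, w <- group_comul z.1]
           [seq (z.1, w.1, w.2) | z <- group_comul f, w <- group_comul z.2].
Proof.
move=> W b b3 b2 b1; rewrite [LHS]big_allpairs_dep [RHS]big_allpairs_dep.
rewrite [LHS]group_comul_sum [RHS]group_comul_sum /=; apply: eq_bigr => x _.
rewrite !group_comul_sum /=; transitivity (f x *:
    b (group_elt x) (group_elt x) (group_elt x)).
  rewrite (bigD1 x) //= big1 ?addr0.
    by rewrite (lin_scale (b1 _ _)) !ffunE eqxx [_ *: 1]mulr1.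
  move=> y ny; rewrite (lin_scale (b1 _ _)) !ffunE (negPf ny) [_ *: 0]mulr0.
  by rewrite scale0r.
rewrite (bigD1 x) //= big1 ?addr0.
  by rewrite (lin_scale (b1 _ _)) !ffunE eqxx scale1r.
by move=> y ny; rewrite (lin_scale (b2 _ _)) ffunE (negPf ny) scale0r.
Qed.

Fact group_counit_linear (c : k) (f g : A) :
  group_counit (c *: f + g) = c * group_counit f + group_counit g.
Proof.
rewrite /group_counit mulr_sumr -big_split.
by apply: eq_bigr => x _; rewrite !ffunE.
Qed.

Fact group_counit1 : group_counit 1 = 1.
Proof. by rewrite group_alg1 -(group_counit_scale 1 1) scale1r. Qed.

Fact group_counitM (f g : A) :
  group_counit (f * g) = group_counit f * group_counit g.
Proof.
rewrite /group_counit mulr_suml; under eq_bigr do rewrite ffunE.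
rewrite exchange_big; apply: eq_bigr => x _ /=; rewrite mulr_sumr.
by rewrite (reindex_inj (mulgI x)); apply: eq_bigr => y _; rewrite mulKg.
Qed.

Fact group_counitl (f : A) :
  \sum_(z <- group_comul f) group_counit z.1 *: z.2 = f.
Proof.
rewrite group_comul_sum [RHS]group_expand.
by apply: eq_bigr => x _; rewrite group_counit_scale.
Qed.

Fact group_counitr (f : A) :
  \sum_(z <- group_comul f) group_counit z.2 *: z.1 = f.
Proof.
rewrite group_comul_sum [RHS]group_expand; apply: eq_bigr => x _ /=.
by rewrite -[X in group_counit X]scale1r group_counit_scale scale1r.
Qed.

Fact group_antipode_linear : linear group_antipode.
Proof. by move=> c f g; apply/ffunP=> x; rewrite !ffunE. Qed.

Lemma group_antipode_elt (x : gT) :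
  group_antipode (group_elt x) = group_elt x^-1%g.
Proof. by apply/ffunP=> y; rewrite !ffunE (can2_eq invgK invgK). Qed.

Fact group_antipodel (f : A) :
  \sum_(z <- group_comul f) group_antipode z.1 * z.2 = (group_counit f)%:A.
Proof.
rewrite group_comul_sum scaler_suml; apply: eq_bigr => x _ /=.
rewrite (lin_scale group_antipode_linear) group_antipode_elt -scalerAl.
by rewrite group_eltM mulVg.
Qed.

Fact group_antipoder (f : A) :
  \sum_(z <- group_comul f) z.1 * group_antipode z.2 = (group_counit f)%:A.
Proof.
rewrite group_comul_sum scaler_suml; apply: eq_bigr => x _ /=.
by rewrite group_antipode_elt -scalerAl group_eltM mulgV.
Qed.

HB.instance Definition _ := Algebra_isHopf.Build k A
  group_comul_linear group_comul1 group_comulM group_comulA group_counit_linear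
  group_counit1 group_counitM group_counitl group_counitr group_antipode_linear
  group_antipodel group_antipoder.

End GroupAlgebra.

Section Actions.
Variables (cT gT : finGroupType).
Implicit Types (act : gT -> cT -> gT) (alpha : {perm cT}).

Definition twist act alpha : gT -> cT -> gT := fun a x => act a (alpha x).

Definition intertwiners act act' : {set {perm gT}} :=
  [set lam in Aut [set: gT] |
    [forall a, forall x, lam (act a x) == act' (lam a) x]]%SET.

Definition equiv_actions act act' : bool := intertwiners act act' != finset.set0.

Definition action_stabilizer act : {set {perm cT}} :=
  [set alpha in Aut [set: cT] | equiv_actions (twist act alpha) act]%SET.

Definition in_action_class act act' : Prop :=
  exists2 alpha, alpha \in Aut [set: cT] & equiv_actions act' (twist act alpha).

Definition trivial_action act : bool := [forall a, forall x, act a x == a].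

(* Used for nontrivial [act] only; [repr] chooses one element of each
   (nonempty) set of intertwiners. *)
Definition calG act : {set {perm gT}} :=
  <<intertwiners act act :|:
    [set repr (intertwiners act (twist act alpha)) |
      alpha in action_stabilizer act]>>%g.

(* The elements of G(act), each paired with the automorphism [alpha] of the
   acting group through which it operates: [lam] is paired with the [alpha] such
   that [lam] intertwines [act] and [act^alpha] if [act] is nontrivial, and
   G(act) is the full product of automorphism groups if [act] is trivial. *)
Definition calG_pairs act : {set {perm gT} * {perm cT}} :=
  if trivial_action act then finset.setX (Aut [set: gT]) (Aut [set: cT])
  else [set g in finset.setX (calG act) (action_stabilizer act) |
         g.1 \in intertwiners act (twist act g.2)]%SET.

End Actions.

Section GroupX.
Variables (k : fieldType) (cT gT : finGroupType) (t : cT).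
Variable act : gT -> cT -> gT.
Implicit Types (chi : gT -> k) (beta : gT -> gT -> k) (lam : {perm gT}).

(* The modules below are written multiplicatively, as sets of functions under
   pointwise product. *)
Definition dual : set (gT -> k) :=
  [set chi | (forall a, chi a != 0) /\
             (forall a b, chi (a * b)%g = chi a * chi b)]%classic.

Definition Alt : set (gT -> gT -> k) :=
  [set beta | [/\ forall a b, beta a b != 0,
                  forall a b c, beta (a * b)%g c = beta a c * beta b c,
                  forall a b c, beta a (b * c)%g = beta a b * beta a c
                & forall a, beta a a = 1]]%classic.

(* Action of [phi_i = 1 + t + ... + t^(i-1)]. *)
Definition phi_chi (i : nat) chi : gT -> k :=
  fun a => \prod_(j < i) chi (act a (t ^+ j)%g).
Definition phi_beta (i : nat) beta : gT -> gT -> k :=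
  fun a b => \prod_(j < i) beta (act a (t ^+ j)%g) (act b (t ^+ j)%g).

Definition dual_fixed : set (gT -> k) :=
  [set chi | dual chi /\ forall a x, chi (act a x) = chi a]%classic.

Definition norm_coset chi : set (gT -> k) :=
  [set (fun a => chi a * phi_chi #[t]%g psi a) | psi in dual]%classic.

Definition Alt_N : set (gT -> gT -> k) :=
  [set beta | Alt beta /\ forall a b, phi_beta #[t]%g beta a b = 1]%classic.

(* The first factor of X(G, act) is the set of cosets of [N(dual)] in
   [dual_fixed]; [Alt_N] is the model of H^2_N(G, k^x) given by
   antisymmetrization of cocycles. *)
Definition groupX_point : Type := (set (gT -> k) * (gT -> gT -> k))%type.

Definition groupX : set groupX_point :=
  [set z | (exists2 chi, dual_fixed chi & z.1 = norm_coset chi) /\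
           Alt_N z.2]%classic.

Definition groupX_left : set groupX_point :=
  [set z | groupX z /\ z.2 = (fun _ _ => 1)]%classic.

(* [z |-> (phi_l . z) . lam] *)
Definition chi_op (l : nat) lam chi : gT -> k :=
  fun a => phi_chi l chi ((lam^-1)%g a).
Definition beta_op (l : nat) lam beta : gT -> gT -> k :=
  fun a b => phi_beta l beta ((lam^-1)%g a) ((lam^-1)%g b).
(* On the first component, the map induced by [chi_op] on cosets. *)
Definition groupX_op (l : nat) lam (z : groupX_point) : groupX_point :=
  ((\bigcup_(chi in z.1) norm_coset (chi_op l lam chi))%classic,
   beta_op l lam z.2).

Definition groupX_orbit (z : groupX_point) : set groupX_point :=
  [set z' | exists (g : {perm gT} * {perm cT}) (n l : nat),
     [/\ g \in calG_pairs act, forall x, g.2 x = (x ^+ n)%g,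
         (0 < l < #[t]%g)%N, (n * l = 1 %[mod #[t]%g])%N
       & z' = groupX_op l g.1 z]]%classic.

Definition groupX_orbits : set (set groupX_point) :=
  [set groupX_orbit z | z in groupX]%classic.

End GroupX.

Section Extensions.
Variables (k : fieldType) (cT gT : finGroupType).

Local Notation kG := (fun_algebra k gT).
Local Notation kC := (group_algebra k cT).

(* [(x . f)(a) = f (act a x)], extended linearly to the group algebra. *)
Definition action_on_functions (act : gT -> cT -> gT) (b : kC) (f : kG) : kG :=
  [ffun a => \sum_x b x * f (act a x)].

Definition extension_action (H : hopfAlgType k) (iota : kG -> H) (pi : H -> kC)
    (act : gT -> cT -> gT) : Prop :=
  exists gamma gamma' : kC -> H,
    cleaving pi gamma gamma' /\
    crossed_action iota gamma gamma' (action_on_functions act).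

(* Equivalence of extensions plays no role here: only the middle terms [H] of
   the extensions enter, and equivalent extensions have isomorphic ones. *)
Definition in_Ext (act : gT -> cT -> gT) (H : hopfAlgType k) : Prop :=
  exists (iota : kG -> H) (pi : H -> kC)
         (act' : groupAction [set: cT] [set: gT]),
    [/\ hopf_extension iota pi, extension_action iota pi act'
      & in_action_class act act'].

End Extensions.

Definition noncocommutative_types (k : fieldType) (cT gT : finGroupType)
    (act : gT -> cT -> gT) (T : hopfAlgType k -> Prop) : Prop :=
  exists2 H : hopfAlgType k, in_Ext act H /\ ~ cocommutative H
                           & T = isomorphism_type H.

(* Main.v *)
(* Write [e_a] for the image in an extension [H] of the delta function at [a].  As
   [p] is the smallest prime divisor of the order of [G], an action of [G] on the
   set [C_p] fixing 1 is trivial, which forces the left and right [k C_p]-coactions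
   on [H] to have the same components.  So [H] is generated over [k^G] by a unit
   [u] above a generator of [C_p], and [Delta(u) = J (u (x) u)] for a 2-cocycle
   [J] of [G].  A symmetric cocycle splits, by a common eigenvector argument, so
   after rescaling [u] we may take [J] to be the alternating square root of
   [beta(a, b) = J(a, b) / J(b, a)], which exists because [G] has odd order.  Then
   [u] is unique up to a character of [G], [u^p = chi] is a character fixed by
   [C_p], [N(beta) = 1], and the point [(chi N(dual), beta)] determines [H].
   If [beta <> 1], the components of [H] outside of [k^G] are so far from being
   cocommutative that every embedding of [k^G] has the same image.  Hence an
   isomorphism between two such Hopf algebras is given on [k^G] by an automorphism
   [lam] of [G], and maps [u] to [psi u'^l] for a character [psi] and some [l]
   prime to [p]; this is the action of G(act) on the points. *)
From HB Require Import structures.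
From mathcomp Require Import all_boot all_order all_algebra all_fingroup.
From mathcomp Require Import cyclic ring.
From mathcomp Require Import boolp classical_sets functions.
Require Import Defs.

Set Implicit Arguments.
Unset Strict Implicit.
Unset Printing Implicit Defensive.

Import GRing.Theory.
Local Open Scope ring_scope.

(** * Sweedler sums *)

(** Tensors are formal sums tested by bilinear maps, and [H] is not assumed finite-dimensional.
    Coefficients are therefore extracted by functionals on [H], which come from Zorn's lemma. The
    first obstacle is that an extension prescribes only the kernel of [pi]: that the coinvariants of
    [pi] are no larger than [iota(k^G)] has to be derived. A point [(chi, beta)] gives a crossed
    product with [u^p = chi], which is awkward to construct. As [k] is algebraically closed there is
    a C-invariant function [r] with [r^p = chi^-1], and [iota r * u] has [p]-th power 1. The price
    is a coboundary of [r] in the twist. So each point has a smash product as its model, and every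
    Hopf algebra presented by the point is isomorphic to that model. Isomorphisms are thereby traded
    for presentations: two points are compared by finding all presentations of one model, where
    coefficients can be read off. If [beta <> 1], no component [t^i <> 1] of the model is
    cocommutative: symmetry of its twist would give [phi_i beta = 1], and [phi_i] acts injectively
    on [Alt_N] for [i] prime to [p]. *)

Definition bilin (k : fieldType) (U V W : lmodType k) (b : U -> V -> W) :=
  (forall u, linear (b u)) /\ (forall v, linear (b^~ v)).

Definition trilin (k : fieldType) (U V T W : lmodType k)
    (b : U -> V -> T -> W) :=
  [/\ forall u v, linear (b u v), forall u w, linear (fun v => b u v w)
    & forall v w, linear (fun u => b u v w)].

Section LinearRules.
Variable k : fieldType.

Lemma scale_lin (U : lmodType k) (d c : k) (x y : U) :
  d *: (c *: x + y) = c *: (d *: x) + d *: y.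
Proof. by rewrite scalerDr !scalerA mulrC. Qed.

Lemma scalar_lin (U : lmodType k) (c : k) (x y : k^o) (u : U) :
  (c *: x + y : k) *: u = c *: ((x : k) *: u) + (y : k) *: u.
Proof. by rewrite scalerDl scalerA. Qed.

Lemma mulr_lin (R : algType k) (e x y : R) (c : k) :
  e * (c *: x + y) = c *: (e * x) + e * y.
Proof. by rewrite mulrDr scalerAr. Qed.

Lemma mull_lin (R : algType k) (e x y : R) (c : k) :
  (c *: x + y) * e = c *: (x * e) + y * e.
Proof. by rewrite mulrDl scalerAl. Qed.

Lemma sum_lin (U : lmodType k) I (r : seq I) (P : pred I) (F G : I -> U) (c : k) :
  \sum_(i <- r | P i) (c *: F i + G i) =
  c *: (\sum_(i <- r | P i) F i) + \sum_(i <- r | P i) G i.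
Proof. by rewrite big_split scaler_sumr. Qed.

Lemma ffun_lin (T : finType) (F G : {ffun T -> k^o}) (c : k) x :
  (c *: F + G) x = (c *: (F x : k^o) + G x : k^o).
Proof. by rewrite !ffunE. Qed.

Variables (U V T W : lmodType k).

Lemma linE (f : U -> V) : linear f ->
  forall c x y, f (c *: x + y) = c *: f x + f y.
Proof. by []. Qed.

Lemma bilinr (b : U -> V -> W) : bilin b ->
  forall u c x y, b u (c *: x + y) = c *: b u x + b u y.
Proof. by case=> H _ u c x y; exact: H. Qed.

Lemma bilinl (b : U -> V -> W) : bilin b ->
  forall v c x y, b (c *: x + y) v = c *: b x v + b y v.
Proof. by case=> _ H v c x y; exact: (H v c x y). Qed.

Lemma trilin3 (b : U -> V -> T -> W) : trilin b ->
  forall u v c x y, b u v (c *: x + y) = c *: b u v x + b u v y.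
Proof. by case=> H _ _ u v c x y; exact: H. Qed.

Lemma trilin2 (b : U -> V -> T -> W) : trilin b ->
  forall u v c x y, b u (c *: x + y) v = c *: b u x v + b u y v.
Proof. by case=> _ H _ u v c x y; exact: (H u v c x y). Qed.

Lemma trilin1 (b : U -> V -> T -> W) : trilin b ->
  forall u v c x y, b (c *: x + y) u v = c *: b x u v + b y u v.
Proof. by case=> _ _ H u v c x y; exact: (H u v c x y). Qed.

End LinearRules.

(** [comul] returns a formal sum, so this value depends only on the tensor it denotes when [b] is
    bilinear; hence the [bilin] hypotheses below. *)
Definition sweedler (k : fieldType) (H : hopfAlgType k) (W : nmodType)
    (b : H -> H -> W) (h : H) : W := \sum_(z <- comul h) b z.1 z.2.

Section Sweedler0.
Variables (k : fieldType) (H : hopfAlgType k).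
Implicit Types (h x y : H).

Lemma eq_sweedler (W : nmodType) (b b' : H -> H -> W) h :
  (forall m n, b m n = b' m n) -> sweedler b h = sweedler b' h.
Proof. by move=> e; apply: eq_bigr => z _. Qed.

Variable W : lmodType k.
Implicit Types b : H -> H -> W.

Lemma sweedler_linear b : bilin b -> linear (sweedler b).
Proof.
move=> [br bl] c x y; rewrite /sweedler (comul_linear c x y _ _ br bl).
rewrite big_cat big_map /= scaler_sumr; congr (_ + _); apply: eq_bigr => z _ /=.
exact: (lin_scale (bl z.2)).
Qed.

Lemma sweedler_lin (b b' : H -> H -> W) c h :
  sweedler (fun m n => c *: b m n + b' m n) h = c *: sweedler b h + sweedler b' h.
Proof. exact: sum_lin. Qed.

Lemma counit_lin c x y :
  counit (c *: x + y) = (c *: (counit x : k^o) + counit y : k^o).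
Proof. exact: counit_linear. Qed.

End Sweedler0.

(** Proves linearity of composite expressions: the first alternatives pull [c *: x + y] out of one
    layer, the later ones merge the right-hand side and descend into a common sum, factor or map. *)
Ltac lin_step :=
  first
  [ rewrite scale_lin | rewrite mulr_lin | rewrite mull_lin
  | rewrite scalar_lin | rewrite sum_lin | rewrite sweedler_lin
  | rewrite ffun_lin | rewrite antipode_linear | rewrite counit_lin
  | match goal with
    | L : @GRing.linear_for _ _ _ _ ?f |- _ => rewrite (linE L)
    | L : bilin ?f |- _ => first [rewrite (bilinr L) | rewrite (bilinl L)]
    | L : trilin ?f |- _ =>
        first [rewrite (trilin3 L) | rewrite (trilin2 L) | rewrite (trilin1 L)]
    | L : forall i, @GRing.linear_for _ _ _ _ (?f i) |- _ => rewrite (linE (L _))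
    | L : forall i, bilin (?f i) |- _ =>
        first [rewrite (bilinr (L _)) | rewrite (bilinl (L _))]
    | |- context [sweedler ?b (_ *: _ + _)] =>
        rewrite (@sweedler_linear _ _ _ b); last by lin
    end
  | rewrite -sweedler_lin; apply: eq_sweedler => ? ?
  | rewrite -sum_lin; apply: eq_bigr => ? _
  | rewrite -mulr_lin; congr (_ * _) | rewrite -mull_lin; congr (_ * _)
  | rewrite -scale_lin; congr (_ *: _)
  | match goal with
    | L : @GRing.linear_for _ _ _ _ ?f |- _ => rewrite -(linE L); congr (f _)
    end ]
with lin :=
  lazymatch goal with
  | |- bilin _ => split=> ?; lin
  | |- trilin _ => split=> ? ?; lin
  | |- @GRing.linear_for _ _ _ _ _ => let c := fresh "c" in let x := fresh "x" in
       let y := fresh "y" in move=> c x y /=; lin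
  | |- forall _, _ => move=> ?; lin
  | |- _ => solve [done | lin_step; lin]
  end.

Section Sweedler.
Variables (k : fieldType) (H : hopfAlgType k).
Implicit Types (h x y : H).

Section Rules.
Variable W : lmodType k.
Implicit Types b : H -> H -> W.

Lemma sweedler1 b : bilin b -> sweedler b 1 = b 1 1.
Proof. by move=> [br bl]; rewrite /sweedler (comul1 _ _ br bl) big_seq1. Qed.

Lemma sweedlerM b x y : bilin b ->
  sweedler b (x * y) =
  sweedler (fun m n => sweedler (fun m' n' => b (m * m') (n * n')) y) x.
Proof.
by move=> [br bl]; rewrite /sweedler (comulM x y _ _ br bl) big_allpairs_dep.
Qed.

Lemma sweedlerA (b : H -> H -> H -> W) h : trilin b ->
  sweedler (fun m n => sweedler (fun p q => b p q n) m) h =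
  sweedler (fun m n => sweedler (fun p q => b m p q) n) h.
Proof.
move=> [b3 b2 b1]; have := comulA h _ _ b3 b2 b1.
by rewrite !big_allpairs_dep.
Qed.

Lemma sweedler_sum I (r : seq I) (P : pred I) (b : I -> H -> H -> W) h :
  sweedler (fun m n => \sum_(i <- r | P i) b i m n) h =
  \sum_(i <- r | P i) sweedler (b i) h.
Proof. by rewrite /sweedler exchange_big. Qed.

Lemma sweedlerZ c b h :
  sweedler (fun m n => c *: b m n) h = c *: sweedler b h.
Proof. by rewrite /sweedler scaler_sumr. Qed.

Lemma sweedler_exchange (H' : hopfAlgType k) (b : H -> H -> H' -> H' -> W) x (y : H') :
  sweedler (fun m n => sweedler (b m n) y) x =
  sweedler (fun m' n' => sweedler (fun m n => b m n m' n') x) y.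
Proof. exact: exchange_big. Qed.

Lemma lin_sweedler (W' : lmodType k) (g : W -> W') b h : linear g ->
  g (sweedler b h) = sweedler (fun m n => g (b m n)) h.
Proof. by move=> lg; rewrite /sweedler (lin_sum lg). Qed.

End Rules.

Lemma sweedler_counitl h : sweedler (fun m n => counit m *: n) h = h.
Proof. exact: counitl. Qed.
Lemma sweedler_counitr h : sweedler (fun m n => counit n *: m) h = h.
Proof. exact: counitr. Qed.
Lemma sweedler_antipodel h :
  sweedler (fun m n => antipode m * n) h = (counit h)%:A.
Proof. exact: antipodel. Qed.
Lemma sweedler_antipoder h :
  sweedler (fun m n => m * antipode n) h = (counit h)%:A.
Proof. exact: antipoder. Qed.

End Sweedler.

(** * Antipodes and Hopf maps *)

Section HopfGeneral.
Variable k : fieldType.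

Lemma sweedler_counitr_lin (H : hopfAlgType k) (W : lmodType k) (f : H -> W) h :
  linear f -> sweedler (fun m n => counit n *: f m) h = f h.
Proof.
move=> lf; rewrite -{2}(sweedler_counitr h) (lin_sweedler _ _ lf).
by apply: eq_sweedler => m n; rewrite (lin_scale lf).
Qed.

Lemma sweedler_counitl_lin (H : hopfAlgType k) (W : lmodType k) (f : H -> W) h :
  linear f -> sweedler (fun m n => counit m *: f n) h = f h.
Proof.
move=> lf; rewrite -{2}(sweedler_counitl h) (lin_sweedler _ _ lf).
by apply: eq_sweedler => m n; rewrite (lin_scale lf).
Qed.

(* Both sides are the convolution inverse of the product of H. *)
Lemma antipodeM (H : hopfAlgType k) (x y : H) :
  antipode (x * y) = antipode y * antipode x.
Proof.
(* [T] is the summand of [S(y1) S(x1) x2 y2 S(x3 y3)]. Collapsing [x2 y2 S(x3 y3)] leaves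
   [S(y) S(x)]; after coassociativity, collapsing [S(x1) x2] and then [S(y1) y2] leaves [S(x y)]. *)
pose T (y1 x1 m m' n n' : H) := antipode y1 * (antipode x1 * (m * m' * antipode (n * n'))).
have trT y1 x1 : bilin (fun m n => T y1 x1 m n 1 1) by rewrite /T; lin.
have -> : antipode y * antipode x =
    sweedler (fun x1 x2 => sweedler (fun y1 y2 =>
      sweedler (fun m n => sweedler (fun m' n' => T y1 x1 m m' n n') y2) x2) y) x.
  symmetry; transitivity (sweedler (fun x1 x2 => sweedler (fun y1 y2 =>
      counit y2 *: (counit x2 *: (antipode y1 * antipode x1))) y) x).
    apply: eq_sweedler => x1 x2; apply: eq_sweedler => y1 y2.
    have := sweedler_antipoder (x2 * y2); rewrite sweedlerM; last lin.
    move/(congr1 (fun z => antipode y1 * (antipode x1 * z))).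
    rewrite counitM mulrC -scalerA -!scalerAr mulr1 => <-.
    rewrite (lin_sweedler (g := fun z => antipode y1 * (antipode x1 * z))); last lin.
    apply: eq_sweedler => m n.
    by rewrite (lin_sweedler (g := fun z => antipode y1 * (antipode x1 * z))); last lin.
  transitivity (sweedler (fun x1 x2 => counit x2 *: (antipode y * antipode x1)) x).
    apply: eq_sweedler => x1 x2; rewrite (sweedler_counitr_lin _ (f := fun y1 =>
      counit x2 *: (antipode y1 * antipode x1))) //; lin.
  by rewrite (sweedler_counitr_lin _ (f := fun x1 => antipode y * antipode x1)) //; lin.
transitivity (sweedler (fun x1 x2 => sweedler (fun m n =>
   sweedler (fun y1 y2 => sweedler (fun m' n' => T m' m n n' x2 y2) y1) y) x1) x); last first.
  rewrite (sweedlerA (b := fun m n x2 => sweedler (fun y1 y2 =>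
     sweedler (fun m' n' => T m' m n n' x2 y2) y1) y)); last by rewrite /T; lin.
  apply: eq_sweedler => m n; rewrite [RHS]sweedler_exchange.
  apply: eq_sweedler => n1 x2.
  rewrite (sweedlerA (b := fun m' n' y2 => T m' m n1 n' x2 y2)) //.
  by rewrite /T; lin.
symmetry; transitivity (sweedler (fun x1 x2 => counit x1 *: sweedler (fun y1 y2 =>
   counit y1 *: antipode (x2 * y2)) y) x).
  apply: eq_sweedler => x1 x2; rewrite sweedler_exchange.
  rewrite -sweedlerZ; apply: eq_sweedler => y1 y2.
  transitivity (sweedler (fun m' n' => antipode m' * ((counit x1)%:A * (n' * antipode (x2 * y2)))) y1).
    rewrite sweedler_exchange; apply: eq_sweedler => m' n'.
    rewrite -(sweedler_antipodel x1).
    rewrite (lin_sweedler (g := fun z => antipode m' * (z * (n' * antipode (x2 * y2))))); last lin.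
    by apply: eq_sweedler => m n; rewrite /T !mulrA.
  transitivity (counit x1 *: (sweedler (fun m' n' => antipode m' * n') y1 * antipode (x2 * y2))).
    rewrite (lin_sweedler (g := fun z => z * antipode (x2 * y2))); last lin.
    rewrite -sweedlerZ; apply: eq_sweedler => m' n'.
    by rewrite -scalerAl mul1r -scalerAr mulrA.
  by rewrite sweedler_antipodel -scalerAl mul1r.
rewrite sweedler_counitl_lin; last lin.
by rewrite sweedler_counitl_lin //; lin.
Qed.

Implicit Types A B C : hopfAlgType k.

Lemma sweedler_hopf_map A B (f : A -> B) (W : lmodType k) (b : B -> B -> W) h :
  hopf_map f -> bilin b ->
  sweedler b (f h) = sweedler (fun m n => b (f m) (f n)) h.
Proof.
by case=> _ _ fD _ _ [br bl]; rewrite /sweedler (fD h _ _ br bl) big_map.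
Qed.

(** Compatibility with antipodes is automatic: [f S] and [S f] are both convolution inverses of [f],
    as the two ways of collapsing [f(S h1) f(h2) S(f h3)] show. *)
Lemma hopf_map_of_bialgebra A B (f : A -> B) : linear f -> monoid_morphism f ->
    (forall (W : lmodType k) (b : B -> B -> W) h, bilin b ->
       sweedler b (f h) = sweedler (fun m n => b (f m) (f n)) h) ->
    (forall x, counit (f x) = counit x) -> hopf_map f.
Proof.
move=> lf [f1 fM] fD fe; split=> // [x W b br bl|h].
  by rewrite big_map; exact: fD.
transitivity (sweedler (fun m n => sweedler (fun p q =>
   f (antipode m) * (f p * antipode (f q))) n) h).
  rewrite -{1}(sweedler_counitr_lin h (f := fun m => f (antipode m))); last lin.
  apply: eq_sweedler => m n.
  rewrite -(lin_sweedler (g := fun z => f (antipode m) * z)); last lin.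
  rewrite -(fD _ (fun p q => p * antipode q)); last lin.
  by rewrite sweedler_antipoder fe -scalerAr mulr1.
rewrite -(sweedlerA (b := fun m p q => f (antipode m) * (f p * antipode (f q)))); last lin.
transitivity (sweedler (fun m n => counit m *: antipode (f n)) h); last first.
  by rewrite sweedler_counitl_lin //; lin.
apply: eq_sweedler => m n.
transitivity (f (sweedler (fun p q => antipode p * q) m) * antipode (f n)).
  rewrite (lin_sweedler _ _ lf).
  rewrite (lin_sweedler (g := fun z => z * antipode (f n))); last lin.
  by apply: eq_sweedler => p q; rewrite fM mulrA.
by rewrite sweedler_antipodel (lin_scale lf) f1 -scalerAl mul1r.
Qed.

Lemma hopf_map_comp A B C (f : A -> B) (g : B -> C) :
  hopf_map f -> hopf_map g -> hopf_map (g \o f).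
Proof.
move=> hf hg; have [lf [f1 fM] _ fe _] := hf; have [lg [g1 gM] _ ge _] := hg.
apply: hopf_map_of_bialgebra => [||W b h bb|x] /=; first lin.
- by split=> [|x y] /=; rewrite ?f1 ?g1 ?fM ?gM.
- rewrite (sweedler_hopf_map _ hg bb) (sweedler_hopf_map _ hf) //; lin.
- by rewrite ge fe.
Qed.

Lemma hopf_map_inv A B (f : A -> B) (g : B -> A) :
  hopf_map f -> cancel f g -> cancel g f -> hopf_map g.
Proof.
move=> hf fK gK; have [lf [f1 fM] _ fe _] := hf.
have gin : injective f := can_inj fK.
have lg : linear g by move=> c x y; apply: gin; rewrite lf !gK.
apply: hopf_map_of_bialgebra => // [|W b h bb|x].
- by split=> [|x y]; apply: gin; rewrite ?fM !gK ?f1.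
- rewrite -{2}(gK h) (sweedler_hopf_map (b := fun m n => b (g m) (g n)) _ hf); last lin.
  by apply: eq_sweedler => m n; rewrite !fK.
- by rewrite -[in RHS](gK x) fe.
Qed.

End HopfGeneral.

Section HopfIso.
Variable k : fieldType.
Implicit Types A B C : hopfAlgType k.

Lemma hopf_iso_sym A B : hopf_iso A B -> hopf_iso B A.
Proof.
case=> f hf [g fK gK]; exists g; last by exists f.
exact: (hopf_map_inv hf fK gK).
Qed.

Lemma hopf_iso_trans A B C : hopf_iso A B -> hopf_iso B C -> hopf_iso A C.
Proof.
case=> f hf bf [g hg bg]; exists (g \o f); first exact: hopf_map_comp.
exact: bij_comp.
Qed.

End HopfIso.

(** * Linear functionals on arbitrary vector spaces *)

Section Functional.
Variables (k : fieldType) (V : lmodType k).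

(** A subspace [M] maximal among those avoiding [v] is a complement of the line of [v]; the
    functional is the coefficient of [v] modulo [M]. *)
Lemma exists_functional (v : V) : v != 0 ->
  exists2 phi : V -> k^o, linear phi & phi v = 1.
Proof.
move=> v0.
pose P (S : set V) := (forall (c : k) x y, S x -> S y -> S (c *: x + y)) /\ ~ S v.
have [F FP Ftot|M [[Mlin Mv] Mmax]] := @Zorn_bigcup V P.
  split=> [c x y [S FS Sx] [S' FS' S'y]|[S FS Sv]]; last by case: (FP _ FS).
  have [SS'|S'S] := Ftot _ _ FS FS'.
    by exists S' => //; apply: (FP _ FS').1 => //; exact: SS'.
  by exists S => //; apply: (FP _ FS).1 => //; exact: S'S.
(* The empty set satisfies [P], as the empty chain requires, so [M 0] has to come from
   maximality. *)
have M0 : M 0.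
  apply: contrapT => nM0; apply: (Mmax (M `|` [set 0])%classic).
    split; first by move=> x; left.
    by apply: contra_not nM0; apply; right.
  split=> [c x y|[] // /esym/eqP]; last by rewrite (eq_sym 0) (negPf v0).
  case=> [Mx|->] [My|->]; rewrite ?scaler0 ?add0r ?addr0.
  - by left; apply: Mlin.
  - by exfalso; apply: nM0; have := Mlin (-1) x x Mx Mx; rewrite scaleN1r addNr.
  - by left.
  - by right.
have MZ c x : M x -> M (c *: x) by move=> Mx; rewrite -[_ *: _]addr0; exact: Mlin.
have MD x y : M x -> M y -> M (x + y).
  by move=> Mx My; rewrite -[x]scale1r; exact: Mlin.
(* If [w] is not in [M], then [M + k w] contains [v] by maximality, and the coefficient of [w] in
   [v] is invertible. *)
have ex w : exists c : k, M (w - c *: v).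
  have [Mw|nMw] := EM (M w); first by exists 0; rewrite scale0r subr0.
  pose M' : set V := [set x | exists c : k, M (x - c *: w)]%classic.
  have [[c Mc]|nM'v] := EM (M' v).
    have c0 : c != 0.
      by apply/eqP => c0; apply: Mv; move: Mc; rewrite c0 scale0r subr0.
    exists c^-1; have := MZ (- c^-1) _ Mc.
    by rewrite scalerBr !scaleNr opprK scalerA mulVf // scale1r addrC.
  have [] : ~ P M'.
    apply: Mmax; split.
      by move=> x Mx; exists 0; rewrite scale0r subr0.
    by apply: contra_not nMw; apply; exists 1; rewrite scale1r subrr.
  split=> // c x y [d Md] [e Me]; exists (c * d + e).
  have := Mlin c _ _ Md Me; congr M.
  by rewrite scalerBr scalerA addrACA -opprD -scalerDl.
have uniq w c d : M (w - c *: v) -> M (w - d *: v) -> c = d.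
  move=> Mc Md; apply/eqP; rewrite -subr_eq0; case: (eqVneq (c - d) 0) => // n0.
  case: Mv; have := MZ (c - d)^-1 _ (MD _ _ Md (MZ (-1) _ Mc)).
  by rewrite scaleN1r opprB [X in _ *: X]addrC subrKA -scalerBl scalerA mulVf // scale1r.
pose phi w : k^o := sval (cid (ex w)).
have phiP w : M (w - phi w *: v) by rewrite /phi; case: cid.
exists phi; last by apply: (uniq _ _ _ (phiP v)); rewrite scale1r subrr.
move=> c x y; apply: (uniq _ _ _ (phiP _)).
have := Mlin c _ _ (phiP x) (phiP y); congr M.
by rewrite scalerBr scalerA addrACA -opprD -scalerDl.
Qed.
End Functional.

(** * The model Hopf algebras *)

Definition right_aut_action (cT gT : finGroupType) (act : gT -> cT -> gT) :=
  [/\ forall a, act a 1%g = a,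
      forall a x y, act a (x * y)%g = act (act a x) y
    & forall a b x, act (a * b)%g x = (act a x * act b x)%g].

Section AutAction.
Variables (cT gT : finGroupType) (act : gT -> cT -> gT).
Hypothesis hact : right_aut_action act.

Lemma aact1 a : act a 1%g = a. Proof. by case: hact. Qed.
Lemma aactM a x y : act a (x * y)%g = act (act a x) y. Proof. by case: hact. Qed.
Lemma aactG a b x : act (a * b)%g x = (act a x * act b x)%g.
Proof. by case: hact. Qed.
Lemma aactK x a : act (act a x) x^-1%g = a.
Proof. by rewrite -aactM mulgV aact1. Qed.
Lemma aactKV x a : act (act a x^-1%g) x = a.
Proof. by rewrite -aactM mulVg aact1. Qed.
Lemma aact_inj x : injective (act^~ x).
Proof. by move=> a b e; rewrite -(aactK x a) e aactK. Qed.
Lemma aact1g x : act 1%g x = 1%g.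
Proof. by apply: (mulgI (act 1%g x)); rewrite -aactG !mulg1. Qed.
Lemma aactV a x : act a^-1%g x = (act a x)^-1%g.
Proof. by apply/eqP; rewrite eq_sym eq_invg_mul -aactG mulgV aact1g. Qed.

End AutAction.

(* The smash product of [kC] over [k^G], where the elements [x] of [C] have the
   comultiplication [sum_(a, c) tau_x(a, c) delta_a x (x) delta_c x]; [td_M] and
   [td_A] are its multiplicativity and coassociativity. *)
Record twist_datum (k : fieldType) (cT gT : finGroupType) := TwistDatum {
  td_act : gT -> cT -> gT;
  td_tau : cT -> gT -> gT -> k;
  td_actP : right_aut_action td_act;
  td_neq0 : forall x a b, td_tau x a b != 0;
  td_1l : forall x a, td_tau x 1%g a = 1;
  td_1r : forall x a, td_tau x a 1%g = 1;
  td_M : forall x y a b, td_tau (x * y)%g a b =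
           td_tau x a b * td_tau y (td_act a x) (td_act b x);
  td_A : forall x a b c, td_tau x a b * td_tau x (a * b)%g c =
           td_tau x b c * td_tau x a (b * c)%g
}.

(** [D] occurs in the type so that the structures it determines can be attached to it. A function
    [F] stands for the sum of the [F(a, x) delta_a x]. *)
Definition twisted_hopf (k : fieldType) (cT gT : finGroupType)
  (D : twist_datum k cT gT) := {ffun gT * cT -> k^o}.

Section TwistedHopf.
Variables (k : fieldType) (cT gT : finGroupType) (D : twist_datum k cT gT).
Local Notation A := (twisted_hopf D).
Local Notation act := (td_act D).
Local Notation tau := (td_tau D).
Let hact := td_actP D.

HB.instance Definition _ := GRing.Lmodule.copy A {ffun gT * cT -> k^o}.

Definition tw_elt (a : gT) (x : cT) : A := [ffun z => (z == (a, x))%:R].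
Definition tw_one : A := [ffun z => (z.2 == 1%g)%:R].
Definition tw_mul (f g : A) : A :=
  [ffun z => \sum_x f (z.1, x) * g (act z.1 x, x^-1 * z.2)%g].

Fact tw_mulDl : left_distributive tw_mul +%R.
Proof.
move=> f g h; apply/ffunP=> z; rewrite !ffunE -big_split /=.
by apply: eq_bigr => x _; rewrite !ffunE mulrDl.
Qed.

Fact tw_mulDr : right_distributive tw_mul +%R.
Proof.
move=> f g h; apply/ffunP=> z; rewrite !ffunE -big_split /=.
by apply: eq_bigr => x _; rewrite !ffunE mulrDr.
Qed.

Fact tw_mulA : associative tw_mul.
Proof.
move=> f g h; apply/ffunP=> -[a z]; rewrite !ffunE /=.
under eq_bigr => x _ do rewrite ffunE mulr_sumr /=.
under [RHS]eq_bigr => y _ do rewrite ffunE mulr_suml /=.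
rewrite [RHS]exchange_big; apply: eq_bigr => x _ /=.
rewrite [RHS](reindex_inj (mulgI x)); apply: eq_bigr => y _ /=.
by rewrite mulKg mulrA invMg mulgA (aactM hact).
Qed.

Fact tw_mul1l : left_id tw_one tw_mul.
Proof.
move=> f; apply/ffunP=> -[a z]; rewrite ffunE (bigD1 1%g) //= big1 ?addr0.
  by rewrite ffunE eqxx mul1r invg1 mul1g (aact1 hact).
by move=> x nx; rewrite ffunE (negPf nx) mul0r.
Qed.

Fact tw_mul1r : right_id tw_one tw_mul.
Proof.
move=> f; apply/ffunP=> -[a z]; rewrite ffunE (bigD1 z) //= big1 ?addr0.
  by rewrite ffunE mulVg eqxx mulr1.
by move=> x nx; rewrite ffunE -eq_mulVg1 (negPf nx) mulr0.
Qed.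

Fact tw_one_neq0 : tw_one != 0.
Proof. by apply/eqP => /ffunP/(_ (1, 1)%g)/eqP; rewrite !ffunE eqxx oner_eq0. Qed.

HB.instance Definition _ := GRing.Zmodule_isNzRing.Build A
  tw_mulA tw_mul1l tw_mul1r tw_mulDl tw_mulDr tw_one_neq0.

Fact tw_scalerAl (c : k) (f g : A) : c *: (f * g) = (c *: f) * g.
Proof.
apply/ffunP=> z; rewrite !ffunE scaler_sumr.
by apply: eq_bigr => x _; rewrite ffunE scalerAl.
Qed.
HB.instance Definition _ := GRing.Lmodule_isLalgebra.Build k A tw_scalerAl.

Fact tw_scalerAr (c : k) (f g : A) : c *: (f * g) = f * (c *: g).
Proof.
apply/ffunP=> z; rewrite !ffunE scaler_sumr.
by apply: eq_bigr => x _; rewrite ffunE scalerAr.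
Qed.
HB.instance Definition _ := GRing.Lalgebra_isAlgebra.Build k A tw_scalerAr.

Lemma tw_oneE : 1 = \sum_a tw_elt a 1%g.
Proof.
apply/ffunP=> -[a x]; rewrite sum_ffunE (bigD1 a) //= !ffunE /= xpair_eqE eqxx /=.
by rewrite big1 ?addr0 // => b nb; rewrite !ffunE xpair_eqE eq_sym (negPf nb).
Qed.

Lemma tw_expand (f : A) : f = \sum_a \sum_x f (a, x) *: tw_elt a x.
Proof.
apply/ffunP=> -[a x]; rewrite sum_ffunE (bigD1 a) //= sum_ffunE (bigD1 x) //=.
rewrite !ffunE eqxx /= !big1 ?addr0; first by rewrite [RHS]mulr1.
- by move=> b nb; rewrite sum_ffunE big1 // => y _; rewrite !ffunE xpair_eqE
    [a == b]eq_sym (negPf nb) /=; apply: mulr0.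
- by move=> y ny; rewrite !ffunE xpair_eqE [x == y]eq_sym (negPf ny) andbF; apply: mulr0.
Qed.

Let eq_mulVg_swap (x y z : cT) : (x^-1 * z == y)%g = (z == x * y)%g.
Proof. exact: (can2_eq (mulKVg x) (mulKg x)). Qed.

Lemma tw_eltM a x b y :
  tw_elt a x * tw_elt b y = (act a x == b)%:R *: tw_elt a (x * y)%g.
Proof.
apply/ffunP=> -[c z]; rewrite !ffunE /= (bigD1 x) //= big1 ?addr0.
  rewrite !ffunE !xpair_eqE eqxx andbT; have [->|_] := eqVneq c a; last first.
    by rewrite mul0r [RHS]mulr0.
  rewrite mul1r eq_mulVg_swap; case: (act a x == b) => /=.
    by rewrite scale1r.
  by rewrite scale0r.
by move=> w nw; rewrite ffunE xpair_eqE (negPf nw) andbF mul0r.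
Qed.


Definition tw_comul (f : A) : tens A A :=
  [seq (f (z.1 * z.2.1, z.2.2)%g * tau z.2.2 z.1 z.2.1 *: tw_elt z.1 z.2.2,
        tw_elt z.2.1 z.2.2) | z <- enum {: gT * (gT * cT)}].
Definition tw_counit (f : A) : k := \sum_x f (1%g, x).
(** Forced by the basis: in the antipode axioms only the summands [delta_a x (x) delta_(a^-1) x] of
    the comultiplication survive, and the scalar cancels their coefficient [tau_x(a, a^-1)]; see
    [tw_antipode_elt]. *)
Definition tw_antipode (f : A) : A :=
  [ffun z => f (act z.1^-1%g z.2, z.2^-1%g)
             / tau z.2^-1%g (act z.1^-1%g z.2) (act z.1 z.2)].

Lemma tw_comul_sum (W : lmodType k) (b : A -> A -> W) (f : A) :
  (forall v, linear (b^~ v)) ->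
  \sum_(z <- tw_comul f) b z.1 z.2 =
  \sum_a \sum_c \sum_x
     (f (a * c, x)%g * tau x a c) *: b (tw_elt a x) (tw_elt c x).
Proof.
move=> bl; rewrite big_map big_enum /=.
under [RHS]eq_bigr => a _ do rewrite pair_bigA.
rewrite pair_bigA; apply: eq_bigr => -[a [c x]] _ /=.
by rewrite (lin_scale (bl _)).
Qed.

Lemma tw_comul_elt (W : lmodType k) (b : A -> A -> W) a x :
  (forall v, linear (b^~ v)) ->
  \sum_(z <- tw_comul (tw_elt a x)) b z.1 z.2 =
  \sum_c tau x c (c^-1 * a)%g *: b (tw_elt c x) (tw_elt (c^-1 * a)%g x).
Proof.
move=> bl; rewrite tw_comul_sum //; apply: eq_bigr => c _.
rewrite (bigD1 (c^-1 * a)%g) //= (bigD1 x) //= !big1 ?addr0.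
- by rewrite ffunE mulKVg eqxx mul1r.
- move=> d nd; rewrite big1 // => y _; rewrite ffunE xpair_eqE.
  by rewrite (can2_eq (mulKg c) (mulKVg c)) (negPf nd) mul0r scale0r.
- by move=> y ny; rewrite ffunE xpair_eqE (negPf ny) andbF mul0r scale0r.
Qed.

Lemma td_tau1 a b : tau 1%g a b = 1.
Proof.
have := td_M D 1%g 1%g a b; rewrite mulg1 !(aact1 hact) -{1}[tau _ _ _]mulr1.
by move/(mulfI (td_neq0 D _ _ _)).
Qed.

Fact tw_comul_linear (c : k) (f g : A) :
  tens_eq (tw_comul (c *: f + g))
    ([seq (c *: z.1, z.2) | z <- tw_comul f] ++ tw_comul g).
Proof.
move=> W b br bl; have hb : bilin b by [].
rewrite [LHS]tw_comul_sum // big_cat big_map /=.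
rewrite (tw_comul_sum (b := fun m n => b (c *: m) n)); last lin.
rewrite [X in _ = _ + X]tw_comul_sum //.
rewrite -big_split; apply: eq_bigr => x _; rewrite -big_split.
apply: eq_bigr => y _; rewrite -big_split; apply: eq_bigr => z _ /=.
rewrite !(lin_scale (bl _)) !ffunE scalerA -scalerDl mulrDl; congr ((_ + _) *: _).
by rewrite [RHS]mulrC; exact: (esym (mulrA c _ _)).
Qed.

Fact tw_comul1 : tens_eq (tw_comul 1) [:: (1, 1)].
Proof.
move=> W b br bl; rewrite big_seq1 tw_comul_sum //= {2 3}tw_oneE.
rewrite (lin_sum (bl _)); apply: eq_bigr => a _.
rewrite (lin_sum (br _)); apply: eq_bigr => c _.
rewrite (bigD1 1%g) //= big1 ?addr0; first by rewrite ffunE eqxx td_tau1 mul1r scale1r.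
by move=> x nx; rewrite ffunE (negPf nx) mul0r scale0r.
Qed.

Fact tw_comulM (f g : A) :
  tens_eq (tw_comul (f * g))
    [seq (z.1 * w.1, z.2 * w.2) | z <- tw_comul f, w <- tw_comul g].
Proof.
move=> W b br bl; have hb : bilin b by [].
rewrite [LHS]tw_comul_sum // [RHS]big_allpairs_dep /=.
have h1 m n : bilin (fun m' n' => b (m * m') (n * n')) by lin.
rewrite [RHS](tw_comul_sum (b := fun m n =>
  \sum_(w <- tw_comul g) b (m * w.1) (n * w.2))); last lin.
apply: eq_bigr => a _; apply: eq_bigr => c _.
transitivity (\sum_z \sum_x (f (a * c, x)%g * g (act (a * c)%g x, x^-1 * z)%g
   * tau z a c) *: b (tw_elt a z) (tw_elt c z)).
  by apply: eq_bigr => z _; rewrite ffunE /= mulr_suml scaler_suml.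
rewrite exchange_big; apply: eq_bigr => x _ /=.
rewrite (tw_comul_sum (b := fun m' n' => b (_ * m') (_ * n'))); last by case: (h1 (tw_elt a x) (tw_elt c x)).
rewrite (bigD1 (act a x)) //= (bigD1 (act c x)) //=.
rewrite [X in _ + X + _]big1 ?[X in _ + X]big1 ?addr0.
- rewrite scaler_sumr (reindex_inj (mulgI x)); apply: eq_bigr => y _ /=.
  rewrite mulKg !tw_eltM !eqxx !scale1r scalerA td_M (aactG hact); congr (_ *: _).
  by rewrite -!mulrA; congr (_ * _); rewrite mulrCA.
- move=> d nd; rewrite big1 // => e _; rewrite big1 // => y _.
  by rewrite tw_eltM eq_sym (negPf nd) scale0r (lin_zero (bl _)) scaler0.
- move=> d nd; rewrite big1 // => y _.
  by rewrite [X in b _ X]tw_eltM eq_sym (negPf nd) scale0r (lin_zero (br _)) scaler0.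
Qed.

Fact tw_comulA (f : A) :
  tens3_eq [seq (w.1, w.2, z.2) | z <- tw_comul f, w <- tw_comul z.1]
           [seq (z.1, w.1, w.2) | z <- tw_comul f, w <- tw_comul z.2].
Proof.
move=> W b b3 b2 b1; have hb : trilin b by [].
rewrite [LHS]big_allpairs_dep [RHS]big_allpairs_dep /=.
(* Both iterated comultiplications become sums over triples of basis elements in the same component
   [x]; their coefficients agree by [td_A]. *)
pose E a c d x := b (tw_elt a x) (tw_elt c x) (tw_elt d x).
pose G f a c d x : k := f (a * c * d, x)%g * (tau x (a * c)%g d * tau x a c).
transitivity (\sum_a \sum_c \sum_d \sum_x G f a c d x *: E a c d x).
  transitivity (\sum_u \sum_d \sum_x \sum_a
    (f (u * d, x)%g * tau x u d * tau x a (a^-1 * u)%g) *: E a (a^-1 * u)%g d x).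
    rewrite (tw_comul_sum (b := fun m n =>
      \sum_(w <- tw_comul m) b w.1 w.2 n)); last first.
      move=> v c x y /=.
      have := tw_comul_linear c x y (b := fun m n => b m n v).
      move=> -> //; first by rewrite big_cat big_map /= scaler_sumr; congr (_ + _);
         apply: eq_bigr => z _; rewrite (lin_scale (b1 _ _)).
    apply: eq_bigr => u _; apply: eq_bigr => d _; apply: eq_bigr => x _.
    rewrite (tw_comul_elt (b := fun m n => b m n _)) // scaler_sumr.
    by apply: eq_bigr => a _; rewrite scalerA.
  under eq_bigr => u _ do under eq_bigr => d _ do rewrite exchange_big /=.
  under eq_bigr => u _ do rewrite exchange_big /=.
  rewrite exchange_big; apply: eq_bigr => a _ /=.
  rewrite (reindex_inj (mulgI a)) /=; apply: eq_bigr => c _.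
  by apply: eq_bigr => d _; apply: eq_bigr => x _; rewrite mulKg /G mulrA.
transitivity (\sum_a \sum_u \sum_x \sum_c
    (f (a * u, x)%g * tau x a u * tau x c (c^-1 * u)%g) *: E a c (c^-1 * u)%g x); last first.
  rewrite (tw_comul_sum (b := fun m n =>
    \sum_(w <- tw_comul n) b m w.1 w.2)); last by lin.
  apply: eq_bigr => a _; apply: eq_bigr => u _; apply: eq_bigr => x _.
  rewrite (tw_comul_elt (b := fun m n => b _ m n)) // scaler_sumr.
  by apply: eq_bigr => c _; rewrite scalerA.
symmetry; apply: eq_bigr => a _.
under eq_bigr => u _ do rewrite exchange_big /=.
rewrite exchange_big; apply: eq_bigr => c _ /=.
rewrite (reindex_inj (mulgI c)) /=; apply: eq_bigr => d _.
apply: eq_bigr => x _; rewrite mulKg /G mulgA -mulrA; congr (_ * _ *: _).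
by rewrite [RHS]mulrC td_A mulrC.
Qed.

Lemma tw_counit_elt a x : tw_counit (tw_elt a x) = (a == 1%g)%:R.
Proof.
rewrite /tw_counit (bigD1 x) //= big1 ?addr0.
  by rewrite ffunE xpair_eqE eqxx andbT eq_sym.
by move=> y ny; rewrite ffunE xpair_eqE (negPf ny) andbF.
Qed.

Fact tw_counit_linear (c : k) (f g : A) :
  tw_counit (c *: f + g) = c * tw_counit f + tw_counit g.
Proof.
rewrite /tw_counit mulr_sumr -big_split.
by apply: eq_bigr => x _; rewrite !ffunE.
Qed.

Fact tw_counit1 : tw_counit 1 = 1.
Proof.
rewrite /tw_counit (bigD1 1%g) //= big1 ?addr0; first by rewrite ffunE eqxx.
by move=> x nx; rewrite ffunE (negPf nx).
Qed.

Fact tw_counitM (f g : A) : tw_counit (f * g) = tw_counit f * tw_counit g.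
Proof.
rewrite /tw_counit mulr_suml; under eq_bigr do rewrite ffunE.
rewrite exchange_big; apply: eq_bigr => x _ /=; rewrite mulr_sumr.
rewrite (reindex_inj (mulgI x)); apply: eq_bigr => y _.
by rewrite mulKg (aact1g hact).
Qed.

Fact tw_counitl (f : A) : \sum_(z <- tw_comul f) tw_counit z.1 *: z.2 = f.
Proof.
rewrite (tw_comul_sum (b := fun m n => tw_counit m *: n)); last first.
  by move=> v c x y /=; rewrite tw_counit_linear scalerDl scalerA.
rewrite (bigD1 1%g) //= [X in _ + X]big1 ?addr0.
  rewrite [RHS]tw_expand; apply: eq_bigr => c _; apply: eq_bigr => x _.
  by rewrite tw_counit_elt eqxx scale1r mul1g td_1l mulr1.
move=> a na; rewrite big1 // => c _; rewrite big1 // => x _.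
by rewrite tw_counit_elt (negPf na) scale0r scaler0.
Qed.

Fact tw_counitr (f : A) : \sum_(z <- tw_comul f) tw_counit z.2 *: z.1 = f.
Proof.
rewrite (tw_comul_sum (b := fun m n => tw_counit n *: m)); last by lin.
rewrite [RHS]tw_expand; apply: eq_bigr => a _.
rewrite (bigD1 1%g) //= [X in _ + X]big1 ?addr0.
  apply: eq_bigr => x _.
  by rewrite tw_counit_elt eqxx scale1r mulg1 td_1r mulr1.
move=> c nc; rewrite big1 // => x _.
by rewrite tw_counit_elt (negPf nc) scale0r scaler0.
Qed.

Fact tw_antipode_linear : linear tw_antipode.
Proof.
move=> c f g; apply/ffunP=> z; rewrite !ffunE mulrDl; congr (_ + _).
exact: (esym (mulrA c _ _)).
Qed.

Lemma tw_antipode_elt a x : tw_antipode (tw_elt a x) =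
  (tau x a a^-1%g)^-1 *: tw_elt (act a x)^-1%g x^-1%g.
Proof.
apply/ffunP=> -[b y]; rewrite !ffunE /= !xpair_eqE.
have [->|nx] := eqVneq y x^-1%g; last first.
  by rewrite (can2_eq invgK invgK) (negPf nx) !andbF mul0r [RHS]mulr0.
rewrite !invgK eqxx !andbT.
have -> : (act b^-1%g x^-1%g == a) = (b == (act a x)^-1%g).
  by apply/eqP/eqP => [<-|->]; rewrite ?(aactKV hact) ?invgK ?(aactK hact).
case: eqP => [->|_]; last by rewrite mul0r [RHS]mulr0.
by rewrite invgK (aactV hact) !(aactK hact) mul1r [RHS]mulr1.
Qed.

(** The cocycle identity at [(a, a^-1, a)]. The right antipode axiom meets the scalar with its
    arguments exchanged. *)
Lemma td_tauV x a : tau x a^-1%g a = tau x a a^-1%g.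
Proof. by have := td_A D x a a^-1%g a; rewrite mulgV mulVg td_1l td_1r !mulr1. Qed.

Lemma tw_one_act x : \sum_a tw_elt (act a x)^-1%g 1%g = 1.
Proof.
rewrite tw_oneE [RHS](reindex_inj (h := fun a => (act a x)^-1%g)) //.
by move=> a b /invg_inj /(aact_inj hact).
Qed.

Fact tw_antipodel (f : A) :
  \sum_(z <- tw_comul f) tw_antipode z.1 * z.2 = (tw_counit f)%:A.
Proof.
have la := tw_antipode_linear.
rewrite (tw_comul_sum (b := fun m n => tw_antipode m * n)); last by lin.
transitivity (\sum_a \sum_x f (1%g, x) *: tw_elt (act a x)^-1%g 1%g).
  apply: eq_bigr => a _; rewrite (bigD1 a^-1%g) //= [X in _ + X]big1 ?addr0.
    apply: eq_bigr => x _; rewrite tw_antipode_elt -scalerAl tw_eltM.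
    rewrite (aactV hact) (aactK hact) eqxx scale1r mulgV mulVg scalerA.
    by rewrite mulfK ?td_neq0.
  move=> c nc; rewrite big1 // => x _; rewrite tw_antipode_elt -scalerAl tw_eltM.
  by rewrite (aactV hact) (aactK hact) eq_sym (negPf nc) scale0r !scaler0.
rewrite exchange_big /= scaler_suml; apply: eq_bigr => x _.
by rewrite -scaler_sumr tw_one_act.
Qed.

Fact tw_antipoder (f : A) :
  \sum_(z <- tw_comul f) z.1 * tw_antipode z.2 = (tw_counit f)%:A.
Proof.
have la := tw_antipode_linear.
rewrite (tw_comul_sum (b := fun m n => m * tw_antipode n)); last by lin.
transitivity (\sum_a \sum_x f (1%g, x) *: tw_elt a 1%g).
  apply: eq_bigr => a _; rewrite (bigD1 a^-1%g) //= [X in _ + X]big1 ?addr0.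
    apply: eq_bigr => x _; rewrite tw_antipode_elt -scalerAr tw_eltM.
    rewrite (aactV hact) !invgK eqxx scale1r !mulgV scalerA.
    by rewrite td_tauV mulfK ?td_neq0.
  move=> c nc; rewrite big1 // => x _; rewrite tw_antipode_elt -scalerAr tw_eltM.
  rewrite -(aactV hact) (inj_eq (@aact_inj _ _ _ hact x)) -(can2_eq invgK invgK).
  by rewrite eq_sym (negPf nc) scale0r !scaler0.
rewrite exchange_big /= scaler_suml; apply: eq_bigr => x _.
by rewrite -scaler_sumr tw_oneE.
Qed.

HB.instance Definition _ := Algebra_isHopf.Build k A
  tw_comul_linear tw_comul1 tw_comulM tw_comulA tw_counit_linear
  tw_counit1 tw_counitM tw_counitl tw_counitr tw_antipode_linear
  tw_antipodel tw_antipoder.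

End TwistedHopf.

Section GroupLikeAlgebras.
Variables (k : fieldType) (cT gT : finGroupType).
Local Notation A := (fun_algebra k gT).
Local Notation KC := (group_algebra k cT).

Lemma sweedler_fun (W : lmodType k) (b : A -> A -> W) (f : A) : bilin b ->
  sweedler b f =
  \sum_a \sum_c f (a * c)%g *: b (fun_delta k a) (fun_delta k c).
Proof.
move=> [br bl]; rewrite /sweedler fun_comul_sum.
by apply: eq_bigr => a _; apply: eq_bigr => c _; rewrite (lin_scale (bl _)).
Qed.

Lemma sweedler_group (W : lmodType k) (b : KC -> KC -> W) (f : KC) : bilin b ->
  sweedler b f = \sum_x f x *: b (group_elt k x) (group_elt k x).
Proof.
move=> [br bl]; rewrite /sweedler group_comul_sum.
by apply: eq_bigr => x _; rewrite (lin_scale (bl _)).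
Qed.

Lemma fun_delta_idem (a c : gT) :
  fun_delta k a * fun_delta k c = (a == c)%:R *: fun_delta k a.
Proof. by rewrite fun_delta_mul ffunE. Qed.

Lemma group_eltE (x y : cT) : (group_elt k x : KC) y = (y == x)%:R.
Proof. by rewrite ffunE. Qed.

Lemma group_mulE (f g : KC) z : (f * g) z = \sum_x f x * g (x^-1 * z)%g.
Proof. by rewrite ffunE. Qed.

Lemma counit_group (f : KC) : counit f = \sum_x f x. Proof. by []. Qed.
Lemma counit_fun (f : A) : counit f = f 1%g. Proof. by []. Qed.

Lemma sum_delta (W : lmodType k) (I : finType) (i : I) (F : I -> W) :
  \sum_j (i == j)%:R *: F j = F i.
Proof.
rewrite (bigD1 i) //= eqxx scale1r big1 ?addr0 // => j nj.
by rewrite eq_sym (negPf nj) scale0r.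
Qed.

Lemma sum_delta' (W : lmodType k) (I : finType) (i : I) (F : I -> W) :
  \sum_j (j == i)%:R *: F j = F i.
Proof. by under eq_bigr => j _ do rewrite eq_sym; exact: sum_delta. Qed.

End GroupLikeAlgebras.

(** * Extensions and their generators *)

(* Projections onto the [x]-components of the right and left [kC]-coactions. *)
Definition rcomp (k : fieldType) (cT : finGroupType) (H : hopfAlgType k)
    (pi : H -> group_algebra k cT) (x : cT) (h : H) : H :=
  sweedler (fun m n => (pi n x : k) *: m) h.

Definition lcomp (k : fieldType) (cT : finGroupType) (H : hopfAlgType k)
    (pi : H -> group_algebra k cT) (x : cT) (h : H) : H :=
  sweedler (fun m n => (pi m x : k) *: n) h.

Section Components.
Variables (k : fieldType) (cT : finGroupType) (H : hopfAlgType k).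
Variable pi : H -> group_algebra k cT.
Hypothesis hpi : hopf_map pi.
Local Notation rc := (rcomp pi).
Local Notation lc := (lcomp pi).

Let lpi : linear pi. Proof. by case: hpi. Qed.

Lemma pi_coef_lin x c m n : pi (c *: m + n) x = (c *: (pi m x : k^o) + pi n x : k^o).
Proof. by rewrite lpi ffun_lin. Qed.

Lemma rcomp_linear x : linear (rc x).
Proof. by apply: sweedler_linear; lin. Qed.

Lemma lcomp_linear x : linear (lc x).
Proof. by apply: sweedler_linear; lin. Qed.

Lemma piM x y : pi (x * y) = pi x * pi y. Proof. by case: hpi => _ [_ ->]. Qed.
Lemma pi1 : pi 1 = 1. Proof. by case: hpi => _ [-> _]. Qed.
Lemma counit_pi h : counit (pi h) = counit h. Proof. by case: hpi. Qed.

(** The basis of [kC] consists of group-likes and [pi] is a coalgebra map, so [(pi (x) pi) Delta(h)]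
    has diagonal coefficients only. This makes the components orthogonal projections. *)
Lemma sweedler_pi (W : lmodType k) (F : k -> k -> W) x y h :
  bilin (F : k^o -> k^o -> W) ->
  sweedler (fun m n => F (pi m x) (pi n y)) h =
  F (pi h x) (x == y)%:R.
Proof.
move=> bF; rewrite -(sweedler_hopf_map (b := fun m n : group_algebra k cT => F (m x) (n y)) _ hpi); last first.
  by split=> v c m n /=; rewrite ffun_lin ?(bilinr bF) ?(bilinl bF).
rewrite sweedler_group; last first.
  by split=> v c m n /=; rewrite ffun_lin ?(bilinr bF) ?(bilinl bF).
under eq_bigr => z _ do rewrite !group_eltE -(lin_scale (bF.2 _)) /=.
rewrite (bigD1 x) //= big1 ?addr0 ?eqxx.
  by rewrite [_ *: 1]mulr1 eq_sym.
by move=> z nz; rewrite eq_sym (negPf nz) [_ *: 0]mulr0 (lin_zero (bF.2 _)).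
Qed.

Lemma rcomp_sum h : \sum_x rc x h = h.
Proof.
rewrite -sweedler_sum -[RHS]sweedler_counitr; apply: eq_sweedler => m n.
by rewrite -scaler_suml -counit_group counit_pi.
Qed.

Lemma lcomp_sum h : \sum_x lc x h = h.
Proof.
rewrite -sweedler_sum -[RHS]sweedler_counitl; apply: eq_sweedler => m n.
by rewrite -scaler_suml -counit_group counit_pi.
Qed.

Lemma rcomp_rcomp x y h : rc x (rc y h) = (x == y)%:R *: rc x h.
Proof.
rewrite [rc y h]/rcomp (lin_sweedler _ _ (rcomp_linear x)).
transitivity (sweedler (fun m n => sweedler (fun p q =>
   (pi n y : k) *: ((pi q x : k) *: p)) m) h).
  by apply: eq_sweedler => m n; rewrite (lin_scale (rcomp_linear x)) sweedlerZ.
rewrite (sweedlerA (b := fun p q n => (pi n y : k) *: ((pi q x : k) *: p))); last lin.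
rewrite -sweedlerZ; apply: eq_sweedler => m n.
rewrite (sweedler_pi (F := fun a c => c *: (a *: m))) //; lin.
Qed.

End Components.

Definition transl (k : fieldType) (cT gT : finGroupType) (act : gT -> cT -> gT)
  (x : cT) (f : fun_algebra k gT) : fun_algebra k gT := [ffun a => f (act a x)].

(** The part of an extension that the classification works with. Unlike normality and the
    description of the kernel, it passes directly through isomorphisms and automorphisms of [G];
    [extension_framed] derives it. *)
Record framed (k : fieldType) (cT gT : finGroupType) (H : hopfAlgType k)
    (iota : fun_algebra k gT -> H) (pi : H -> group_algebra k cT) : Prop := {
  fr_iota : hopf_map iota;
  fr_pi : hopf_map pi;
  fr_inj : injective iota;
  fr_triv : forall f, pi (iota f) = (f 1%g : k) *: (1 : group_algebra k cT);
  fr_coinv : forall h, rcomp pi 1%g h = h -> exists f, h = iota f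
}.

(* [comul u = (sum_(a, c) J a c iota(delta_a) (x) iota(delta_c)) (u (x) u)]. *)
Definition twisted_grouplike (k : fieldType) (gT : finGroupType)
    (H : hopfAlgType k) (iota : fun_algebra k gT -> H) (u : H)
    (J : gT -> gT -> k) : Prop :=
  forall (W : lmodType k) (b : H -> H -> W), bilin b ->
    sweedler b u = \sum_a \sum_c
      J a c *: b (iota (fun_delta k a) * u) (iota (fun_delta k c) * u).

Lemma eq_twisted (k : fieldType) (gT : finGroupType) (H : hopfAlgType k)
    (iota : fun_algebra k gT -> H) u J J' :
  (forall a c, J a c = J' a c) ->
  twisted_grouplike iota u J -> twisted_grouplike iota u J'.
Proof.
move=> eJ hu W b hb; rewrite hu //.
by apply: eq_bigr => a _; apply: eq_bigr => c _; rewrite eJ.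
Qed.

Section Twisted.
Variables (k : fieldType) (cT gT : finGroupType) (H : hopfAlgType k).
Variable iota : fun_algebra k gT -> H.
Hypothesis hi : hopf_map iota.
Local Notation e a := (iota (fun_delta k a)).

Let li : linear iota. Proof. by case: hi. Qed.
Lemma iotaM f g : iota (f * g) = iota f * iota g. Proof. by case: hi => _ [_ ->]. Qed.
Lemma iota1 : iota 1 = 1. Proof. by case: hi => _ [-> _]. Qed.
Lemma counit_iota f : counit (iota f) = f 1%g.
Proof. by case: hi => _ _ _ -> _. Qed.
Lemma iota_deltaM a f : e a * iota f = (f a : k) *: e a.
Proof. by rewrite -iotaM fun_delta_mul (lin_scale li). Qed.
Lemma iota_expand f : iota f = \sum_a (f a : k) *: e a.
Proof.
by rewrite {1}[f]fun_expand (lin_sum li); apply: eq_bigr => a _; rewrite (lin_scale li).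
Qed.
Lemma iota_sum1 : \sum_a e a = 1.
Proof. by rewrite -iota1 fun_alg1 (lin_sum li). Qed.

Lemma sweedler_iotaM (W : lmodType k) (b : H -> H -> W) f h : bilin b ->
  sweedler b (iota f * h) = \sum_a \sum_c f (a * c)%g *:
    sweedler (fun m n => b (e a * m) (e c * n)) h.
Proof.
move=> hb; rewrite sweedlerM // (sweedler_hopf_map (b := fun m n =>
  sweedler (fun m' n' => b (m * m') (n * n')) h) _ hi); last lin.
by rewrite sweedler_fun //; lin.
Qed.

Lemma twisted_iotaM J u f (W : lmodType k) (b : H -> H -> W) :
  twisted_grouplike iota u J -> bilin b ->
  sweedler b (iota f * u) = \sum_a \sum_c
    (f (a * c)%g * J a c) *: b (e a * u) (e c * u).
Proof.
move=> hu hb; rewrite sweedler_iotaM //.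
apply: eq_bigr => a _; apply: eq_bigr => c _.
rewrite hu; last lin.
rewrite -scalerA; congr (_ *: _); rewrite (bigD1 a) //= (bigD1 c) //=.
rewrite [X in _ + X + _]big1 ?[X in _ + X]big1 ?addr0.
- by rewrite !mulrA !iota_deltaM !ffunE !eqxx !scale1r.
- move=> d nd; rewrite big1 // => g _.
  by rewrite !mulrA iota_deltaM ffunE eq_sym (negPf nd) scale0r mul0r
    (lin_zero (hb.2 _)) scaler0.
- move=> d nd.
  by rewrite [in X in b _ X]mulrA [in X in b _ X]iota_deltaM ffunE eq_sym
    (negPf nd) scale0r mul0r (lin_zero (hb.1 _)) scaler0.
Qed.

(** Rescaling changes the twist by a coboundary, so only the class of [J] in [H^2(G, k^x)] is
    intrinsic. *)
Lemma twisted_scale J u (f : fun_algebra k gT) : twisted_grouplike iota u J ->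
  (forall a, f a != 0) ->
  twisted_grouplike iota (iota f * u)
    (fun a c => J a c * (f (a * c)%g / (f a * f c))).
Proof.
move=> hu f0 W b hb; rewrite (twisted_iotaM _ hu) //.
apply: eq_bigr => a _; apply: eq_bigr => c _.
rewrite !mulrA !iota_deltaM -!scalerAl (lin_scale (hb.2 _)) (lin_scale (hb.1 _)).
rewrite !scalerA; congr (_ *: _).
by rewrite [LHS]mulrC -!mulrA mulVf ?mulr1 ?mulf_neq0.
Qed.

Lemma twisted_one : twisted_grouplike iota 1 (fun _ _ => 1).
Proof.
move=> W b hb; rewrite sweedler1 // -iota_sum1 (lin_sum (hb.2 _)).
apply: eq_bigr => a _; rewrite (lin_sum (hb.1 _)); apply: eq_bigr => c _.
by rewrite scale1r iota_sum1 !mulr1.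
Qed.

Variable act : gT -> cT -> gT.
Hypothesis hact : right_aut_action act.

Lemma transl_delta x a : transl act x (fun_delta k a) = fun_delta k (act a x^-1%g).
Proof.
apply/ffunP=> c; rewrite !ffunE; congr (_ %:R); congr nat_of_bool.
by apply/eqP/eqP => [<-|->]; rewrite ?(aactK hact) ?(aactKV hact).
Qed.

Lemma transl1 (f : fun_algebra k gT) : transl act 1%g f = f.
Proof. by apply/ffunP=> a; rewrite ffunE (aact1 hact). Qed.

Lemma translM x y (f : fun_algebra k gT) : transl act (x * y)%g f = transl act x (transl act y f).
Proof. by apply/ffunP=> a; rewrite !ffunE (aactM hact). Qed.

Definition commutes_as x u := forall f, u * iota f = iota (transl act x f) * u.

Lemma commutes_asM x y u v :
  commutes_as x u -> commutes_as y v -> commutes_as (x * y)%g (u * v).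
Proof. by move=> hu hv f; rewrite -mulrA hv mulrA hu -mulrA -translM. Qed.

Lemma commutes_asX x u n : commutes_as x u -> commutes_as (x ^+ n)%g (u ^+ n).
Proof.
move=> hu; elim: n => [|n IHn]; first by move=> f; rewrite mul1r mulr1 transl1.
by rewrite expgS exprS; exact: commutes_asM.
Qed.

Lemma commutes_as_iotaM x f u : commutes_as x u -> commutes_as x (iota f * u).
Proof.
move=> hu g; rewrite -mulrA hu !mulrA -!iotaM; congr (iota _ * _).
by apply/ffunP=> a; rewrite !ffunE mulrC.
Qed.

(** Each factor [iota f] is moved left past the powers of [u] before it and picks up one more
    translate; this is the origin of norms and of the operators [phi_i]. *)
Lemma iotaM_exp x f u n : commutes_as x u ->
  (iota f * u) ^+ n = iota [ffun a => \prod_(j < n) f (act a (x ^+ j)%g)] * u ^+ n.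
Proof.
move=> cu; elim: n => [|n IHn].
  rewrite !expr0 mulr1 -iota1; congr iota; apply/ffunP=> a.
  by rewrite !ffunE big_ord0.
rewrite exprSr IHn mulrA -(mulrA (iota _)) (commutes_asX n cu) mulrA.
rewrite -iotaM -mulrA -exprSr; congr (iota _ * _); apply/ffunP=> a.
by rewrite !ffunE big_ord_recr.
Qed.

Lemma twistedM x u v J J' : commutes_as x u ->
  twisted_grouplike iota u J -> twisted_grouplike iota v J' ->
  twisted_grouplike iota (u * v) (fun a c => J a c * J' (act a x) (act c x)).
Proof.
move=> cu hu hv W b hb; rewrite sweedlerM // hu; last lin.
apply: eq_bigr => a _; apply: eq_bigr => c _.
rewrite hv; last lin.
rewrite -scalerA; congr (_ *: _).
have E d d' w : e d * u * (e d' * w) = (act d x == d')%:R *: (e d * (u * w)).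
  rewrite -mulrA [u * _]mulrA cu transl_delta -!mulrA mulrA iota_deltaM ffunE.
  rewrite -scalerAl; congr (_%:R *: _); congr nat_of_bool.
  by apply/eqP/eqP => [->|<-]; rewrite ?(aactK hact) ?(aactKV hact).
transitivity (\sum_d (act a x == d)%:R *: (\sum_d' (act c x == d')%:R *:
   (J' d d' *: b (e a * (u * v)) (e c * (u * v))))); last first.
  by rewrite sum_delta sum_delta.
apply: eq_bigr => d _; rewrite scaler_sumr; apply: eq_bigr => d' _.
rewrite !E (lin_scale (hb.2 _)) (lin_scale (hb.1 _)) !scalerA.
by rewrite -[in LHS]mulrA [in LHS]mulrC.
Qed.

Lemma twistedX x u J n : commutes_as x u -> twisted_grouplike iota u J ->
  twisted_grouplike iota (u ^+ n)
    (fun a c => \prod_(j < n) J (act a (x ^+ j)%g) (act c (x ^+ j)%g)).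
Proof.
move=> cu hu; elim: n => [|n IHn].
  under boolp.eq_fun => a do under boolp.eq_fun => c do rewrite big_ord0.
  exact: twisted_one.
under boolp.eq_fun => a do under boolp.eq_fun => c do rewrite big_ord_recr.
by rewrite exprSr; apply: twistedM => //; exact: commutes_asX.
Qed.

End Twisted.

Section Framed.
Variables (k : fieldType) (cT gT : finGroupType) (H : hopfAlgType k).
Variables (iota : fun_algebra k gT -> H) (pi : H -> group_algebra k cT).
Hypothesis fr : framed iota pi.
Local Notation e a := (iota (fun_delta k a)).
Local Notation rc := (rcomp pi).
Local Notation lc := (lcomp pi).
Let hi := fr_iota fr.
Let hpi := fr_pi fr.
Let li : linear iota. Proof. by case: hi. Qed.
Let lpi : linear pi. Proof. by case: hpi. Qed.

Lemma framed_coef f x : pi (iota f) x = f 1%g * (x == 1%g)%:R.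
Proof. by rewrite (fr_triv fr) !ffunE. Qed.

Lemma pi_iotaM f h x : pi (iota f * h) x = f 1%g * pi h x.
Proof. by rewrite (piM hpi) (fr_triv fr) -scalerAl mul1r ffunE. Qed.

Lemma rcompM z h h' :
  rc z (h * h') = \sum_s rc s h * rc (s^-1 * z)%g h'.
Proof.
have lr := rcomp_linear hpi; rewrite {1}/rcomp sweedlerM; last lin.
transitivity (\sum_s sweedler (fun m n => sweedler (fun m' n' =>
  ((pi n s : k) *: m) * ((pi n' (s^-1 * z)%g : k) *: m')) h') h).
  rewrite -sweedler_sum; apply: eq_sweedler => m n.
  rewrite -sweedler_sum; apply: eq_sweedler => m' n'.
  rewrite (piM hpi) group_mulE scaler_suml; apply: eq_bigr => s _.
  by rewrite -scalerAl -scalerAr scalerA.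
apply: eq_bigr => s _; rewrite /rcomp.
rewrite (lin_sweedler (g := fun y => y * _)); last lin.
apply: eq_sweedler => m n.
by rewrite (lin_sweedler (g := fun y => _ * y)); last lin.
Qed.

Lemma rcomp_iota x f : rc x (iota f) = (x == 1%g)%:R *: iota f.
Proof.
rewrite /rcomp (sweedler_hopf_map _ hi); last lin.
transitivity (sweedler (fun m n => (x == 1%g)%:R *: (counit n *: iota m)) f).
  by apply: eq_sweedler => m n; rewrite framed_coef mulrC -scalerA.
by rewrite sweedlerZ sweedler_counitr_lin.
Qed.

Lemma rcomp1 x : rc x 1 = (x == 1%g)%:R *: 1.
Proof. by rewrite -(iota1 hi) rcomp_iota. Qed.

Lemma rcomp_iotaM x f h : rc x (iota f * h) = iota f * rc x h.
Proof.
rewrite rcompM (bigD1 1%g) //= big1 ?addr0.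
  by rewrite rcomp_iota eqxx scale1r invg1 mul1g.
by move=> s ns; rewrite rcomp_iota (negPf ns) scale0r mul0r.
Qed.

Lemma rcomp_homM x h h' z :
  rc x h = h -> rc z (h * h') = h * rc (x^-1 * z)%g h'.
Proof.
move=> hx; rewrite rcompM (bigD1 x) //= big1 ?addr0 ?hx // => s ns.
by rewrite -hx (rcomp_rcomp hpi) (negPf ns) scale0r mul0r.
Qed.

Lemma rcomp_hom x y h : rc x h = h -> rc y h = (y == x)%:R *: h.
Proof.
move=> hx; rewrite -{1}hx (rcomp_rcomp hpi).
by case: eqP => [->|_]; rewrite ?scale0r // hx.
Qed.

Lemma rcomp_hom_inv x h h' :
  rc x h = h -> h * h' = 1 -> h' * h = 1 -> rc x^-1%g h' = h'.
Proof.
move=> hx hh' h'h; have := rcomp_homM h' 1%g hx.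
rewrite hh' rcomp1 eqxx scale1r mulg1 => /(congr1 (fun y => h' * y)).
by rewrite mulrA h'h mul1r mulr1.
Qed.

(** [h * u'] has degree [x x^-1 = 1], hence is coinvariant: one invertible element of degree [x]
    generates the whole component over [iota(k^G)]. *)
Lemma coinv_factor x h u u' :
  rc x h = h -> rc x u = u -> u * u' = 1 -> u' * u = 1 ->
  exists f, h = iota f * u.
Proof.
move=> hx ux uu' u'u.
have [f ef] : exists f, h * u' = iota f.
  apply: (fr_coinv fr); rewrite (rcomp_homM _ _ hx) mulg1.
  by rewrite (rcomp_hom_inv ux).
by exists f; rewrite -ef -mulrA u'u mulr1.
Qed.

Lemma twisted_rcomp u J x : twisted_grouplike iota u J ->
  (forall a, J a 1%g = 1) -> pi u = group_elt k x -> rc x u = u.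
Proof.
move=> hu J1 pu; rewrite /rcomp hu; last lin.
rewrite -[RHS]mul1r -(iota_sum1 hi) mulr_suml; apply: eq_bigr => a _.
rewrite (bigD1 1%g) //= big1 ?addr0.
  by rewrite J1 scale1r pi_iotaM pu ffunE group_eltE !eqxx mul1r scale1r.
by move=> c nc; rewrite pi_iotaM ffunE eq_sym (negPf nc) mul0r scale0r scaler0.
Qed.

Section ModelMap.
Variable D : twist_datum k cT gT.
Variables (v : cT -> H) (theta : cT -> cT).
Hypotheses (theta_inj : injective theta) (v1 : v 1%g = 1).
Hypothesis vM : forall x y, v (x * y)%g = v x * v y.
Hypothesis vi : forall x, commutes_as iota (td_act D) x (v x).
Hypothesis vD : forall x, twisted_grouplike iota (v x) (td_tau D x).
Hypothesis vpi : forall x, pi (v x) = group_elt k (theta x).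
Local Notation B := (twisted_hopf D).

Definition slice (x : cT) (F : B) : fun_algebra k gT := [ffun a => F (a, x)].
(** The comparison map given by elements [v x] obeying the relations of the model. Their degree is
    [theta x] and not [x], because the generator of a presentation may lie above any nontrivial
    element of [C]. *)
Definition model_map (F : B) : H := \sum_x iota (slice x F) * v x.

Lemma slice_linear x : linear (slice x).
Proof. by move=> c F G; apply/ffunP=> a; rewrite !ffunE. Qed.

Lemma model_map_linear : linear model_map.
Proof. by rewrite /model_map; have ls := slice_linear; lin. Qed.

Lemma slice_elt x a y : slice x (tw_elt D a y) = (x == y)%:R *: fun_delta k a.
Proof.
apply/ffunP=> c; rewrite !ffunE xpair_eqE [X in _ = X]mulrC.
by case: (c == a); rewrite ?mul0r ?mul1r.
Qed.

Lemma model_map_elt a x : model_map (tw_elt D a x) = e a * v x.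
Proof.
rewrite /model_map; under eq_bigr => y _ do
  rewrite slice_elt (lin_scale li) -scalerAl.
exact: sum_delta'.
Qed.

Lemma vK x : v x * v x^-1%g = 1. Proof. by rewrite -vM mulgV. Qed.
Lemma vKV x : v x^-1%g * v x = 1. Proof. by rewrite -vM mulVg. Qed.

Lemma model_map_mul : monoid_morphism model_map.
Proof.
split=> [|F G].
  rewrite tw_oneE (lin_sum model_map_linear); under eq_bigr do rewrite model_map_elt v1 mulr1.
  exact: iota_sum1.
transitivity (\sum_x \sum_y iota (slice x F * transl (td_act D) x (slice y G)) *
    v (x * y)%g).
  rewrite exchange_big /= [LHS](_ : _ = \sum_z \sum_x
     iota (slice x F * transl (td_act D) x (slice (x^-1 * z)%g G)) * v z).
    rewrite exchange_big [RHS]exchange_big /=; apply: eq_bigr => x _.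
    by rewrite (reindex_inj (mulgI x)); apply: eq_bigr => y _; rewrite mulKg.
  rewrite /model_map; apply: eq_bigr => z _; rewrite -mulr_suml -(lin_sum li).
  congr (iota _ * _); apply/ffunP=> a; rewrite !ffunE sum_ffunE.
  by apply: eq_bigr => x _; rewrite !ffunE.
rewrite /model_map mulr_suml; apply: eq_bigr => x _; rewrite mulr_sumr.
apply: eq_bigr => y _.
by rewrite -mulrA [v x * _]mulrA vi -!mulrA -vM mulrA -(iotaM hi).
Qed.

Lemma model_map_comul (W : lmodType k) (b : H -> H -> W) F : bilin b ->
  sweedler b (model_map F) = sweedler (fun m n => b (model_map m) (model_map n)) F.
Proof.
move=> hb; have lh := model_map_linear.
have hb2 : bilin (fun m n => b (model_map m) (model_map n)) by lin.
rewrite [RHS](tw_comul_sum F (b := fun m n => b (model_map m) (model_map n)) hb2.2).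
rewrite [model_map F]/model_map (lin_sum (sweedler_linear hb)).
transitivity (\sum_x \sum_a \sum_c (F (a * c, x)%g * td_tau D x a c) *:
   b (e a * v x) (e c * v x)).
  apply: eq_bigr => x _; rewrite (twisted_iotaM hi _ (vD x)) //.
  by apply: eq_bigr => a _; apply: eq_bigr => c _; rewrite ffunE.
rewrite exchange_big; apply: eq_bigr => a _ /=.
rewrite exchange_big; apply: eq_bigr => c _ /=.
by apply: eq_bigr => x _; rewrite !model_map_elt.
Qed.

Lemma model_map_counit F : counit (model_map F) = counit F.
Proof.
have lc : linear (counit : H -> k^o) by lin.
have -> : counit F = \sum_x F (1%g, x) by [].
rewrite /model_map (lin_sum lc); apply: eq_bigr => x _.
rewrite counitM (counit_iota hi) ffunE -(counit_pi hpi) vpi counit_group.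
rewrite (bigD1 (theta x)) //= big1 ?addr0 ?group_eltE ?eqxx ?mulr1 //.
by move=> y ny; rewrite group_eltE (negPf ny).
Qed.

Lemma v_hom x : rc (theta x) (v x) = v x.
Proof. by apply: (twisted_rcomp (vD x)) => // a; rewrite td_1r. Qed.

Lemma rcomp_model_map x F : rc (theta x) (model_map F) = iota (slice x F) * v x.
Proof.
rewrite /model_map (lin_sum (rcomp_linear hpi _)) (bigD1 x) //= big1 ?addr0.
  by rewrite rcomp_iotaM v_hom.
move=> y ny; rewrite rcomp_iotaM (rcomp_hom _ (v_hom y)).
by rewrite (inj_eq theta_inj) eq_sym (negPf ny) scale0r mulr0.
Qed.

(** Componentwise: [v x] is invertible, and by [coinv_factor] the component of degree [theta x] is
    [iota(k^G) v x]. *)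
Lemma model_map_bij : bijective model_map.
Proof.
have hinj : injective model_map.
  move=> F G eFG; apply/ffunP=> -[a x].
  have := congr1 (fun h => rc (theta x) h * v x^-1%g) eFG.
  rewrite /= !rcomp_model_map -!mulrA vK !mulr1 => /(fr_inj fr)/ffunP/(_ a).
  by rewrite !ffunE.
have [theta' thetaK thetaVK] := injF_bij theta_inj.
have ex h : exists F, model_map F = h.
  have /choice [f ef] : forall x, exists f, rc (theta x) h = iota f * v x.
    move=> x; apply: (coinv_factor (x := theta x) (u' := v x^-1%g)).
    - by rewrite (rcomp_rcomp hpi) eqxx scale1r.
    - exact: v_hom.
    - exact: vK.
    - exact: vKV.
  exists [ffun z => f z.2 z.1]; rewrite /model_map -[RHS](rcomp_sum hpi).
  rewrite [RHS](reindex_inj theta_inj); apply: eq_bigr => x _.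
  by rewrite ef; congr (iota _ * _); apply/ffunP=> a; rewrite !ffunE.
have /choice [g gK] := ex.
by exists g => // F; apply: hinj; rewrite gK.
Qed.

Lemma model_map_iso : hopf_iso B H.
Proof.
exists model_map; last exact: model_map_bij.
apply: hopf_map_of_bialgebra.
- exact: model_map_linear.
- exact: model_map_mul.
- by move=> W b h hb; exact: model_map_comul.
- exact: model_map_counit.
Qed.

End ModelMap.
End Framed.

(** * The models as extensions *)

Section Model.
Variables (k : fieldType) (cT gT : finGroupType) (D : twist_datum k cT gT).
Local Notation B := (twisted_hopf D).
Local Notation kG := (fun_algebra k gT).
Local Notation kC := (group_algebra k cT).
Local Notation act := (td_act D).
Local Notation tau := (td_tau D).
Let hact := td_actP D.

Definition tw_iota (f : kG) : B := [ffun z => (z.2 == 1%g)%:R * f z.1].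
Definition tw_pi (F : B) : kC := [ffun x => F (1%g, x)].
Definition tw_v (x : cT) : B := [ffun z => (z.2 == x)%:R].

Lemma tw_iota_linear : linear tw_iota.
Proof. by move=> c f g; apply/ffunP=> z; rewrite !ffunE mulrDr; congr (_ + _); exact: mulrCA. Qed.

Lemma tw_pi_linear : linear tw_pi.
Proof. by move=> c F G; apply/ffunP=> z; rewrite !ffunE. Qed.

Lemma tw_iota_delta a : tw_iota (fun_delta k a) = tw_elt D a 1%g.
Proof.
apply/ffunP=> -[c x]; rewrite !ffunE xpair_eqE /= andbC.
by case: (x == 1%g); rewrite ?mul1r ?mul0r.
Qed.

Lemma tw_pi_elt a x : tw_pi (tw_elt D a x) = (a == 1%g)%:R *: group_elt k x.
Proof.
apply/ffunP=> y; rewrite !ffunE xpair_eqE eq_sym.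
by case: (a == 1%g); [rewrite [RHS]mul1r | rewrite [RHS]mul0r].
Qed.

Lemma tw_vE x : tw_v x = \sum_a tw_elt D a x.
Proof.
apply/ffunP=> -[a y]; rewrite sum_ffunE (bigD1 a) //= !ffunE /= xpair_eqE eqxx /=.
by rewrite big1 ?addr0 // => b nb; rewrite !ffunE xpair_eqE eq_sym (negPf nb).
Qed.

Lemma tw_iota_v f x : tw_iota f * tw_v x = [ffun z => (z.2 == x)%:R * f z.1].
Proof.
apply/ffunP=> -[a y]; rewrite !ffunE /= (bigD1 1%g) //= big1 ?addr0.
  by rewrite !ffunE eqxx mul1r invg1 mul1g mulrC.
by move=> z nz; rewrite ffunE (negPf nz) !mul0r.
Qed.

Lemma tw_v_iota f x : tw_v x * tw_iota f = tw_iota (transl act x f) * tw_v x.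
Proof.
rewrite tw_iota_v; apply/ffunP=> -[a y]; rewrite !ffunE /= (bigD1 x) //= big1 ?addr0.
  by rewrite !ffunE eqxx mul1r /= -eq_mulVg1 eq_sym.
by move=> z nz; rewrite ffunE (negPf nz) !mul0r.
Qed.

Lemma tw_v1 : tw_v 1%g = 1. Proof. by []. Qed.

Lemma tw_vM x y : tw_v (x * y)%g = tw_v x * tw_v y.
Proof.
apply/ffunP=> -[a z]; rewrite !ffunE /= (bigD1 x) //= big1 ?addr0.
  by rewrite !ffunE eqxx mul1r /= (can2_eq (mulKVg x) (mulKg x)).
by move=> w nw; rewrite ffunE (negPf nw) !mul0r.
Qed.

Lemma sweedler_tw (W : lmodType k) (b : B -> B -> W) F : bilin b ->
  sweedler b F = \sum_a \sum_c \sum_x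
     (F (a * c, x)%g * tau x a c) *: b (tw_elt D a x) (tw_elt D c x).
Proof. by move=> hb; exact: (tw_comul_sum F hb.2). Qed.

Lemma tw_iota_hopf : hopf_map tw_iota.
Proof.
have li := tw_iota_linear.
apply: hopf_map_of_bialgebra => // [|W b f hb|f].
- split=> [|f g]; apply/ffunP=> -[a x]; rewrite !ffunE ?mulr1 //=.
  rewrite (bigD1 1%g) //= big1 ?addr0.
    by rewrite !ffunE eqxx mul1r invg1 mul1g (aact1 hact) mulrCA.
  by move=> y ny; rewrite ffunE (negPf ny) !mul0r.
- rewrite sweedler_tw // sweedler_fun; last lin.
  apply: eq_bigr => a _; apply: eq_bigr => c _.
  rewrite (bigD1 1%g) //= big1 ?addr0.
    by rewrite ffunE eqxx mul1r td_tau1 mulr1 !tw_iota_delta.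
  by move=> y ny; rewrite ffunE (negPf ny) !mul0r scale0r.
- have -> : counit (tw_iota f) = \sum_x tw_iota f (1%g, x) by [].
  rewrite (bigD1 1%g) //= big1 ?addr0; first by rewrite ffunE eqxx mul1r.
  by move=> y ny; rewrite ffunE (negPf ny) !mul0r.
Qed.

Lemma tw_pi_hopf : hopf_map tw_pi.
Proof.
have lp := tw_pi_linear.
apply: hopf_map_of_bialgebra => // [|W b f hb|f].
- split=> [|f g]; apply/ffunP=> x; rewrite !ffunE //=.
  by apply: eq_bigr => y _; rewrite !ffunE (aact1g hact).
- rewrite sweedler_tw; last lin.
  rewrite sweedler_group // [RHS](bigD1 1%g) //= [X in _ = _ + X]big1 ?addr0; last first.
    move=> a na; rewrite big1 // => c _; rewrite big1 // => x _.
    by rewrite tw_pi_elt (negPf na) scale0r (lin_zero (hb.2 _)) scaler0.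
  rewrite [RHS](bigD1 1%g) //= [X in _ = _ + X]big1 ?addr0; last first.
    move=> c nc; rewrite big1 // => x _.
    by rewrite [X in b _ X]tw_pi_elt (negPf nc) scale0r (lin_zero (hb.1 _)) scaler0.
  apply: eq_bigr => x _.
  by rewrite tw_pi_elt eqxx scale1r ffunE mulg1 td_1r mulr1.
- by rewrite counit_group; apply: eq_bigr => x _; rewrite ffunE.
Qed.

Lemma tw_rcomp x F : rcomp tw_pi x F = tw_iota [ffun a => F (a, x)] * tw_v x.
Proof.
have lp := pi_coef_lin tw_pi_hopf.
rewrite /rcomp sweedler_tw; last first.
  by split=> u c m n; rewrite /= ?lp ?scalar_lin ?scale_lin.
transitivity (\sum_a F (a, x) *: tw_elt D a x).
  apply: eq_bigr => a _; rewrite (bigD1 1%g) //= [X in _ + X]big1 ?addr0; last first.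
    move=> c nc; rewrite big1 // => y _.
    by rewrite tw_pi_elt (negPf nc) scale0r !ffunE scale0r scaler0.
  rewrite (bigD1 x) //= [X in _ + X]big1 ?addr0.
    by rewrite tw_pi_elt eqxx scale1r group_eltE eqxx scale1r mulg1 td_1r mulr1.
  move=> y ny; rewrite tw_pi_elt eqxx scale1r group_eltE eq_sym (negPf ny).
  by rewrite scale0r scaler0.
rewrite tw_iota_v; apply/ffunP=> -[a y]; rewrite !ffunE sum_ffunE /=.
rewrite (bigD1 a) //= big1 ?addr0.
  by rewrite !ffunE xpair_eqE eqxx /= mulrC.
by move=> c nc; rewrite !ffunE xpair_eqE eq_sym (negPf nc); exact: mulr0.
Qed.

Lemma tw_framed : framed tw_iota tw_pi.
Proof.
split.
- exact: tw_iota_hopf.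
- exact: tw_pi_hopf.
- move=> f g /ffunP efg; apply/ffunP=> a; have := efg (a, 1%g).
  by rewrite !ffunE eqxx !mul1r.
- by move=> f; apply/ffunP=> x; rewrite !ffunE mulrC.
- by move=> h; rewrite tw_rcomp tw_v1 mulr1 => <-; exists [ffun a => h (a, 1%g)].
Qed.

Lemma tw_v_twisted x : twisted_grouplike tw_iota (tw_v x) (tau x).
Proof.
move=> W b hb; rewrite sweedler_tw //.
apply: eq_bigr => a _; apply: eq_bigr => c _.
rewrite (bigD1 x) //= big1 ?addr0.
  rewrite ffunE eqxx mul1r !tw_iota_v; congr (_ *: b _ _); apply/ffunP=> -[d y].
    by rewrite !ffunE xpair_eqE /= -natrM mulnb andbC.
  by rewrite !ffunE xpair_eqE /= -natrM mulnb andbC.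
by move=> y ny; rewrite ffunE (negPf ny) mul0r scale0r.
Qed.

Lemma tw_pi_v x : tw_pi (tw_v x) = group_elt k x.
Proof. by apply/ffunP=> y; rewrite !ffunE. Qed.

Lemma tw_elt_iota a x f : tw_elt D a x * tw_iota f = (f (act a x) : k) *: tw_elt D a x.
Proof.
have -> : tw_elt D a x = tw_iota (fun_delta k a) * tw_v x.
  by rewrite tw_iota_v; apply/ffunP=> -[c y]; rewrite !ffunE xpair_eqE /= -natrM mulnb andbC.
rewrite -mulrA tw_v_iota mulrA -(iotaM tw_iota_hopf) fun_delta_mul ffunE.
by rewrite (lin_scale tw_iota_linear) -scalerAl.
Qed.

Let iota_sum I (r : seq I) (P : pred I) (F : I -> B) :
  (forall i, exists f, F i = tw_iota f) ->
  exists f, \sum_(i <- r | P i) F i = tw_iota f.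
Proof.
move=> hF; apply: (big_ind (fun h => exists f, h = tw_iota f)) => [|x y [f ->] [g ->]|i _]; last exact: hF.
  by exists 0; rewrite (lin_zero tw_iota_linear).
by exists (f + g); rewrite (lin_add tw_iota_linear).
Qed.

Let iota_elt c a : exists f, c *: tw_elt D a 1%g = tw_iota f.
Proof. by exists (c *: fun_delta k a); rewrite (lin_scale tw_iota_linear) tw_iota_delta. Qed.

Lemma tw_normal : normal_image tw_iota.
Proof.
move=> h f; split.
  rewrite -[X in exists _, X = _]/(sweedler (fun m n => m * tw_iota f * antipode n) h).
  rewrite sweedler_tw; last lin.
  apply: iota_sum => a; apply: iota_sum => c; apply: iota_sum => x.
  rewrite [antipode _]tw_antipode_elt tw_elt_iota -scalerAl -scalerAr tw_eltM mulgV.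
  by rewrite !scalerA; exact: iota_elt.
rewrite -[X in exists _, X = _]/(sweedler (fun m n => antipode m * tw_iota f * n) h).
rewrite sweedler_tw; last lin.
apply: iota_sum => a; apply: iota_sum => c; apply: iota_sum => x.
rewrite [antipode _]tw_antipode_elt -!scalerAl tw_elt_iota -scalerAl tw_eltM mulVg.
by rewrite !scalerA; exact: iota_elt.
Qed.

Lemma tw_kernel h : tw_pi h = 0 <-> augmentation_ideal tw_iota h.
Proof.
have hi := tw_iota_hopf; have hp := tw_pi_hopf.
split=> [h0|[s s0 ->]]; last first.
  rewrite (lin_sum tw_pi_linear) big_seq big1 // => z /s0 z0.
  apply/ffunP=> x; rewrite (pi_iotaM tw_framed) -counit_fun z0 mul0r.
  by rewrite ffunE.
(* [h] is the sum of all [e_a h], and [tw_pi h = 0] says exactly that the term [a = 1] vanishes. *)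
exists [seq (fun_delta k a, h) | a <- enum gT & a != 1%g].
  move=> z /mapP[a]; rewrite mem_filter => /andP[na _] -> /=.
  by rewrite counit_fun ffunE eq_sym (negPf na).
rewrite big_map big_filter big_enum_cond /= -{1}[h]mul1r -(iota_sum1 hi) mulr_suml.
rewrite (bigD1 1%g) //= [X in X + _](_ : _ = 0) ?add0r //.
apply/ffunP=> -[c y]; rewrite !ffunE /= (bigD1 1%g) //= big1 ?addr0.
  rewrite !ffunE eqxx mul1r invg1 mul1g (aact1 hact).
  have [->|_] := eqVneq c 1%g; last by rewrite mul0r.
  by rewrite mul1r; have /ffunP/(_ y) := h0; rewrite !ffunE.
by move=> z nz; rewrite ffunE (negPf nz) !mul0r.
Qed.

Lemma tw_extension : hopf_extension tw_iota tw_pi.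
Proof.
split; [exact: tw_iota_hopf | exact: tw_pi_hopf | | exact: tw_normal | exact: tw_kernel].
split; first exact: (fr_inj tw_framed).
move=> g; exists [ffun z => g z.2]; by apply/ffunP=> x; rewrite !ffunE.
Qed.

Lemma tw_extension_action : extension_action tw_iota tw_pi act.
Proof.
pose gamma (g : kC) : B := [ffun z => g z.2].
pose gamma' (g : kC) : B := [ffun z => g z.2^-1%g].
have lg : linear gamma by move=> c f g; apply/ffunP=> z; rewrite !ffunE.
have lg' : linear gamma' by move=> c f g; apply/ffunP=> z; rewrite !ffunE.
have gE x : gamma (group_elt k x) = tw_v x by apply/ffunP=> z; rewrite !ffunE.
have g'E x : gamma' (group_elt k x) = tw_v x^-1%g.
  by apply/ffunP=> z; rewrite !ffunE (can2_eq invgK invgK).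
have vK x : tw_v x * tw_v x^-1%g = 1 by rewrite -tw_vM mulgV.
have vKV x : tw_v x^-1%g * tw_v x = 1 by rewrite -tw_vM mulVg.
exists gamma, gamma'; split; last first.
  move=> g f.
  rewrite -[RHS]/(sweedler (fun m n => gamma m * tw_iota f * gamma' n) g).
  rewrite sweedler_group; last lin.
  have -> : action_on_functions act g f = \sum_x (g x : k) *: transl act x f.
    by apply/ffunP=> a; rewrite !ffunE sum_ffunE; apply: eq_bigr => x _; rewrite !ffunE.
  rewrite (lin_sum tw_iota_linear); apply: eq_bigr => x _.
  by rewrite (lin_scale tw_iota_linear) gE g'E tw_v_iota -mulrA vK mulr1.
split=> //.
- move=> g W b br bl; have hb : bilin b by [].
  have lp := tw_pi_linear.
  rewrite [LHS]big_map [RHS]big_map.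
  rewrite -[LHS]/(sweedler (fun m n => b m (tw_pi n)) (gamma g)).
  rewrite -[RHS]/(sweedler (fun m n => b (gamma m) n) g).
  rewrite sweedler_tw; last lin.
  rewrite sweedler_group; last lin.
  transitivity (\sum_x \sum_a (g x : k) *: b (tw_elt D a x) (group_elt k x)).
    rewrite [RHS]exchange_big; apply: eq_bigr => a _ /=.
    rewrite (bigD1 1%g) //= [X in _ + X]big1 ?addr0; last first.
      move=> c nc; rewrite big1 // => y _.
      by rewrite tw_pi_elt (negPf nc) scale0r (lin_zero (br _)) scaler0.
    by apply: eq_bigr => x _; rewrite tw_pi_elt eqxx scale1r ffunE td_1r mulr1.
  by apply: eq_bigr => x _; rewrite gE tw_vE (lin_sum (bl _)) scaler_sumr.
- move=> g; rewrite -[LHS]/(sweedler (fun m n => gamma m * gamma' n) g).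
  rewrite sweedler_group; last lin.
  by rewrite counit_group scaler_suml; apply: eq_bigr => x _; rewrite gE g'E vK.
- move=> g; rewrite -[LHS]/(sweedler (fun m n => gamma' m * gamma n) g).
  rewrite sweedler_group; last lin.
  by rewrite counit_group scaler_suml; apply: eq_bigr => x _; rewrite gE g'E vKV.
Qed.

End Model.

(** * Presentations *)

Lemma exists_root (k : closedFieldType) (p : nat) (x : k) : (0 < p)%N ->
  exists y, y ^+ p = x.
Proof.
move=> p0; have [y ey] := solve_monicpoly (fun i => if i == 0%N then x else 0 : k) p0.
exists y; rewrite ey {ey}; case: p p0 => // p _; rewrite big_ord_recl /= expr0 mulr1.
by rewrite big1 ?addr0 // => i _; rewrite mul0r.
Qed.

Section Characters.
Variables (k : fieldType) (cT gT : finGroupType) (t : cT).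
Variable act : gT -> cT -> gT.
Hypothesis hact : right_aut_action act.
Implicit Types (chi : gT -> k) (beta : gT -> gT -> k).

Lemma phi_beta0 beta a c : phi_beta t act 0 beta a c = 1.
Proof. exact: big_ord0. Qed.
Lemma phi_betaS i beta a c : phi_beta t act i.+1 beta a c =
  phi_beta t act i beta a c * beta (act a (t ^+ i)%g) (act c (t ^+ i)%g).
Proof. exact: big_ord_recr. Qed.

Lemma phi_betaD i j beta a c : phi_beta t act (i + j) beta a c =
  phi_beta t act i beta a c *
  phi_beta t act j beta (act a (t ^+ i)%g) (act c (t ^+ i)%g).
Proof.
elim: j => [|j IHj]; first by rewrite addn0 phi_beta0 mulr1.
by rewrite addnS !phi_betaS IHj -mulrA -!(aactM hact) -expgnDr.
Qed.

Lemma dual_phi i chi : dual chi -> dual (phi_chi t act i chi).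
Proof.
case=> n0 mM; split=> [a|a b]; first by apply/prodf_neq0 => j _.
by rewrite -big_split; apply: eq_bigr => j _; rewrite (aactG hact) mM.
Qed.

Lemma dual1 : dual (fun _ : gT => 1 : k).
Proof. by split=> *; rewrite ?mulr1 ?oner_eq0. Qed.

Lemma dualM chi psi : dual chi -> dual psi -> dual (fun a => chi a * psi a).
Proof.
case=> n0 mM [n0' mM']; split=> [a|a b]; first exact: mulf_neq0.
by rewrite mM mM' mulrACA.
Qed.

Lemma dual_1g chi : dual chi -> chi 1%g = 1.
Proof.
by case=> n0 mM; apply: (mulfI (n0 1%g)); rewrite -mM mulg1 mulr1.
Qed.

Lemma Alt_phi i beta : Alt beta -> Alt (phi_beta t act i beta).
Proof.
case=> n0 ml mr m1; split=> [a c|a b c|a b c|a]; first by apply/prodf_neq0 => j _.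
- by rewrite -big_split; apply: eq_bigr => j _; rewrite (aactG hact) ml.
- by rewrite -big_split; apply: eq_bigr => j _; rewrite (aactG hact) mr.
- by apply: big1 => j _; rewrite m1.
Qed.

Lemma AltX n beta : Alt beta -> Alt (fun a b => beta a b ^+ n).
Proof.
case=> n0 ml mr m1; split=> [a c|a b c|a b c|a]; first exact: expf_neq0.
- by rewrite ml exprMn.
- by rewrite mr exprMn.
- by rewrite m1 expr1n.
Qed.

Lemma Alt1l beta a : Alt beta -> beta 1%g a = 1.
Proof.
by case=> n0 ml _ _; apply: (mulfI (n0 1%g a)); rewrite -ml mulg1 mulr1.
Qed.
Lemma Alt1r beta a : Alt beta -> beta a 1%g = 1.
Proof.
by case=> n0 _ mr _; apply: (mulfI (n0 a 1%g)); rewrite -mr mulg1 mulr1.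
Qed.
Lemma Alt_swap beta a c : Alt beta -> beta a c * beta c a = 1.
Proof.
case=> n0 ml mr m1; have := m1 (a * c)%g.
by rewrite ml !mr !m1 mul1r mulr1.
Qed.

Lemma Alt_expl beta a c n : Alt beta -> beta (a ^+ n)%g c = beta a c ^+ n.
Proof.
move=> hb; have [n0 ml mr m1] := hb; elim: n => [|n IHn].
  by rewrite Alt1l.
by rewrite expgS exprS ml IHn.
Qed.

Lemma Alt_order beta a c : Alt beta -> beta a c ^+ #|gT| = 1.
Proof.
by move=> hb; rewrite -Alt_expl // -cardsT expg_cardG ?inE // Alt1l.
Qed.

Hypothesis oddG : odd #|gT|.

(* The unique alternating square root of beta: Alt(G) has odd exponent. *)
Definition half_form beta : gT -> gT -> k :=
  fun a c => beta a c ^+ (#|gT|.+1)./2.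

Lemma half_formK beta a c : Alt beta -> half_form beta a c ^+ 2 = beta a c.
Proof.
(* The exponent inverts 2 modulo [|G|]: doubled it is [|G| + 1], and [beta] takes values in the
   [|G|]-th roots of unity. *)
move=> hb; rewrite -exprM muln2 even_halfK /= ?oddG //.
by rewrite exprS Alt_order // mulr1.
Qed.

Lemma Alt_half beta : Alt beta -> Alt (half_form beta).
Proof. exact: AltX. Qed.

(** Exchanging the arguments inverts an alternating form, so the quotient is the square:
    [half_form beta] is a cocycle with antisymmetrization [beta]. *)
Lemma half_form_div beta a c : Alt beta ->
  half_form beta a c / half_form beta c a = beta a c.
Proof.
move=> hb; have := Alt_swap a c (Alt_half hb); have [n0 _ _ _] := Alt_half hb.
move=> sw; have -> : (half_form beta c a)^-1 = half_form beta a c.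
  by apply: (mulIf (n0 c a)); rewrite mulVf // sw.
by rewrite -expr2 half_formK.
Qed.

Lemma half_form_phi i beta a c :
  phi_beta t act i (half_form beta) a c = half_form (phi_beta t act i beta) a c.
Proof. exact: prodrXl. Qed.

Lemma half_form1 beta : (forall a c, beta a c = 1) -> forall a c, half_form beta a c = 1.
Proof. by move=> b1 a c; rewrite /half_form b1 expr1n. Qed.

Lemma Alt_sym_eq1 beta : Alt beta ->
  (forall a c, half_form beta a c = half_form beta c a) -> forall a c, beta a c = 1.
Proof.
move=> hb s a c; rewrite -half_form_div // s divff //.
by have [n0 _ _ _] := Alt_half hb.
Qed.

Lemma Alt_cocycle beta a b c : Alt beta ->
  beta a b * beta (a * b)%g c = beta b c * beta a (b * c)%g.
Proof. by case=> n0 ml mr _; rewrite ml mr mulrA [RHS]mulrC. Qed.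

End Characters.

Section Presented.
Variables (k : closedFieldType) (cT gT : finGroupType) (t : cT).
Variable act : gT -> cT -> gT.
Local Notation p := #[t]%g.
Hypothesis hact : right_aut_action act.
Hypothesis genT : forall x, exists i, (t ^+ i)%g = x.
Hypothesis pr_p : prime p.
Hypothesis oddG : odd #|gT|.
Implicit Types (chi r : gT -> k) (beta : gT -> gT -> k).

(** [u] acts on [k^G] as [t], while its degree [x0] is left free. This absorbs automorphisms of [C]:
    passing to [u ^+ l], or to an action in the class of [act], changes only [x0] and [iota]. *)
Definition presented (H : hopfAlgType k) chi beta : Prop :=
  exists (iota : fun_algebra k gT -> H) (pi : H -> group_algebra k cT) u x0,
    [/\ framed iota pi, commutes_as iota act t u,
        u ^+ p = iota [ffun a => chi a],
        twisted_grouplike iota u (half_form beta)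
      & pi u = group_elt k x0 /\ x0 != 1%g].

(* [iota r * u] has [p]-th power 1 when [u ^+ p = iota chi]: the crossed product
   becomes a smash product. *)
Definition scaling chi r : Prop :=
  [/\ forall a, r a != 0, r 1%g = 1, forall a x, r (act a x) = r a
    & forall a, r a ^+ p = (chi a)^-1].

Lemma exists_scaling chi : dual_fixed act chi -> exists r, scaling chi r.
Proof.
case=> dchi fchi; have p0 : (0 < p)%N by exact: prime_gt0.
(* Taking [r] as a function of [chi a] alone makes it C-invariant, and choosing 1 as the root of 1
   gives [r 1 = 1]. It need not be a character. *)
have /choice [rho rhoE] : forall x : k, exists y, y ^+ p = x^-1 /\ (x = 1 -> y = 1).
  move=> x; have [->|nx] := eqVneq x 1; first by exists 1; rewrite expr1n invr1.
  by have [y ey] := exists_root x^-1 p0; exists y; split=> // /eqP; rewrite (negPf nx).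
exists (fun a => rho (chi a)); split=> [a||a x|a].
- have := (rhoE (chi a)).1; case: eqP => // ->; rewrite expr0n.
  by rewrite eqn0Ngt p0 => /esym/eqP; rewrite invr_eq0 (negPf (dchi.1 a)).
- by apply: (rhoE _).2; exact: dual_1g.
- by rewrite fchi.
- by case: (rhoE (chi a)).
Qed.

Definition tau_pow r beta i a c : k :=
  phi_beta t act i (half_form beta) a c * (r (a * c)%g / (r a * r c)) ^+ i.

(* [tau_pow r beta i] is the twist of [(iota r * u) ^+ i]. *)
Definition datum_for r beta (D : twist_datum k cT gT) : Prop :=
  td_act D = act /\ forall i a c, td_tau D (t ^+ i)%g a c = tau_pow r beta i a c.

Section Data.
Variables (chi r : gT -> k) (beta : gT -> gT -> k).
Hypotheses (hchi : dual_fixed act chi) (hbeta : Alt_N t act beta).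
Hypothesis (hr : scaling chi r).

Let r0 a : r a != 0. Proof. by case: hr. Qed.
Let rr0 a c : r (a * c)%g / (r a * r c) != 0.
Proof. by rewrite mulf_neq0 // invr_eq0 mulf_neq0. Qed.
Let rfix a x : r (act a x) = r a. Proof. by case: hr. Qed.
Let hb2 : Alt (half_form beta). Proof. by apply: Alt_half; case: hbeta. Qed.

Lemma tau_powD i j a c : tau_pow r beta (i + j) a c =
  tau_pow r beta i a c * tau_pow r beta j (act a (t ^+ i)%g) (act c (t ^+ i)%g).
Proof.
by rewrite /tau_pow (phi_betaD t hact) -(aactG hact) !rfix exprD mulrACA.
Qed.

(** The two factors are trivial separately: [N(beta) = 1], and [r ^+ p = chi^-1] is multiplicative.
    Hence the twist of index [i] depends only on [t ^+ i]. *)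
Lemma tau_pow_order a c : tau_pow r beta p a c = 1.
Proof.
have [dchi _] := hchi; have [c0 cM] := dchi.
rewrite /tau_pow half_form_phi half_form1; last by case: hbeta.
have [_ _ _ rp] := hr.
rewrite mul1r expr_div_n exprMn !rp cM invfM divff //.
by rewrite mulf_neq0 ?invr_eq0.
Qed.

Lemma tau_pow_mod i a c : tau_pow r beta (i %% p) a c = tau_pow r beta i a c.
Proof.
rewrite {2}(divn_eq i p); elim: (i %/ p)%N => [|q IHq]; first by rewrite mul0n.
rewrite mulSn -addnA tau_powD tau_pow_order mul1r expg_order !(aact1 hact).
exact: IHq.
Qed.

Lemma exists_datum : exists D, datum_for r beta D.
Proof.
(* [lg] is a discrete logarithm; by [tau_pow_mod] its choice has no influence. *)
have [lg lgE] := choice genT.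
have lgX i a c : tau_pow r beta (lg (t ^+ i)%g) a c = tau_pow r beta i a c.
  rewrite -tau_pow_mod -[RHS]tau_pow_mod; congr tau_pow.
  by apply/eqP; rewrite -eq_expg_mod_order lgE.
have [b0 bl br b1] := hb2.
have J0 i := Alt_phi t hact i hb2.
have r1 : r 1%g = 1 by case: hr.
have t0 x a c : tau_pow r beta (lg x) a c != 0.
  by rewrite mulf_neq0 ?expf_neq0 //; case: (J0 (lg x)).
have t1l x a : tau_pow r beta (lg x) 1%g a = 1.
  by rewrite /tau_pow (Alt1l _ (J0 _)) mul1g r1 !mul1r divff // expr1n.
have t1r x a : tau_pow r beta (lg x) a 1%g = 1.
  by rewrite /tau_pow (Alt1r _ (J0 _)) mulg1 r1 mul1r mulr1 divff // expr1n.
have tM x y a c : tau_pow r beta (lg (x * y)%g) a c =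
    tau_pow r beta (lg x) a c * tau_pow r beta (lg y) (act a x) (act c x).
  by rewrite -{1}(lgE x) -{1}(lgE y) -expgnDr lgX tau_powD lgE.
have tA x a b c : tau_pow r beta (lg x) a b * tau_pow r beta (lg x) (a * b)%g c =
    tau_pow r beta (lg x) b c * tau_pow r beta (lg x) a (b * c)%g.
  rewrite /tau_pow mulrACA [RHS]mulrACA (Alt_cocycle _ _ _ (J0 _)) -!exprMn.
  congr (_ * _ ^+ _); rewrite mulgA.
  by field; rewrite !r0.
exists (@TwistDatum k cT gT act (fun x => tau_pow r beta (lg x)) hact t0 t1l t1r tM tA).
by split=> // i a c /=; rewrite lgX.
Qed.

Variable D : twist_datum k cT gT.
Hypothesis hD : datum_for r beta D.
Let t_neq1 : t != 1%g.
Proof. by apply/eqP=> t1; move: pr_p; rewrite t1 order1. Qed.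

Let iotaX (H : hopfAlgType k) (iota : fun_algebra k gT -> H) (f : fun_algebra k gT) n :
  hopf_map iota -> iota f ^+ n = iota [ffun a => f a ^+ n].
Proof.
move=> hi; elim: n => [|n IHn].
  by rewrite expr0 -(iota1 hi); congr iota; apply/ffunP=> a; rewrite !ffunE.
by rewrite exprS IHn -(iotaM hi); congr iota; apply/ffunP=> a; rewrite !ffunE exprS.
Qed.

(** Since [r] is C-invariant, [iota r] commutes with [u], and [w = iota r * u] has
    [w ^+ p = chi^-1 chi = 1]. The powers of [w] then satisfy the relations of the model. *)
Lemma presented_iso (H : hopfAlgType k) :
  presented H chi beta -> hopf_iso (twisted_hopf D) H.
Proof.
case=> iota [pi [u [x0 [fr cu up hu [pu x01]]]]].
have hi := fr_iota fr; have hpi := fr_pi fr.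
have [lg lgE] := choice genT.
(* This makes [x -> x0 ^+ lg x], the map from model components to degrees in [H], injective. *)
have ordx0 : #[x0]%g = p.
  apply/eqP; have [i ei] := genT x0.
  have : (#[x0]%g %| p)%N by rewrite -ei orderXdvd.
  move/(prime_nt_dvdP pr_p) => -> //; rewrite order_eq1; exact: x01.
pose f : fun_algebra k gT := [ffun a => r a].
pose w := iota f * u.
have wt : twisted_grouplike iota w
    (fun a c => half_form beta a c * (r (a * c)%g / (r a * r c))).
  apply: (eq_twisted _ (twisted_scale hi hu (f := f) _)) => [a c|a].
    by rewrite !ffunE.
  by rewrite ffunE.
have cw : commutes_as iota act t w by exact: commutes_as_iotaM.
have ff : transl act t f = f by apply/ffunP=> a; rewrite !ffunE.
have wp : w ^+ p = 1.
  rewrite exprMn_comm; last by rewrite /GRing.comm cu ff.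
  rewrite up iotaX // -(iotaM hi) -(iota1 hi); congr iota; apply/ffunP=> a.
  rewrite !ffunE; have [_ _ _ ->] := hr.
  by rewrite mulVf //; have [[? _] _] := hchi.
have wmod i j : (t ^+ i)%g = (t ^+ j)%g -> w ^+ i = w ^+ j.
  move/eqP; rewrite eq_expg_mod_order => /eqP e.
  by rewrite -(expr_mod i wp) e expr_mod.
have pw n : pi (w ^+ n) = group_elt k (x0 ^+ n)%g.
  elim: n => [|n IHn]; first by rewrite expr0 (pi1 hpi).
  rewrite exprS (piM hpi) IHn /w (piM hpi) (fr_triv fr) pu ffunE.
  by have [_ -> _ _] := hr; rewrite scale1r mul1r group_eltM expgS.
apply: (@model_map_iso _ _ _ _ _ _ fr D (fun x => w ^+ lg x) (fun x => x0 ^+ lg x)%g).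
- move=> x y /eqP; rewrite eq_expg_mod_order ordx0 -eq_expg_mod_order !lgE.
  by move/eqP.
- by rewrite (wmod _ 0) ?expr0 // lgE.
- by move=> x y; rewrite -exprD; apply: wmod; rewrite expgnDr !lgE.
- move=> x; rewrite -{1}(lgE x) hD.1; exact: commutes_asX.
- move=> x; apply: (eq_twisted _ (twistedX hi hact (lg x) cw wt)) => a c.
  rewrite -[in RHS](lgE x) hD.2 /tau_pow big_split /=; congr (_ * _).
  under eq_bigr => j _ do rewrite -(aactG hact) !rfix.
  by rewrite prodr_const card_ord.
- by move=> x; rewrite pw.
Qed.

(** Undoes the rescaling: multiplying [tw_v D t] by [r^-1] restores the [p]-th power [chi] and
    removes the coboundary of [r]. *)
Lemma model_presented : presented (twisted_hopf D) chi beta.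
Proof.
have [Dact Dtau] := hD.
have fr := tw_framed D; have hi := fr_iota fr.
pose f : fun_algebra k gT := [ffun a => (r a)^-1].
have cv : commutes_as (@tw_iota _ _ _ D) act t (tw_v D t).
  by move=> g; rewrite tw_v_iota Dact.
have ff : transl act t f = f by apply/ffunP=> a; rewrite !ffunE rfix.
exists (@tw_iota _ _ _ D), (@tw_pi _ _ _ D), (tw_iota D f * tw_v D t), t; split=> //.
- exact: commutes_as_iotaM.
- rewrite exprMn_comm; last by rewrite /GRing.comm cv ff.
  have -> : tw_v D t ^+ p = 1.
    rewrite -[RHS]/(tw_v D 1%g) -(expg_order t); elim: (#[t]%g) => [|n IHn] //.
    by rewrite exprS expgS tw_vM IHn.
  rewrite mulr1 iotaX //; congr tw_iota; apply/ffunP=> a; rewrite !ffunE exprVn.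
  by have [_ _ _ ->] := hr; rewrite invrK.
- apply: (eq_twisted _ (twisted_scale hi (@tw_v_twisted _ _ _ D t) (f := f) _)) => [a c|a].
    have := Dtau 1%N a c; rewrite expg1 => ->; rewrite !ffunE.
    rewrite /tau_pow phi_betaS phi_beta0 mul1r expg0 !(aact1 hact) expr1 -mulrA.
    rewrite -[RHS]mulr1; congr (_ * _).
    by field; rewrite !r0 oner_neq0.
  by rewrite ffunE invr_eq0.
- split=> //; rewrite (piM (fr_pi fr)) (fr_triv fr) ffunE tw_pi_v.
  by have [_ -> _ _] := hr; rewrite invr1 scale1r mul1r.
Qed.

End Data.
End Presented.

Section Transport.
Variables (k : closedFieldType) (cT gT : finGroupType) (t : cT).
Variable act : gT -> cT -> gT.

Lemma framed_iso (H H' : hopfAlgType k) (iota : fun_algebra k gT -> H)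
    (pi : H -> group_algebra k cT) (f : H -> H') (g : H' -> H) :
  hopf_map f -> cancel f g -> cancel g f ->
  framed iota pi -> framed (f \o iota) (pi \o g).
Proof.
move=> hf fK gK fr; have [hi hp inj triv coinv] := fr.
have hg := hopf_map_inv hf fK gK.
split.
- exact: hopf_map_comp hi hf.
- exact: hopf_map_comp hg hp.
- by move=> a b /(can_inj fK) /inj.
- by move=> a /=; rewrite fK triv.
have [lf _ _ _ _] := hf; have [lg _ _ _ _] := hg; have [lp _ _ _ _] := hp.
move=> h; rewrite -{1 2}(gK h) => /(congr1 g); rewrite fK => e.
have [|a ea] := coinv (g h); last by exists a; rewrite /= -ea gK.
rewrite -[RHS]e /rcomp (sweedler_hopf_map _ hf); last lin.
rewrite (lin_sweedler _ _ lg); apply: eq_sweedler => m n /=.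
by rewrite !fK (lin_scale lg) fK.
Qed.

Lemma presented_transport (H H' : hopfAlgType k) chi beta :
  hopf_iso H H' -> presented t act H chi beta -> presented t act H' chi beta.
Proof.
case=> f hf [g fK gK] [iota [pi [u [x0 [fr cu up hu [pu x01]]]]]].
have [lf [f1 fM] _ _ _] := hf.
exists (f \o iota), (pi \o g), (f u), x0; split.
- exact: framed_iso fr.
- by move=> a /=; rewrite -!fM cu.
- rewrite /= -up; elim: (#[t]%g) => [|n IHn]; first by rewrite !expr0 f1.
  by rewrite !exprS fM IHn.
- move=> W b hb; rewrite (sweedler_hopf_map _ hf) // hu; last lin.
  by apply: eq_bigr => a _; apply: eq_bigr => c _ /=; rewrite -!fM.
- by rewrite /= fK.
Qed.

Lemma cocommutative_iso (H H' : hopfAlgType k) :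
  hopf_iso H H' -> cocommutative H -> cocommutative H'.
Proof.
case=> f hf [g fK gK] cH h; rewrite -(gK h) => W b br bl.
have hb : bilin b by [].
have [lf _ _ _ _] := hf.
rewrite big_map -[LHS]/(sweedler b (f (g h))).
rewrite -[RHS]/(sweedler (fun m n => b n m) (f (g h))).
rewrite !(sweedler_hopf_map _ hf) //.
have hb' : bilin (fun m n => b (f m) (f n)) by lin.
have := cH (g h) _ _ hb'.1 hb'.2.
by rewrite big_map.
Qed.

End Transport.

(** * Changing the generator and the embedding *)

Section Changes.
Variables (k : closedFieldType) (cT gT : finGroupType) (t : cT).
Variable act : gT -> cT -> gT.
Local Notation p := #[t]%g.
Hypothesis hact : right_aut_action act.
Hypothesis genT : forall x, exists i, (t ^+ i)%g = x.
Hypothesis pr_p : prime p.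
Hypothesis oddG : odd #|gT|.
Implicit Types (chi psi : gT -> k) (beta : gT -> gT -> k).

Lemma card_gen : #|cT| = p.
Proof.
rewrite -cardsT; congr #|pred_of_set _|; apply/setP=> x; rewrite !inE.
by have [i <-] := genT x; rewrite mem_cycle.
Qed.

Lemma expgp (x : cT) : (x ^+ p = 1)%g.
Proof. by have [i <-] := genT x; rewrite -expgnA mulnC expgnA expg_order expg1n. Qed.

Lemma expg_modp (x : cT) i j : i = j %[mod p] -> (x ^+ i = x ^+ j)%g.
Proof.
by move=> e; rewrite -(expg_mod i (expgp x)) e expg_mod // expgp.
Qed.

(** For [m] prime to [p], the elements [t ^+ (j * m)] enumerate [C], so norms may be computed along
    any generator. *)
Lemma prod_powers (F : cT -> k) m : coprime m p ->
  \prod_(j < p) F (t ^+ (j * m))%g = \prod_x F x.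
Proof.
move=> cop; rewrite (reindex (fun j : 'I_p => t ^+ (j * m))%g) //.
apply: onW_bij; apply: inj_card_bij; last by rewrite card_ord card_gen.
move=> i j /eqP; rewrite eq_expg_mod_order => e; apply/val_inj => /=.
wlog le_ij : i j e / (i <= j)%N => [W|].
  by have [/W->|/ltnW/W->] := leqP i j; rewrite // eq_sym.
move: e; rewrite eq_sym eqn_mod_dvd ?leq_mul // -mulnBl Gauss_dvdl; last first.
  by rewrite coprime_sym.
move=> dv; apply/eqP; rewrite eqn_leq le_ij -subn_eq0; apply: contraLR dv.
rewrite -lt0n => pos; rewrite gtnNdvd //; apply: leq_ltn_trans (ltn_ord j).
exact: leq_subr.
Qed.

Lemma phi_chi_order psi a : phi_chi t act p psi a = \prod_x psi (act a x).
Proof.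
rewrite -(prod_powers (fun x => psi (act a x)) (m := 1)) ?coprime1n //.
by apply: eq_bigr => j _; rewrite muln1.
Qed.

Lemma phi_beta_order beta a c :
  phi_beta t act p beta a c = \prod_x beta (act a x) (act c x).
Proof.
rewrite -(prod_powers (fun x => beta (act a x) (act c x)) (m := 1)) ?coprime1n //.
by apply: eq_bigr => j _; rewrite muln1.
Qed.

Lemma phi_chi_fixed n chi a : dual_fixed act chi -> phi_chi t act n chi a = chi a ^+ n.
Proof.
case=> _ fx; rewrite /phi_chi; under eq_bigr do rewrite fx.
by rewrite prodr_const card_ord.
Qed.

Lemma norm_coset_refl chi : norm_coset t act chi chi.
Proof.
exists (fun _ => 1); first exact: dual1.
by apply/funext=> a; rewrite phi_chi_order big1 ?mulr1.
Qed.

Lemma phi_chiM n chi psi a : phi_chi t act n (fun a => chi a * psi a) a =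
  phi_chi t act n chi a * phi_chi t act n psi a.
Proof. exact: big_split. Qed.

Lemma dualV psi : dual psi -> dual (fun a => (psi a)^-1).
Proof.
case=> n0 mM; split=> [a|a b]; first by rewrite invr_eq0.
by rewrite mM invfM.
Qed.

Lemma norm_coset_shift chi psi : dual psi ->
  norm_coset t act (fun a => chi a * phi_chi t act p psi a) = norm_coset t act chi.
Proof.
move=> dpsi; apply/seteqP; split=> _ [xi dxi <-].
  exists (fun a => psi a * xi a); first exact: dualM.
  by apply/funext=> a; rewrite phi_chiM mulrA.
exists (fun a => (psi a)^-1 * xi a); first exact/dualM/dxi/dualV.
apply/funext=> a; rewrite phi_chiM !phi_chi_order prodfV -mulrA mulrA.
rewrite -[_ * _ * (_ * _)]mulrA [X in _ * X]mulrA divff ?mul1r //.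
by apply/prodf_neq0 => x _; case: dpsi.
Qed.

(** Multiplying [u] by [psi] leaves the twist alone, a character having trivial coboundary, and
    multiplies [u ^+ p] by [N(psi)]: this is why [chi] matters only modulo norms. *)
Lemma presented_norm (H : hopfAlgType k) chi psi beta : dual psi ->
  presented t act H chi beta ->
  presented t act H (fun a => chi a * phi_chi t act p psi a) beta.
Proof.
move=> dpsi [iota [pi [u [x0 [fr cu up hu [pu x01]]]]]].
have [psi0 psiM] := dpsi; have hi := fr_iota fr.
pose f : fun_algebra k gT := [ffun a => psi a].
exists iota, pi, (iota f * u), x0; split=> //.
- exact: commutes_as_iotaM.
- rewrite (iotaM_exp hi hact f p cu).
  rewrite up -(iotaM hi); congr iota; apply/ffunP=> a.
  rewrite !ffunE mulrC; congr (_ * _).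
  by apply: eq_bigr => j _; rewrite ffunE.
- apply: (eq_twisted _ (twisted_scale hi hu (f := f) _)) => [a c|a].
    by rewrite !ffunE psiM divff ?mulr1 // mulf_neq0.
  by rewrite ffunE.
- by rewrite (piM (fr_pi fr)) (fr_triv fr) ffunE (dual_1g dpsi) scale1r mul1r.
Qed.

Section Automorphism.
Variables (lam : {perm gT}) (n l : nat).
Hypothesis lamM : forall a b, lam (a * b)%g = (lam a * lam b)%g.
Hypothesis lam_act : forall a x, lam (act a x) = act (lam a) (x ^+ n)%g.
Hypothesis nl : n * l = 1 %[mod p].

Let lamV a : lam ((lam^-1)%g a) = a. Proof. exact: permKV. Qed.
Let lamK a : (lam^-1)%g (lam a) = a. Proof. exact: permK. Qed.
Let lamVM a b : (lam^-1)%g (a * b)%g = ((lam^-1)%g a * (lam^-1)%g b)%g.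
Proof. by apply: (can_inj lamK); rewrite lamM !lamV. Qed.

Lemma lamV_act a x : (lam^-1)%g (act a x) = act ((lam^-1)%g a) (x ^+ l)%g.
Proof.
apply: (can_inj lamK); rewrite lam_act !lamV -expgnA; congr act.
by rewrite -{1}[x]expg1; apply: expg_modp; rewrite mulnC nl.
Qed.

Let cop_l : coprime l p.
Proof.
rewrite coprime_sym prime_coprime //; apply/negP=> /dvdnP[q eq].
move: nl; rewrite eq mulnA modnMl modn_small ?prime_gt1 //.
Qed.

Definition pull (f : fun_algebra k gT) : fun_algebra k gT := [ffun a => f (lam a)].

Lemma pull_delta a : pull (fun_delta k a) = fun_delta k ((lam^-1)%g a).
Proof.
by apply/ffunP=> c; rewrite !ffunE -(can2_eq lamK lamV).
Qed.

Lemma pull_hopf : hopf_map pull.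
Proof.
have lp : linear pull by move=> c f g; apply/ffunP=> a; rewrite !ffunE.
have lam1 : lam 1%g = 1%g by apply: (mulgI (lam 1%g)); rewrite -lamM !mulg1.
apply: hopf_map_of_bialgebra => // [|W b f hb|f].
- by split=> [|f g]; apply/ffunP=> a; rewrite !ffunE.
- rewrite sweedler_fun // sweedler_fun; last lin.
  rewrite [RHS](reindex_inj (@perm_inj _ lam)); apply: eq_bigr => a _.
  rewrite [RHS](reindex_inj (@perm_inj _ lam)); apply: eq_bigr => c _.
  by rewrite ffunE lamM !pull_delta !lamK.
- by rewrite !counit_fun ffunE lam1.
Qed.

Lemma framed_pull (H : hopfAlgType k) (iota : fun_algebra k gT -> H)
    (pi : H -> group_algebra k cT) : framed iota pi -> framed (iota \o pull) pi.
Proof.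
case=> hi hp inj triv coinv; split=> //.
- exact: hopf_map_comp pull_hopf hi.
- move=> f g /inj /ffunP e; apply/ffunP=> a; have := e ((lam^-1)%g a).
  by rewrite !ffunE lamV.
- move=> f /=; rewrite triv; have := counit_iota pull_hopf f.
  by rewrite counit_fun => ->.
- move=> h /coinv [f ->]; exists [ffun a => f ((lam^-1)%g a)]; congr iota.
  by apply/ffunP=> a; rewrite !ffunE lamK.
Qed.

(** Replace [u] by [u ^+ l] and compose [iota] with the automorphism. Through the old embedding
    [u ^+ l] acts as [t ^+ l]; through the new one it acts as [t ^+ (l * n) = t]. *)
Lemma presented_op (H : hopfAlgType k) chi beta : dual_fixed act chi ->
  presented t act H chi beta ->
  presented t act H (chi_op t act l lam chi) (beta_op t act l lam beta).
Proof.
move=> dchi [iota [pi [u [x0 [fr cu up hu [pu x01]]]]]].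
have hi := fr_iota fr; have hpi := fr_pi fr.
exists (iota \o pull), pi, (u ^+ l), (x0 ^+ l)%g; split.
- exact: framed_pull.
- move=> f /=; rewrite (commutes_asX hact l cu); congr (iota _ * _).
  apply/ffunP=> a; rewrite !ffunE lam_act -expgnA; congr (f (act _ _)).
  by rewrite -[RHS]expg1; apply: expg_modp; rewrite mulnC nl.
- rewrite exprAC up /=.
  have -> m : iota [ffun a => chi a] ^+ m = iota [ffun a => chi a ^+ m].
    elim: m => [|m IHm].
      by rewrite expr0 -(iota1 hi); congr iota; apply/ffunP=> a; rewrite !ffunE.
    by rewrite exprS IHm -(iotaM hi); congr iota; apply/ffunP=> a; rewrite !ffunE exprS.
  congr iota; apply/ffunP=> a; rewrite !ffunE /chi_op phi_chi_fixed //.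
  by rewrite lamK.
- have hl := twistedX hi hact l cu hu; move=> W b hb; rewrite hl //.
  rewrite [RHS](reindex_inj (@perm_inj _ lam)); apply: eq_bigr => a _.
  rewrite [RHS](reindex_inj (@perm_inj _ lam)); apply: eq_bigr => c _ /=.
  rewrite !pull_delta !lamK; congr (_ *: _).
  by rewrite /half_form /beta_op !lamK; exact: prodrXl.
- split; last first.
    apply/eqP=> e; move/eqP: x01; apply.
    have -> : x0 = (x0 ^+ l ^+ n)%g.
      by rewrite -expgnA -{1}[x0]expg1; apply: expg_modp; rewrite mulnC nl.
    by rewrite e expg1n.
  elim: l => [|m IHm]; first by rewrite expr0 (pi1 hpi).
  by rewrite exprS (piM hpi) IHm pu group_eltM expgS.
Qed.

Let prod_shift (F : cT -> k) (y : cT) : \prod_x F (x * y)%g = \prod_x F x.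
Proof. by rewrite [RHS](reindex_inj (mulIg y)). Qed.

Lemma dual_fixed_op chi : dual_fixed act chi ->
  dual_fixed act (chi_op t act l lam chi).
Proof.
move=> dchi; have [[c0 cM] cf] := dchi.
have E a : chi_op t act l lam chi a = chi ((lam^-1)%g a) ^+ l.
  exact: phi_chi_fixed.
split=> [|a x]; last by rewrite !E lamV_act cf.
split=> [a|a b]; rewrite !E ?expf_neq0 //.
by rewrite lamVM cM exprMn.
Qed.

Lemma Alt_N_op beta : Alt_N t act beta -> Alt_N t act (beta_op t act l lam beta).
Proof.
case=> hb bN; have hl := Alt_phi t hact l hb; have [b0 bl br b1] := hl.
split=> [|a c].
  split=> [a c|a b c|a b c|a] //; rewrite /beta_op ?lamVM //.
pose F x := beta (act ((lam^-1)%g a) x) (act ((lam^-1)%g c) x).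
(* For each fixed [i] the elements [t ^+ (j * l) * t ^+ i] run through [C], so the product is a
   power of the original norm. *)
transitivity (\prod_(j < p) \prod_(i < l) F (t ^+ (j * l) * t ^+ i)%g).
  apply: eq_bigr => j _; rewrite /beta_op !lamV_act -expgnA.
  by apply: eq_bigr => i _; rewrite -!(aactM hact).
rewrite exchange_big /= big1 // => i _.
rewrite (prod_powers (fun x => F (x * t ^+ i)%g) cop_l) prod_shift.
by rewrite -[RHS](bN ((lam^-1)%g a) ((lam^-1)%g c)) phi_beta_order.
Qed.

(** Both sides are the [l]-th power of [N(psi)] at [lam^-1 a]. So norms go to norms, and the union
    in [groupX_op] is a single coset. *)
Lemma chi_op_norm psi a :
  chi_op t act l lam (phi_chi t act p psi) a =
  phi_chi t act p (chi_op t act l lam psi) a.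
Proof.
pose F x := psi (act ((lam^-1)%g a) x).
transitivity (\prod_(i < l) \prod_x F x).
  apply: eq_bigr => i _; rewrite phi_chi_order.
  rewrite [RHS](reindex_inj (mulgI (t ^+ i)%g)); apply: eq_bigr => x _.
  by rewrite /F (aactM hact).
transitivity (\prod_(j < p) \prod_(i < l) F (t ^+ (j * l) * t ^+ i)%g).
  rewrite [RHS]exchange_big; apply: eq_bigr => i _ /=.
  by rewrite (prod_powers (fun x => F (x * t ^+ i)%g) cop_l) prod_shift.
apply: eq_bigr => j _; apply: eq_bigr => i _.
by rewrite /F lamV_act -expgnA (aactM hact).
Qed.

Lemma groupX_opE chi beta : dual_fixed act chi ->
  groupX_op t act l lam (norm_coset t act chi, beta) =
  (norm_coset t act (chi_op t act l lam chi), beta_op t act l lam beta).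
Proof.
move=> dchi; congr pair; apply/seteqP; split=> [xi|xi hxi].
  case=> _ [psi dpsi <-].
  have -> : chi_op t act l lam (fun a => chi a * phi_chi t act p psi a) =
     fun a => chi_op t act l lam chi a *
       phi_chi t act p (chi_op t act l lam psi) a.
    by apply/funext=> a; rewrite -chi_op_norm /chi_op phi_chiM.
  rewrite norm_coset_shift //.
  have [n0 mM] := dual_phi t hact l dpsi.
  by split=> [a|a b]; rewrite /chi_op ?lamVM.
by exists chi => //; exact: norm_coset_refl.
Qed.

End Automorphism.
End Changes.

(** * Isomorphisms between models *)

Section Recognition.
Variables (k : closedFieldType) (cT gT : finGroupType) (t : cT).
Variable act : gT -> cT -> gT.
Local Notation p := #[t]%g.
Hypothesis hact : right_aut_action act.
Hypothesis genT : forall x, exists i, (t ^+ i)%g = x.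
Hypothesis pr_p : prime p.
Hypothesis oddG : odd #|gT|.
Hypothesis abG : forall a c : gT, (a * c = c * a)%g.
Implicit Types (beta : gT -> gT -> k).

(** Choose [m i = q p + 1]. Then [phi_(m i) beta = 1] because it splits into blocks [phi_i beta],
    while [phi_p beta = 1] reduces it to [beta]. *)
Lemma phi_beta_eq1 beta i : Alt_N t act beta -> ~~ (p %| i)%N ->
  (forall a c, phi_beta t act i beta a c = 1) -> forall a c, beta a c = 1.
Proof.
case=> hb bN ndiv h1 a c.
have hm m a' c' : phi_beta t act (m * i) beta a' c' = 1.
  elim: m a' c' => [|m IHm] a' c'; first exact: phi_beta0.
  by rewrite mulSn (phi_betaD t hact) h1 IHm mulr1.
have hp q a' c' : phi_beta t act (q * p) beta a' c' = 1.
  elim: q a' c' => [|q IHq] a' c'; first exact: phi_beta0.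
  by rewrite mulSn (phi_betaD t hact) bN IHq mulr1.
have i0 : (0 < i)%N by case: (i) ndiv => //; rewrite dvdn0.
have /(coprimeP _ i0)[[m q] /= e] : coprime i p by rewrite coprime_sym prime_coprime.
have em : (m * i = q * p + 1)%N.
  by rewrite -e subnKC // ltnW // -subn_gt0 e.
have := hm m a c; rewrite em (phi_betaD t hact) hp mul1r phi_betaS phi_beta0 mul1r.
by rewrite mulnC expgnA expg_order expg1n expg0 !(aact1 hact).
Qed.

Variables (chi r : gT -> k) (beta : gT -> gT -> k).
Hypotheses (hchi : dual_fixed act chi) (hbeta : Alt_N t act beta).
Hypotheses (hr : scaling t act chi r).
Variable D : twist_datum k cT gT.
Hypothesis hD : datum_for t act r beta D.
Local Notation B := (twisted_hopf D).
Local Notation tau := (td_tau D).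
Let hb : Alt beta. Proof. by case: hbeta. Qed.
Let r0 a : r a != 0. Proof. by case: hr. Qed.
Let rfix a x : r (act a x) = r a. Proof. by case: hr. Qed.

(** For abelian [G] the coboundary part of the twist is symmetric, so all asymmetry comes from the
    half form. *)
Lemma datum_swap l a c :
  tau (t ^+ l)%g a c * half_form (phi_beta t act l beta) c a =
  tau (t ^+ l)%g c a * half_form (phi_beta t act l beta) a c.
Proof.
rewrite !hD.2 /tau_pow !half_form_phi // [r c * r a]mulrC (abG c a).
by rewrite mulrAC [RHS]mulrAC [X in X * _]mulrC.
Qed.

(** Symmetry of a single [tau x] with [x = t ^+ i] makes [phi_i beta] trivial, and then
    [phi_beta_eq1] applies. *)
Lemma datum_sym x : x != 1%g -> (forall a c, tau x a c = tau x c a) ->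
  forall a c, beta a c = 1.
Proof.
have [i <-] := genT x; move=> ti sym; apply: (@phi_beta_eq1 _ i) => //.
  by rewrite order_dvdn.
have hbi := Alt_phi t hact i hb.
apply: Alt_sym_eq1 => // a c; have := datum_swap i a c.
by rewrite sym => /(mulfI (td_neq0 D _ _ _)).
Qed.

Lemma coord_bilin y z x x' :
  bilin (fun m n : B => m (y, x) * n (z, x') : k^o).
Proof.
by split=> u d m n; rewrite /= !ffunE ?mulrDr ?mulrDl; congr (_ + _);
  rewrite -?scalerAl -?scalerAr.
Qed.

(** Extracts the coefficient of [Delta(F)] at [delta_y x (x) delta_z x']. The facts about foreign
    embeddings below come from computing such a coefficient twice. *)
Lemma tw_coord (F : B) y z x x' :
  sweedler (fun m n : B => m (y, x) * n (z, x') : k^o) F =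
  (x == x')%:R * (F (y * z, x)%g * tau x y z).
Proof.
rewrite sweedler_tw; last exact: coord_bilin.
rewrite (bigD1 y) //= [X in _ + X]big1 ?addr0; last first.
  move=> a na; rewrite big1 // => c _; rewrite big1 // => w _.
  by rewrite !ffunE xpair_eqE eq_sym (negPf na) mul0r scaler0.
rewrite (bigD1 z) //= [X in _ + X]big1 ?addr0; last first.
  move=> c nc; rewrite big1 // => w _.
  by rewrite !ffunE !xpair_eqE [z == c]eq_sym (negPf nc) mulr0 scaler0.
rewrite (bigD1 x) //= big1 ?addr0; last first.
  by move=> w nw; rewrite !ffunE !xpair_eqE [x == w]eq_sym (negPf nw) andbF mul0r scaler0.
rewrite !ffunE !xpair_eqE !eqxx /= mul1r eq_sym [RHS]mulrC.
by [].
Qed.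

Lemma model_cocommutative : cocommutative B -> forall a c, beta a c = 1.
Proof.
move=> coc; apply: (@datum_sym t) => [|a c].
  by apply/eqP=> t1; move: pr_p; rewrite t1 order1.
have := tw_coord (tw_v D t) c a t t; rewrite eqxx mul1r ffunE eqxx mul1r => <-.
have := tw_coord (tw_v D t) a c t t; rewrite eqxx mul1r ffunE eqxx mul1r => <-.
have hbb := coord_bilin a c t t.
rewrite /sweedler (coc _ _ _ hbb.1 hbb.2) big_map.
by apply: eq_bigr => z _; rewrite mulrC.
Qed.

Section Uniqueness.
Variables (chi' : gT -> k) (beta' : gT -> gT -> k).
Variables (iota : fun_algebra k gT -> B) (pi : B -> group_algebra k cT) (u : B) (x0 : cT).
Hypothesis hbeta' : Alt beta'.
Hypothesis beta_neq1 : ~ (forall a c, beta a c = 1).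
Hypothesis fr : framed iota pi.
Hypothesis cu : commutes_as iota act t u.
Hypothesis up : u ^+ p = iota [ffun a => chi' a].
Hypothesis hu : twisted_grouplike iota u (half_form beta').
Hypotheses (pu : pi u = group_elt k x0) (x01 : x0 != 1%g).
Local Notation c_ a := (iota (fun_delta k a)).
Let hi := fr_iota fr.
Let li : linear iota. Proof. by case: hi. Qed.

Lemma delta_coord a y z x : c_ a (y * z, x)%g * tau x y z =
  \sum_d \sum_e (d * e == a)%g%:R * (c_ d (y, x) * c_ e (z, x)).
Proof.
have := tw_coord (c_ a) y z x x; rewrite eqxx mul1r => <-.
rewrite (sweedler_hopf_map _ hi); last exact: coord_bilin.
rewrite sweedler_fun; last by have := coord_bilin y z x x; lin.
by apply: eq_bigr => d _; apply: eq_bigr => e _; rewrite ffunE.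
Qed.

(* iota(k^G) is a cocommutative subcoalgebra, while the x-component of the
   model is not cocommutative for x <> 1. *)
Lemma delta_supp a y x : x != 1%g -> c_ a (y, x) = 0.
Proof.
move=> nx; have [y0 [z0 ns]] : exists y0 z0, tau x y0 z0 != tau x z0 y0.
  apply: contrapT => ne; apply: beta_neq1; apply: (datum_sym nx) => y0 z0.
  by apply/eqP/negPn/negP => h; apply: ne; exists y0, z0.
pose w := (y0 * z0)%g.
(* [Delta(c_ d)] is symmetric as [G] is abelian, so exchanging [y0] and [z0] gives the same
   coefficient; but the two twists differ. *)
have w0 d : c_ d (w, x) = 0.
  have e1 := delta_coord d y0 z0 x; have := delta_coord d z0 y0 x.
  rewrite exchange_big /= -(abG y0) => e2.
  have : c_ d (w, x) * tau x y0 z0 = c_ d (w, x) * tau x z0 y0.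
    rewrite e1 e2; apply: eq_bigr => e _; apply: eq_bigr => f _.
    by rewrite abG [c_ f _ * _]mulrC.
  move/eqP; rewrite -subr_eq0 -mulrBr mulf_eq0 subr_eq0 (negPf ns) orbF.
  by move/eqP.
(* Write [y = w (w^-1 y)]: the coefficient at [y], up to a nonzero twist, is a sum of products each
   having a factor at [w]. *)
have := delta_coord a w (w^-1 * y)%g x; rewrite mulKVg.
rewrite [RHS]big1 => [/eqP|d _]; last by apply: big1 => e _; rewrite w0 mul0r mulr0.
by rewrite mulf_eq0 (negPf (td_neq0 D _ _ _)) orbF => /eqP.
Qed.

Lemma iota_supp f y x : x != 1%g -> iota f (y, x) = 0.
Proof.
move=> nx; rewrite (iota_expand hi) sum_ffunE big1 // => a _.
by rewrite ffunE delta_supp // scaler0.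
Qed.

Lemma iota_mulE f (F : B) y x : (iota f * F) (y, x) = iota f (y, 1%g) * F (y, x).
Proof.
rewrite ffunE /= (bigD1 1%g) //= big1 ?addr0.
  by rewrite invg1 mul1g (aact1 (td_actP D)).
by move=> w nw; rewrite iota_supp // mul0r.
Qed.

(** The values of the [c_ a] at [(y, 1)] are orthogonal idempotents of [k] with sum 1, so exactly
    one of them is 1. An [a] missed by [mu] would give [c_ a = 0]; hence [mu] is onto, and injective
    by finiteness. *)
Lemma exists_index : exists mu : gT -> gT,
  injective mu /\ forall f y, iota f (y, 1%g) = f (mu y).
Proof.
have gM a c y : c_ a (y, 1%g) * c_ c (y, 1%g) = (a == c)%:R * c_ a (y, 1%g).
  by rewrite -iota_mulE -(iotaM hi) fun_delta_idem (lin_scale li) ffunE.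
have /choice [mu muP] : forall y, exists a, c_ a (y, 1%g) = 1.
  move=> y; apply: contrapT => ne.
  have g0 a : c_ a (y, 1%g) = 0.
    have [//|n0] := eqVneq (c_ a (y, 1%g)) 0.
    case: ne; exists a; apply: (mulIf n0).
    by rewrite gM eqxx.
  have := congr1 (fun F : B => F (y, 1%g)) (iota_sum1 hi).
  rewrite sum_ffunE big1 // ffunE eqxx => /esym/eqP.
  by rewrite oner_eq0.
have gE c y : c_ c (y, 1%g) = (mu y == c)%:R.
  by rewrite -[LHS]mul1r -(muP y) gM muP mulr1.
have iE f y : iota f (y, 1%g) = f (mu y).
  rewrite (iota_expand hi) sum_ffunE.
  under eq_bigr => a _ do rewrite ffunE gE.
  rewrite (bigD1 (mu y)) //= big1 ?addr0 ?eqxx ?[_ *: 1]mulr1 // => a na.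
  by rewrite eq_sym (negPf na) [_ *: 0]mulr0.
exists mu; split=> //.
have /choice [s muK] : forall a, exists y, mu y = a.
  move=> a; apply: contrapT => ne.
  have : c_ a = iota 0.
    rewrite (lin_zero li); apply/ffunP=> -[y x]; rewrite [RHS]ffunE.
    have [->|nx] := eqVneq x 1%g; last exact: delta_supp.
    by rewrite gE; case: eqP => // e; case: ne; exists y.
  move/(fr_inj fr)/ffunP/(_ a); rewrite !ffunE eqxx => /eqP.
  by rewrite oner_eq0.
have [s' sK s'K] := injF_bij (can_inj muK).
have muE y : mu y = s' y by rewrite -{1}(s'K y) muK.
by move=> y z; rewrite !muE => /(can_inj s'K).
Qed.

Section Index.
Variable mu : gT -> gT.
Hypothesis mu_inj : injective mu.
Hypothesis muE : forall f y, iota f (y, 1%g) = f (mu y).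

Lemma muM y z : mu (y * z)%g = (mu y * mu z)%g.
Proof.
have := delta_coord (mu (y * z)%g) y z 1%g.
rewrite muE ffunE eqxx td_tau1 mulr1.
under eq_bigr => d _ do under eq_bigr => e _ do rewrite !muE !ffunE.
rewrite (bigD1 (mu y)) //= [X in _ + X]big1 ?addr0; last first.
  move=> d nd; rewrite big1 // => e _.
  by rewrite [mu y == d]eq_sym (negPf nd) mul0r mulr0.
rewrite (bigD1 (mu z)) //= [X in _ + X]big1 ?addr0; last first.
  by move=> e ne; rewrite [mu z == e]eq_sym (negPf ne) !mulr0.
rewrite !eqxx !mulr1; case: eqP => [->//|_] /eqP.
by rewrite oner_eq0.
Qed.

Lemma u_coord y z x x' :
  (x == x')%:R * (u (y * z, x)%g * tau x y z) =
  half_form beta' (mu y) (mu z) * (u (y, x) * u (z, x')).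
Proof.
rewrite -tw_coord hu; last exact: coord_bilin.
under eq_bigr => a _ do under eq_bigr => c _ do rewrite !iota_mulE !muE !ffunE.
rewrite (bigD1 (mu y)) //= [X in _ + X]big1 ?addr0; last first.
  move=> d nd; rewrite big1 // => e _.
  by rewrite [mu y == d]eq_sym (negPf nd) !mul0r; exact: mulr0.
rewrite (bigD1 (mu z)) //= [X in _ + X]big1 ?addr0; last first.
  by move=> e ne; rewrite [mu z == e]eq_sym (negPf ne) mul0r mulr0; exact: mulr0.
by rewrite !eqxx !mul1r.
Qed.

(** [Delta] of the model has no terms mixing two components, so the twisted group-like [u] lives in
    one. Its coefficients there are nonzero because [u (1, x) = counit u = 1] is proportional to
    [u (y, x) * u (y^-1, x)]. The component is not that of 1, since [u] would then lie in
    [iota(k^G)], against [x0 <> 1]. *)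
Lemma u_shape : exists x (g : fun_algebra k gT),
  [/\ forall y, g y != 0, u = tw_iota D g * tw_v D x & x != 1%g].
Proof.
have hh := Alt_half hbeta'; have [h0 _ _ _] := hh.
have eu : \sum_x u (1%g, x) = 1.
  transitivity (counit u) => //.
  by rewrite -(counit_pi (fr_pi fr)) pu counit_group; under eq_bigr do
    rewrite group_eltE; rewrite (bigD1 x0) //= eqxx big1 ?addr0 // => y /negPf ->.
have [x ux] : exists x, u (1%g, x) != 0.
  apply: contrapT => ne; move: eu; rewrite big1 => [/esym/eqP|x _].
    by rewrite oner_eq0.
  by apply/eqP/negPn/negP => h; apply: ne; exists x.
have ux0 z x' : x' != x -> u (z, x') = 0.
  move=> nx; have := u_coord 1%g z x x'; rewrite eq_sym (negPf nx) mul0r.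
  move/esym/eqP; rewrite !mulf_eq0 (negPf (h0 _ _)) (negPf ux) /=.
  by move/eqP.
have ux1 : u (1%g, x) = 1.
  by rewrite -eu (bigD1 x) //= big1 ?addr0 // => x' /ux0 ->.
pose g : fun_algebra k gT := [ffun y => u (y, x)].
have uE : u = tw_iota D g * tw_v D x.
  rewrite tw_iota_v; apply/ffunP=> -[y x']; rewrite !ffunE /=.
  by case: eqP => [->|/eqP/ux0 ->]; rewrite ?mul1r ?mul0r.
exists x, g; split=> //.
  move=> y; rewrite ffunE; apply/eqP=> uy; have := u_coord y y^-1%g x x.
  rewrite uy mul0r mulr0 mulgV ux1 eqxx !mul1r => /eqP.
  by rewrite (negPf (td_neq0 D _ _ _)).
apply/eqP=> ex; have [nu nuK nuKV] := injF_bij mu_inj.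
have eqi : u = iota [ffun y => g (nu y)].
  rewrite uE ex tw_v1 mulr1; apply/ffunP=> -[y x'].
  have [->|nx] := eqVneq x' 1%g; last first.
    by rewrite iota_supp // ffunE (negPf nx) mul0r.
  by rewrite muE !ffunE eqxx mul1r nuK.
move: pu; rewrite eqi (fr_triv fr) => /ffunP /(_ x0).
rewrite !ffunE eqxx (negPf x01) => /esym/eqP.
by rewrite [_ *: 0]mulr0 oner_eq0.
Qed.

Lemma recognition_index : exists (lam : {perm gT}) (n l : nat) (psi : gT -> k),
  [/\ forall a b, lam (a * b)%g = (lam a * lam b)%g,
      forall a x, lam (act a x) = act (lam a) (x ^+ n)%g,
      (0 < l < p)%N && (n * l == 1 %[mod p]),
      dual psi
    & chi' = (fun a => chi_op t act l lam chi a * phi_chi t act p psi a)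
      /\ beta' = beta_op t act l lam beta].
Proof.
have [x [g [g0 uE nx]]] := u_shape.
(* The exponent [l] of the operation is the index of the component containing [u]; [n] is its
   inverse modulo [p]. *)
have [j ej] := genT x; pose l := (j %% p)%N.
have el : (t ^+ l)%g = x by rewrite expg_mod_order.
have lp : (l < p)%N by rewrite ltn_mod prime_gt0.
have l0 : (0 < l)%N.
  by rewrite lt0n; apply/eqP=> l0; move/eqP: nx; rewrite -el l0.
have cop : coprime l p.
  by rewrite coprime_sym prime_coprime // gtnNdvd.
have /(coprimeP _ l0)[[n q] /= e] := cop.
have nl : (n * l = 1 %[mod p])%N.
  have -> : (n * l = q * p + 1)%N by rewrite -e subnKC // ltnW // -subn_gt0 e.
  by rewrite modnMDl.
have Dact : td_act D = act by case: hD.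
(* Compare the coefficients at [(y, x)] in the commutation rule of [u] with the delta function at
   [mu (act y x)]. *)
have act_mu y : mu (act y x) = act (mu y) t.
  have := cu (fun_delta k (mu (act y x))); move/ffunP/(_ (y, x)).
  rewrite iota_mulE muE !ffunE /= (bigD1 x) //= [X in X + _ = _ -> _](_ : _ = u (y, x)).
    rewrite big1 ?addr0; last first.
      move=> w nw; rewrite uE tw_iota_v ffunE /= (negPf nw) !mul0r.
      by [].
    rewrite uE tw_iota_v ffunE /= eqxx mul1r => /eqP.
    rewrite -{1}[g y]mul1r (inj_eq (mulIf (g0 y))).
    by have [->|_] := eqVneq (act (mu y) t) (mu (act y x)); rewrite // oner_eq0.
  by rewrite mulVg muE Dact ffunE eqxx mulr1.
pose lam := perm mu_inj.
have lamE a : lam a = mu a by rewrite permE.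
have lamM a b : lam (a * b)%g = (lam a * lam b)%g by rewrite !lamE muM.
have act_muX y i : mu (act y (x ^+ i)%g) = act (mu y) (t ^+ i)%g.
  elim: i y => [|i IHi] y; first by rewrite !expg0 !(aact1 hact).
  by rewrite !expgS !(aactM hact) IHi act_mu.
have lam_act a y : lam (act a y) = act (lam a) (y ^+ n)%g.
  have [i <-] := genT y; rewrite !lamE -expgnA mulnC -act_muX; congr (mu (act _ _)).
  rewrite -el -expgnA; apply: (expg_modp genT).
  by rewrite mulnA [(l * n)%N]mulnC -modnMml nl modnMml mul1n.
have hh := Alt_half hbeta'; have [h0 _ _ _] := hh.
have ux y : u (y, x) = g y by rewrite uE tw_iota_v ffunE eqxx mul1r.
have rel y z : g (y * z)%g * tau x y z = half_form beta' (mu y) (mu z) * (g y * g z).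
  by have := u_coord y z x x; rewrite eqxx mul1r !ux.
have hbl := Alt_phi t hact l hb.
(* Dividing [rel] by the same relation with [y] and [z] exchanged cancels [g]; what remains are the
   alternations of the two twists. *)
have betaE y z : beta' (mu y) (mu z) = phi_beta t act l beta y z.
  rewrite -half_form_div // -[RHS]half_form_div //.
  have [hl0 _ _ _] := Alt_half hbl.
  have sw := datum_swap l y z; rewrite el in sw.
  have r1 := rel y z; have r2 := rel z y; rewrite (abG z y) [g z * _]mulrC in r2.
  have gg : g y * g z != 0 by rewrite mulf_neq0.
  have gyz := g0 (y * z)%g.
  apply/eqP; rewrite eqr_div ?h0 ?hl0 //; apply/eqP.
  apply: (mulIf gg); rewrite mulrAC -r1 -mulrA sw -[RHS]mulrA -r2.
  by rewrite mulrA [RHS]mulrC.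
have halfE y z : half_form beta' (mu y) (mu z) = half_form (phi_beta t act l beta) y z.
  by rewrite /half_form betaE.
(* If [u0] is the generator of the model with [u0 ^+ p = chi], then [tw_v D t] is [r u0], so
   [u = g tw_v D x] equals [(g r^l) u0^l]. The sought character is therefore [g r^l], transported by
   [lam]. *)
pose G y : k := g y * r y ^+ l.
have dG : dual G.
  split=> [y|y z]; first by rewrite mulf_neq0 ?expf_neq0.
  have := rel y z; rewrite halfE -el hD.2 /tau_pow half_form_phi //.
  have [hl0 _ _ _] := Alt_half hbl; rewrite mulrCA => /(mulfI (hl0 _ _)) e1.
  by rewrite /G mulrACA -exprMn -e1 -mulrA -exprMn divfK ?mulf_neq0.
(* The coefficient at [(y, 1)] of [u ^+ p]: the norm of [g] along [x], where the powers of [r]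
   contained in [G] are compensated by [chi ^+ l = (r ^+ l)^-1 ^+ p]. *)
have chiE y : chi' (mu y) = chi y ^+ l * \prod_(w : cT) G (act y w).
  have cx : commutes_as (@tw_iota _ _ _ D) act x (tw_v D x).
    by move=> f; rewrite tw_v_iota Dact.
  have vX i : tw_v D x ^+ i = tw_v D (x ^+ i)%g.
    by elim: i => [|i IHi] //; rewrite exprS expgS tw_vM IHi.
  have := congr1 (fun F : B => F (y, 1%g)) up.
  rewrite muE uE (iotaM_exp (tw_iota_hopf D) hact g p cx) vX (expgp genT) tw_v1.
  rewrite mulr1 !ffunE eqxx mul1r => <-.
  rewrite -(prod_powers genT (fun w => G (act y w)) cop).
  have -> : chi y ^+ l = ((r y) ^+ l)^-1 ^+ p.
    by rewrite exprVn exprAC; case: hr => _ _ _ ->; rewrite exprVn invrK.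
  rewrite -[in X in _ = _ ^+ X * _](card_ord p) -prodr_const -big_split.
  apply: eq_bigr => i _ /=; rewrite /G rfix -el -expgnA mulnC mulrCA.
  by rewrite mulVf ?mulr1 // expf_neq0.
have lamVM a b : (lam^-1)%g (a * b)%g = ((lam^-1)%g a * (lam^-1)%g b)%g.
  by apply: (@perm_inj _ lam); rewrite lamM !permKV.
have lamV_act' := lamV_act genT lam_act nl.
exists lam, n, l, (fun a => G ((lam^-1)%g a)); split=> //.
- by rewrite l0 lp /= nl.
- by case: dG => G0 GM; split=> [a|a b]; rewrite ?lamVM.
split; apply/funext=> a.
  rewrite -{1}[a](permKV lam) lamE chiE /chi_op phi_chi_fixed //; congr (_ * _).
  rewrite -(prod_powers genT _ cop); apply: eq_bigr => i _.
  by rewrite lamV_act' -expgnA.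
apply/funext=> c; rewrite /beta_op -betaE -!lamE !permKV.
by [].
Qed.

End Index.

End Uniqueness.

Lemma recognition chi' beta' : Alt beta' ->
    ~ (forall a c, beta a c = 1) -> presented t act B chi' beta' ->
  exists (lam : {perm gT}) (n l : nat) (psi : gT -> k),
  [/\ forall a b, lam (a * b)%g = (lam a * lam b)%g,
      forall a x, lam (act a x) = act (lam a) (x ^+ n)%g,
      (0 < l < p)%N && (n * l == 1 %[mod p]),
      dual psi
    & chi' = (fun a => chi_op t act l lam chi a * phi_chi t act p psi a)
      /\ beta' = beta_op t act l lam beta].
Proof.
move=> hb' nb [iota [pi [u [x0 [fr cu up hu [pu x01]]]]]].
have [mu [mu_inj muE]] := exists_index nb fr.
exact: (recognition_index hb' nb fr cu up hu pu x01 mu_inj muE).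
Qed.

End Recognition.

(** * Structure of an extension *)

Section Coinvariants.
Variables (k : fieldType) (cT gT : finGroupType) (H : hopfAlgType k).
Variables (iota : fun_algebra k gT -> H) (pi : H -> group_algebra k cT).
Hypothesis hext : hopf_extension iota pi.
Local Notation e a := (iota (fun_delta k a)).
Let hi : hopf_map iota. Proof. by case: hext. Qed.
Let hp : hopf_map pi. Proof. by case: hext. Qed.
Let li : linear iota. Proof. by case: hi. Qed.
Let lp : linear pi. Proof. by case: hp. Qed.
Let iinj : injective iota. Proof. by case: hext => _ _ []. Qed.

Lemma delta_neq0 a : e a != 0.
Proof.
apply/eqP; rewrite -(lin_zero li) => /iinj/ffunP/(_ a)/eqP.
by rewrite !ffunE eqxx oner_eq0.
Qed.

Lemma extension_triv f : pi (iota f) = (f 1%g : k) *: (1 : group_algebra k cT).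
Proof.
have [_ _ _ _ ker] := hext.
have : pi (iota (- (f 1%g : k) *: 1 + f)) = 0.
  apply/ker; exists [:: (- (f 1%g : k) *: 1 + f, 1)].
    move=> z; rewrite inE => /eqP -> /=; rewrite counit_fun !ffunE.
    by rewrite [_ *: _]mulr1 addNr.
  by rewrite big_seq1 mulr1.
rewrite li lp (iota1 hi) (pi1 hp) scaleNr => /eqP; rewrite addrC subr_eq0.
by move/eqP.
Qed.

(** [e 1] annihilates functions vanishing at 1, which generate the right ideal [ker pi]. So
    [e 1 * h] depends only on [pi h]. *)
Lemma delta1_ker h : pi h = 0 -> e 1%g * h = 0.
Proof.
have [_ _ _ _ ker] := hext; move/ker => [s s0 ->].
rewrite mulr_sumr big_seq big1 // => z /s0; rewrite counit_fun => z0.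
by rewrite mulrA (iota_deltaM hi) z0 scale0r mul0r.
Qed.

Lemma antipode_delta a : antipode (e a) = e a^-1%g.
Proof. by case: hi => _ _ _ _ <-; congr iota; exact: fun_antipode_delta. Qed.

(* The canonical map of the Galois extension identifies [H (x)_A H] with
   [H (x) k[C]], and sends [r (x) 1] and [1 (x) r] to the same element when [r]
   is coinvariant; the component at [e a] of this equality is the claim. *)
Lemma coinv_tensor (W : lmodType k) (B : H -> H -> W) r a : bilin B ->
  rcomp pi 1%g r = r -> B (r * e a) (e a) = B (e a) (e a * r).
Proof.
move=> hB hr; have [_ _ [_ surj] _ _] := hext.
(* [b x y] applies the inverse of the canonical map to [x (x) y], cut down to the component at [e a]
   and followed by [B]. *)
pose b x y := sweedler (fun m n => B (x * antipode m * e a) (e a * n)) y.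
have hb : bilin b by rewrite /b; lin.
have /choice [y yE] : forall x : cT, exists h, pi h = group_elt k x by move=> x; exact: surj.
(* Of the summands [e_(d^-1) (x) e_d] of [Delta(e_1)], only [d = a] survives multiplication by
   [e a]. *)
have collapse (F : gT -> gT -> W) : (forall d c, d != a^-1%g -> F d c = 0) ->
    (forall d c, c != a -> F d c = 0) ->
    \sum_d \sum_c fun_delta k 1%g (d * c)%g *: F d c = F a^-1%g a.
  move=> F1 F2; rewrite (bigD1 a^-1%g) //= [X in _ + X]big1 ?addr0; last first.
    by move=> d nd; rewrite big1 // => c _; rewrite F1 ?scaler0.
  rewrite (bigD1 a) //= big1 ?addr0; last by move=> c nc; rewrite F2 ?scaler0.
  by rewrite ffunE mulVg eqxx scale1r.
transitivity (b r (e 1%g)).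
  rewrite /b (sweedler_hopf_map _ hi); last lin.
  rewrite sweedler_fun; last lin.
  rewrite (collapse (fun d c => B (r * antipode (e d) * e a) (e a * e c))).
  - by rewrite antipode_delta invgK -mulrA !(iota_deltaM hi) !ffunE eqxx !scale1r.
  - move=> d c nd; rewrite antipode_delta -mulrA (iota_deltaM hi) ffunE.
    by rewrite (can2_eq invgK invgK) (negPf nd)
       scale0r mulr0 (lin_zero (hB.2 _)).
  - move=> d c nc; rewrite [X in B _ X](iota_deltaM hi) ffunE eq_sym (negPf nc).
    by rewrite scale0r (lin_zero (hB.1 _)).
transitivity (sweedler (fun m n => b m (e 1%g * n)) r).
  (* By [delta1_ker], [n] may be replaced by the lift of [pi n] through [y]. Coinvariance of [r]
     then keeps only [x = 1], where the lift may be taken to be 1. *)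
  transitivity (sweedler (fun m n => \sum_x (pi n x : k) *: b m (e 1%g * y x)) r).
    rewrite sweedler_sum (bigD1 1%g) //= big1 ?addr0.
      transitivity (b (rcomp pi 1%g r) (e 1%g * y 1%g)).
        rewrite hr; congr b; apply/eqP; rewrite -subr_eq0; apply/eqP.
        rewrite -[X in X - _]mulr1 -mulrBr delta1_ker //.
        by rewrite -scaleN1r addrC lp yE (pi1 hp) scaleN1r addNr.
      rewrite (lin_sweedler (g := fun m => b m _)); last lin.
      by apply: eq_sweedler => m n; rewrite (lin_scale (hb.2 _)).
    move=> x nx; transitivity (b (rcomp pi x r) (e 1%g * y x)).
      rewrite (lin_sweedler (g := fun m => b m _)); last lin.
      by apply: eq_sweedler => m n; rewrite (lin_scale (hb.2 _)).
    by rewrite -hr (rcomp_rcomp hp) (negPf nx) scale0r (lin_zero (hb.2 _)).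
  apply: eq_sweedler => m n.
  transitivity (b m (e 1%g * \sum_x (pi n x : k) *: y x)).
    rewrite mulr_sumr (lin_sum (hb.1 _)); apply: eq_bigr => x _.
    by rewrite -scalerAr (lin_scale (hb.1 _)).
  congr b; apply/eqP; rewrite -subr_eq0 -mulrBr; apply/eqP/delta1_ker.
  rewrite -scaleN1r addrC lp scaleN1r (lin_sum lp) {1}[pi n]group_expand addrC.
  apply/eqP; rewrite subr_eq0; apply/eqP; apply: eq_bigr => x _.
  by rewrite (lin_scale lp) yE.
transitivity (sweedler (fun m n => sweedler (fun p q =>
   B (m * antipode p * e a) (e a * q)) n) r).
  apply: eq_sweedler => m n; rewrite /b (sweedler_iotaM hi); last lin.
  rewrite (collapse (fun d c => sweedler (fun p q =>
     B (m * antipode (e d * p) * e a) (e a * (e c * q))) n)).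
  - apply: eq_sweedler => p q; rewrite antipodeM antipode_delta invgK !mulrA.
    rewrite -[_ * e a * e a]mulrA (iota_deltaM hi) ffunE eqxx scale1r.
    by [].
  - move=> d c nd; rewrite /sweedler big1 // => z _.
    rewrite antipodeM antipode_delta mulrA -[_ * _ * e a]mulrA (iota_deltaM hi) ffunE.
    by rewrite (can2_eq invgK invgK) (negPf nd)
       scale0r mulr0 (lin_zero (hB.2 _)).
  - move=> d c nc; rewrite /sweedler big1 // => z _.
    rewrite [X in B _ X]mulrA (iota_deltaM hi) ffunE eq_sym (negPf nc).
    by rewrite scale0r mul0r (lin_zero (hB.1 _)).
rewrite -(sweedlerA (b := fun m p q => B (m * antipode p * e a) (e a * q))); last lin.
transitivity (sweedler (fun m n => counit m *: B (e a) (e a * n)) r).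
  apply: eq_sweedler => m n.
  rewrite -(lin_sweedler (g := fun x => B (x * e a) (e a * n))); last lin.
  by rewrite sweedler_antipoder -scalerAl mul1r (lin_scale (hB.2 _)).
by rewrite sweedler_counitl_lin //; lin.
Qed.

(** Applying [coinv_tensor] to [x (x) y -> phi(x) y] with [phi (e a) = 1] shows that [e a * r] is a
    multiple of [e a]; these products sum to [r]. *)
Lemma extension_framed : framed iota pi.
Proof.
split=> //; first exact: extension_triv.
move=> r hr.
have /choice [f fE] : forall a, exists c : k, e a * r = c *: e a.
  move=> a; have [phi lphi phi1] := exists_functional (delta_neq0 a).
  exists (phi (r * e a)).
  have := coinv_tensor (B := fun x y => (phi x : k) *: y) a _ hr.
  by rewrite phi1 scale1r => -> //; lin.
exists [ffun a => f a]; rewrite (iota_expand hi) -[r in LHS]mul1r -(iota_sum1 hi).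
by rewrite mulr_suml; apply: eq_bigr => a _; rewrite fE ffunE.
Qed.

End Coinvariants.

(** * Left and right coactions agree *)

Section Bicomodule.
Variables (k : fieldType) (cT gT : finGroupType) (H : hopfAlgType k).
Variables (iota : fun_algebra k gT -> H) (pi : H -> group_algebra k cT).
Hypothesis fr : framed iota pi.
Local Notation e a := (iota (fun_delta k a)).
Local Notation rc := (rcomp pi).
Local Notation lc := (lcomp pi).
Let hi := fr_iota fr.
Let hp := fr_pi fr.
Let li : linear iota. Proof. by case: hi. Qed.
Let lp : linear pi. Proof. by case: hp. Qed.
Let lrc x : linear (rc x). Proof. exact: rcomp_linear. Qed.
Let llc x : linear (lc x). Proof. exact: lcomp_linear. Qed.

Lemma framed_delta_neq0 a : e a != 0.
Proof.
apply/eqP; rewrite -(lin_zero li) => /(fr_inj fr)/ffunP/(_ a)/eqP.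
by rewrite !ffunE eqxx oner_eq0.
Qed.

Lemma lcomp_lcomp x y h : lc x (lc y h) = (x == y)%:R *: lc x h.
Proof.
rewrite [lc y h]/lcomp (lin_sweedler _ _ (lcomp_linear hp x)).
transitivity (sweedler (fun m n => sweedler (fun p q =>
   (pi m y : k) *: ((pi p x : k) *: q)) n) h).
  by apply: eq_sweedler => m n; rewrite (lin_scale (lcomp_linear hp x)) sweedlerZ.
rewrite -(sweedlerA (b := fun m p q => (pi m y : k) *: ((pi p x : k) *: q))); last lin.
rewrite -sweedlerZ; apply: eq_sweedler => m n.
rewrite (sweedler_pi hp (F := fun a c => a *: (c *: n))); last lin.
rewrite !scalerA eq_sym; case: eqP => [->|_]; first by rewrite mulrC.
by rewrite mulr0 mul0r.
Qed.

Lemma lcomp_iotaM x f h : lc x (iota f * h) = iota f * lc x h.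
Proof.
rewrite /lcomp (sweedler_iotaM hi); last lin.
rewrite (bigD1 1%g) //= [X in _ + X]big1 ?addr0; last first.
  move=> a na; rewrite big1 // => c _; rewrite /sweedler big1 ?scaler0 // => z _.
  by rewrite (pi_iotaM fr) ffunE eq_sym (negPf na) mul0r scale0r.
rewrite (lin_sweedler (g := fun y => _ * y)); last lin.
rewrite (iota_expand hi f); transitivity (sweedler (fun m n => \sum_c (f c : k) *: ((pi m x : k) *: (e c * n))) h).
  rewrite sweedler_sum; apply: eq_bigr => c _; rewrite mul1g [RHS]sweedlerZ; congr (_ *: _).
  apply: eq_sweedler => m n.
  by rewrite (pi_iotaM fr) ffunE eqxx mul1r.
apply: eq_sweedler => m n; rewrite mulr_suml; apply: eq_bigr => c _.
by rewrite -scalerAl -scalerAr.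
Qed.

Lemma lcomp1 x : lc x 1 = (x == 1%g)%:R *: 1.
Proof.
rewrite /lcomp sweedler1; last lin.
by rewrite (pi1 hp) group_alg1 group_eltE.
Qed.

Section Forms.
Variables (W : lmodType k) (b : H -> H -> W).
Hypothesis hb : bilin b.

Lemma sweedler_rcomp x h : sweedler b (rc x h) = sweedler (fun m n => b m (rc x n)) h.
Proof.
rewrite /rcomp (lin_sweedler _ _ (sweedler_linear hb)).
transitivity (sweedler (fun m n => sweedler (fun p q => (pi n x : k) *: b p q) m) h).
  by apply: eq_sweedler => m n; rewrite sweedlerZ (lin_scale (sweedler_linear hb)).
rewrite (sweedlerA (b := fun p q n => (pi n x : k) *: b p q)); last lin.
apply: eq_sweedler => m n; rewrite (lin_sweedler _ _ (hb.1 m)).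
by apply: eq_sweedler => p q; rewrite (lin_scale (hb.1 _)).
Qed.

Lemma sweedler_lcomp x h : sweedler b (lc x h) = sweedler (fun m n => b (lc x m) n) h.
Proof.
rewrite /lcomp (lin_sweedler _ _ (sweedler_linear hb)).
transitivity (sweedler (fun m n => sweedler (fun p q => (pi m x : k) *: b p q) n) h).
  by apply: eq_sweedler => m n; rewrite sweedlerZ (lin_scale (sweedler_linear hb)).
rewrite -(sweedlerA (b := fun m p q => (pi m x : k) *: b p q)); last lin.
apply: eq_sweedler => m n; rewrite (lin_sweedler _ _ (hb.2 n)).
by apply: eq_sweedler => p q; rewrite (lin_scale (hb.2 _)).
Qed.

(** Both sides apply [pi] to the middle factor of the iterated comultiplication: the right degree of
    the first leg is the left degree of the second. *)
Lemma sweedler_mid s h :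
  sweedler (fun m n => b (rc s m) n) h = sweedler (fun m n => b m (lc s n)) h.
Proof.
transitivity (sweedler (fun m n => sweedler (fun p q => (pi q s : k) *: b p n) m) h).
  apply: eq_sweedler => m n; rewrite (lin_sweedler _ _ (hb.2 n)).
  by apply: eq_sweedler => p q; rewrite (lin_scale (hb.2 _)).
rewrite (sweedlerA (b := fun p q n => (pi q s : k) *: b p n)); last lin.
apply: eq_sweedler => m n; rewrite (lin_sweedler _ _ (hb.1 m)).
by apply: eq_sweedler => p q; rewrite (lin_scale (hb.1 _)).
Qed.

End Forms.

Lemma rcomp_lcomp x y h : rc x (lc y h) = lc y (rc x h).
Proof.
rewrite [RHS]sweedler_rcomp; last lin.
rewrite [lc y h]/lcomp (lin_sweedler _ _ (rcomp_linear hp x)).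
by apply: eq_sweedler => m n; rewrite (lin_scale (lrc x)).
Qed.

Lemma lcomp_hom x y h : lc x h = h -> lc y h = (y == x)%:R *: h.
Proof.
move=> hx; rewrite -{1}hx lcomp_lcomp.
by case: eqP => [->|_]; rewrite ?scale0r // hx.
Qed.

Lemma pi_lcomp y h : pi (lc y h) = (pi h y : k) *: group_elt k y.
Proof.
rewrite (lin_sweedler _ _ lp); transitivity (sweedler (fun m n : group_algebra k cT => (m y : k) *: n) (pi h)).
  rewrite (sweedler_hopf_map _ hp); last by split=> u c m n; rewrite ?ffun_lin ?scalar_lin ?scale_lin.
  by apply: eq_sweedler => m n; rewrite (lin_scale lp).
rewrite sweedler_group; last by split=> u c m n; rewrite ?ffun_lin ?scalar_lin ?scale_lin.
rewrite (bigD1 y) //= big1 ?addr0 => [|x nx]; rewrite group_eltE ?eqxx ?scale1r //.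
by rewrite eq_sym (negPf nx) scale0r scaler0.
Qed.

Lemma pi_rcomp y h : pi (rc y h) = (pi h y : k) *: group_elt k y.
Proof.
rewrite (lin_sweedler _ _ lp); transitivity (sweedler (fun m n : group_algebra k cT => (n y : k) *: m) (pi h)).
  rewrite (sweedler_hopf_map _ hp); last by split=> u c m n; rewrite ?ffun_lin ?scalar_lin ?scale_lin.
  by apply: eq_sweedler => m n; rewrite (lin_scale lp).
rewrite sweedler_group; last by split=> u c m n; rewrite ?ffun_lin ?scalar_lin ?scale_lin.
rewrite (bigD1 y) //= big1 ?addr0 => [|x nx]; rewrite group_eltE ?eqxx ?scale1r //.
by rewrite eq_sym (negPf nx) scale0r scaler0.
Qed.

Section Cocentral.
Variables (G G' : cT -> H).
Hypothesis GG' : forall x, G x * G' x = 1.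
Hypothesis G'G : forall x, G' x * G x = 1.
Hypothesis Ghom : forall x, rc x (G x) = G x.

Lemma hom_factor x h : rc x h = h -> exists f, h = iota f * G x.
Proof. by move=> hx; apply: (coinv_factor fr hx (Ghom x) (GG' x) (G'G x)). Qed.

Lemma eG_neq0 a x : e a * G x != 0.
Proof.
apply/eqP => /(congr1 (fun h => h * G' x)); rewrite -mulrA GG' mulr1 mul0r.
by apply/eqP/framed_delta_neq0.
Qed.

(** Left projections preserve the right component [iota(k^G) G x] and commute with [e a], so
    [e a * G x] is an eigenvector of each. They are idempotents with sum 1, so some eigenvalue is
    nonzero, hence 1. *)
Lemma exists_left_degree x a : exists y, lc y (e a * G x) = e a * G x.
Proof.
have /choice [f fE] : forall y, exists c : k, lc y (e a * G x) = c *: (e a * G x).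
  move=> y; have [|g eg] := @hom_factor x (lc y (G x)).
    by rewrite rcomp_lcomp Ghom.
  by exists (g a); rewrite lcomp_iotaM eg mulrA (iota_deltaM hi) -scalerAl.
apply: contrapT => ne; have f0 y : f y = 0.
  have [//|n0] := eqVneq (f y) 0; case: ne; exists y.
  set v := e a * G x; have fv : f y *: lc y v = lc y v.
    by rewrite -(lin_scale (llc y)) -fE lcomp_lcomp eqxx scale1r.
  move: fv; rewrite fE scalerA => /eqP; rewrite -subr_eq0 -scalerBl.
  rewrite scaler_eq0 (negPf (eG_neq0 _ _)) orbF -{3}[f y]mulr1 -mulrBr mulf_eq0.
  by rewrite (negPf n0) subr_eq0 => /eqP ->; rewrite scale1r.
have := lcomp_sum hp (e a * G x); rewrite big1 => [/esym/eqP|y _].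
  by rewrite (negPf (eG_neq0 _ _)).
by rewrite fE f0 scale0r.
Qed.

Hypothesis abG : forall a c : gT, (a * c = c * a)%g.
(* This is where the minimality of p enters: an action of G on the set C fixing
   1 is trivial. *)
Hypothesis small : (#|cT| <= pdiv #|gT|)%N.

(** [Delta(G x)] is invertible with inverse [Delta(G' x)], so multiplication by [e a (x) e c] cannot
    kill it. *)
Lemma sweedler_G_nonzero x a c (zero : forall (W : lmodType k) (b : H -> H -> W),
    bilin b -> sweedler (fun m n => b (e a * m) (e c * n)) (G x) = 0) : False.
Proof.
have [pa lpa pa1] := exists_functional (framed_delta_neq0 a).
have [pc lpc pc1] := exists_functional (framed_delta_neq0 c).
pose b m n : k^o := pa m *: pc n.
have hb : bilin b by rewrite /b; lin.
have : sweedler (fun m n => b (e a * m) (e c * n)) (G x * G' x) = 1.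
  by rewrite GG' sweedler1 ?mulr1 /b ?pa1 ?pc1; [exact: mulr1 | lin].
rewrite sweedlerM; last lin.
rewrite sweedler_exchange /sweedler big1 => [/esym/eqP|z _].
  by rewrite oner_eq0.
have hz : bilin (fun m n => b (m * z.1) (n * z.2)) by lin.
rewrite -[RHS](zero _ _ hz); apply: eq_bigr => w _.
by rewrite !mulrA.
Qed.

Section Degree.
Variable tr : cT -> gT -> cT.
Hypothesis trP : forall x a, lc (tr x a) (e a * G x) = e a * G x.

Lemma trE y x a : lc y (e a * G x) = (y == tr x a)%:R *: (e a * G x).
Proof. exact: lcomp_hom. Qed.

Lemma tr_uniq y x a : lc y (e a * G x) = e a * G x -> y = tr x a.
Proof.
rewrite trE; case: eqP => // _; rewrite scale0r => /esym/eqP.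
by rewrite (negPf (eG_neq0 _ _)).
Qed.

Lemma lcomp_homE y x a h : rc x h = h ->
  lc y (e a * h) = (y == tr x a)%:R *: (e a * h).
Proof.
move/hom_factor => [f ->]; rewrite mulrA (iota_deltaM hi) -scalerAl.
by rewrite (lin_scale (llc y)) trE !scalerA mulrC.
Qed.

(** Compute the left degree of [(e a (x) e c) Delta(G x)] twice. Its second leg has right degree
    [x], hence left degree [tr x c]; this is the right degree of the first leg, which thus has left
    degree [tr (tr x c) a]. But it is also [(e a (x) e c) Delta(e (a c) G x)], of left degree
    [tr x (a c)], and it is nonzero. *)
Lemma trM x a c : tr x (a * c)%g = tr (tr x c) a.
Proof.
apply: contrapT => ne; apply: (@sweedler_G_nonzero x a c) => W b hb.
have rr y h : rc y (rc y h) = rc y h by rewrite (rcomp_rcomp hp) eqxx scale1r.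
pose F h := sweedler (fun m n => b (e a * m) (e c * n)) h.
have bF : bilin (fun m n => b (e a * m) (e c * n)) by lin.
have lF : linear F by exact: sweedler_linear.
have FP y h : sweedler (fun m n => b (lc y (e a * m)) (e c * n)) h = F (lc y h).
  rewrite /F sweedler_lcomp //; apply: eq_sweedler => m n.
  by rewrite lcomp_iotaM.
have F1 : F (G x) = F (lc (tr (tr x c) a) (G x)).
  rewrite -FP; transitivity (sweedler (fun m n => b (e a * m) (e c * lc (tr x c) n)) (G x)).
    rewrite /F -{1 2}(Ghom x) !sweedler_rcomp //; last lin.
    apply: eq_sweedler => m n.
    by rewrite -[in RHS]lcomp_iotaM (lcomp_homE _ _ (rr x n)) eqxx scale1r.
  have hl := llc (tr x c); have hr := lrc (tr x c); have hl2 := llc (tr (tr x c) a).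
  rewrite -(sweedler_mid (b := fun m n => b (e a * m) (e c * n)) bF).
  transitivity (sweedler (fun m n => b (lc (tr (tr x c) a) (e a * rc (tr x c) m)) (e c * n)) (G x)).
    by apply: eq_sweedler => m n; rewrite (lcomp_homE _ _ (rr _ m)) eqxx scale1r.
  rewrite (sweedler_mid (b := fun m n => b (lc (tr (tr x c) a) (e a * m)) (e c * n))); last lin.
  rewrite -{1}(Ghom x) sweedler_rcomp; last lin.
  rewrite -[in RHS](Ghom x) [RHS]sweedler_rcomp; last lin.
  apply: eq_sweedler => m n.
  by rewrite -[in LHS]lcomp_iotaM (lcomp_homE _ _ (rr x n)) eqxx scale1r.
have F2 h : F (e (a * c)%g * h) = F h.
  rewrite /F (sweedler_iotaM hi) // (bigD1 a) //= [X in _ + X]big1 ?addr0; last first.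
    move=> d nd; rewrite big1 // => g _; rewrite /sweedler big1 ?scaler0 // => z _.
    by rewrite mulrA (iota_deltaM hi) ffunE eq_sym (negPf nd) scale0r mul0r (lin_zero (hb.2 _)).
  rewrite (bigD1 c) //= big1 ?addr0; last first.
    move=> d nd; rewrite /sweedler big1 ?scaler0 // => z _.
    by rewrite [X in b _ X]mulrA (iota_deltaM hi) ffunE eq_sym (negPf nd) scale0r mul0r (lin_zero (hb.1 _)).
  rewrite ffunE eqxx scale1r; apply: eq_sweedler => m n.
  by rewrite !mulrA !(iota_deltaM hi) !ffunE !eqxx !scale1r.
rewrite -/(F (G x)) F1 -F2 -lcomp_iotaM trE.
by case: eqP => [/esym//|_]; rewrite scale0r (lin_zero lF).
Qed.

Lemma tr1 x : tr x 1%g = x.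
Proof.
have piG : pi (G x) = (pi (G x) x : k) *: group_elt k x by rewrite -pi_rcomp Ghom.
have n0 : pi (G x) != 0.
  apply/eqP=> z; have := congr1 pi (GG' x); rewrite (piM hp) z mul0r (pi1 hp) => /esym/eqP.
  by rewrite oner_eq0.
have pe : pi (e 1%g * G x) = pi (G x).
  by apply/ffunP=> y; rewrite (pi_iotaM fr) ffunE eqxx mul1r.
have := congr1 pi (trP x 1%g); rewrite pi_lcomp pe => e1.
apply/eqP; apply: contraNT n0 => ne; rewrite -e1.
by rewrite piG ffunE group_eltE (negPf ne) [_ *: 0]mulr0 scale0r.
Qed.

Lemma tr_unit a : tr 1%g a = 1%g.
Proof.
have [f ef] := fr_coinv fr (Ghom 1%g).
apply/esym/tr_uniq; rewrite lcomp_iotaM ef -{1}[iota f]mulr1 lcomp_iotaM lcomp1.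
by rewrite eqxx scale1r mulr1.
Qed.

Lemma tr_trivial x a : tr x a = x.
Proof.
have [->|nx] := eqVneq x 1%g; first exact: tr_unit.
(* [trM] composes in the order of a left action; commutativity of [G] turns it into a right
   action. *)
have actM y : act_morph tr y by move=> c d; rewrite abG trM.
pose to := TotalAction tr1 actM.
pose O := orbit to [set: gT] x.
have x_O : x \in O by exact: orbit_refl.
have O1 : 1%g \notin O.
  apply/imsetP=> -[c _ /= e1]; move/eqP: nx; apply.
  by have := trM x c^-1%g c; rewrite mulVg tr1 -e1 tr_unit.
(* The orbit misses 1, which makes the bound strict; an orbit length dividing [|G|] and smaller than
   its least prime divisor is 1. *)
have cO : (#|O| < pdiv #|gT|)%N.
  apply: leq_trans small; rewrite -(cardsT cT); apply: proper_card.
  by apply/properP; split; [exact: finset.subsetT | exists 1%g].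
have dO : (#|O| %| #|gT|)%N by rewrite card_orbit -cardsT dvdn_indexg.
have : (#|O| <= 1)%N.
  rewrite leqNgt; apply/negP=> O2; have := pdiv_min_dvd O2 dO.
  by rewrite leqNgt cO.
move/card_le1P/(_ _ x_O) => h; apply/eqP.
have : tr x a \in O by apply/imsetP; exists a; rewrite ?inE.
by rewrite h.
Qed.

End Degree.

Lemma cocentral y h : lc y h = rc y h.
Proof.
have /choice [tr trP] : forall xa : cT * gT, exists y, lc y (e xa.2 * G xa.1) = e xa.2 * G xa.1.
  by move=> xa; exact: exists_left_degree.
have GE x a z : lc z (e a * G x) = (z == x)%:R *: (e a * G x).
  rewrite (@trE (fun x a => tr (x, a))) => [|x' a']; last exact: (trP (x', a')).
  by rewrite (@tr_trivial (fun x a => tr (x, a))) // => x' a'; exact: (trP (x', a')).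
rewrite -{1}(rcomp_sum hp h) (lin_sum (llc y)) (bigD1 y) //= big1 ?addr0.
  have [|f ->] := @hom_factor y (rc y h).
    by rewrite (rcomp_rcomp hp) eqxx scale1r.
  rewrite lcomp_iotaM; congr (_ * _); rewrite -{1}[G y]mul1r -(iota_sum1 hi) mulr_suml.
  rewrite (lin_sum (llc y)) -[RHS]mul1r -(iota_sum1 hi) mulr_suml.
  by apply: eq_bigr => a _; rewrite GE eqxx scale1r.
move=> x nx; have [|f ->] := @hom_factor x (rc x h).
  by rewrite (rcomp_rcomp hp) eqxx scale1r.
rewrite lcomp_iotaM -[G x]mul1r -(iota_sum1 hi) mulr_suml (lin_sum (llc y)).
by rewrite big1 ?mulr0 // => a _; rewrite GE eq_sym (negPf nx) scale0r.
Qed.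

End Cocentral.
End Bicomodule.

(** * Common eigenvectors and symmetric cocycles *)

Section CommonEigenvector.
Variables (k : closedFieldType) (V : lmodType k).

(** The value [q(f) w], for [q] of size at most [n]. *)
Let pev (f : V -> V) (n : nat) (q : {poly k}) (w : V) :=
  \sum_(i < n) q`_i *: iter i f w.

Let iter_linear (f : V -> V) i : linear f -> linear (iter i f).
Proof. by move=> lf c x y; elim: i => //= i ->; rewrite lf. Qed.

Let pev_mulX f n (q : {poly k}) z w : linear f -> (size q <= n)%N ->
  pev f n.+1 (q * ('X - z%:P)) w = pev f n q (f w - z *: w).
Proof.
move=> lf sq; rewrite /pev mulrBr.
under eq_bigr => i _ do rewrite coefB coefMX coefMC scalerBl.
rewrite sumrB big_ord_recl /= scale0r add0r [X in _ - X]big_ord_recr /=.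
rewrite nth_default // mul0r scale0r addr0 -sumrB; apply: eq_bigr => i _.
have li := iter_linear i lf.
have -> : iter i f (f w - z *: w) = iter i f (f w) - z *: iter i f w.
  by rewrite addrC -scaleNr li scaleNr addrC.
by rewrite add0n -iterS iterSr scalerBr scalerA.
Qed.

(** Split off a root [z] of the annihilating polynomial: either [w] is an eigenvector, or
    [f w - z *: w] is annihilated by the quotient. The vector found is a polynomial in [f] applied
    to [w], so it keeps the eigenvalues of [w] under maps commuting with [f]. *)
Let eigen_poly f n (q : {poly k}) w : linear f -> (size q <= n)%N -> q != 0 ->
  w != 0 -> pev f n q w = 0 ->
  exists v z, [/\ v != 0, f v = z *: v
    & forall g : V -> V, linear g -> (forall x, g (f x) = f (g x)) ->
      forall y, g w = y *: w -> g v = y *: v].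
Proof.
move=> lf; elim: n q w => [|n IHn] q w sq q0 w0 e.
  by move: q0; rewrite -size_poly_leq0 sq.
have [s1|s1] := eqVneq (size q) 1%N.
  have [c c0 eq] := size_poly1P _ (introT eqP s1).
  move: e; rewrite /pev big_ord_recl big1 ?addr0 => [|i _] /=.
    by rewrite eq coefC eqxx => /eqP; rewrite scaler_eq0 (negPf c0) (negPf w0).
  by rewrite eq coefC /= scale0r.
have /closed_rootP [z /factor_theorem [q' eq]] := s1.
have q'0 : q' != 0 by apply: contraNneq q0 => q'0; rewrite eq q'0 mul0r.
have sq' : (size q' <= n)%N by move: sq; rewrite eq size_Mmonic ?monicXsubC // size_XsubC addn2.
have [e0|n0] := eqVneq (f w - z *: w) 0.
  exists w, z; split=> //; first by apply/eqP; rewrite -subr_eq0 e0.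
have := IHn q' (f w - z *: w) sq' q'0 n0.
rewrite -pev_mulX // -eq e => /(_ erefl) [v [y [v0 fv hv]]].
exists v, y; split=> // g lg gf y' gw; apply: hv => //.
rewrite -scaleNr addrC lg gf gw (lin_scale lf) scalerDr !scalerA.
by rewrite mulrN mulNr mulrC.
Qed.

Lemma eigen_of_iter (f : V -> V) n w c : linear f -> (0 < n)%N -> w != 0 ->
  iter n f w = c *: w ->
  exists v z, [/\ v != 0, f v = z *: v
    & forall g : V -> V, linear g -> (forall x, g (f x) = f (g x)) ->
      forall y, g w = y *: w -> g v = y *: v].
Proof.
move=> lf n0 w0 e; apply: (@eigen_poly f n.+1 ('X^n - c%:P)) => //.
- by rewrite size_XnsubC.
- by rewrite -size_poly_eq0 size_XnsubC.
rewrite /pev; under eq_bigr => i _ do rewrite coefB coefXn coefC scalerBl.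
rewrite sumrB big_ord_recr /= eqxx scale1r [X in X + _ - _]big1 ?add0r; last first.
  by move=> i _; rewrite (ltn_eqF (ltn_ord i)) scale0r.
rewrite big_ord_recl /= big1 ?addr0; first by rewrite e subrr.
by move=> i _; rewrite scale0r.
Qed.

End CommonEigenvector.

(* A common eigenvector of the twisted translations is a one-dimensional
   representation of the (commutative) twisted group algebra. *)
Lemma symmetric_cocycle_split (k : closedFieldType) (gT : finGroupType)
    (s : gT -> gT -> k) :
  (forall a c : gT, (a * c = c * a)%g) -> (forall a c, s a c != 0) ->
  (forall a c, s a c = s c a) ->
  (forall a b c, s a b * s (a * b)%g c = s b c * s a (b * c)%g) ->
  exists g : gT -> k, (forall a, g a != 0) /\
    forall a c, s a c = g a * g c / g (a * c)%g.
Proof.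
move=> abG s0 ssym scoc; pose W := {ffun gT -> k^o}.
(* The twisted translations: they multiply up to the cocycle [s], commute because [s] and [G] are
   commutative, and have scalar [|G|]-th power. *)
pose T a (w : W) : W := [ffun b => s a b * w (a * b)%g].
have lT a : linear (T a).
  by move=> c x y; apply/ffunP=> b; rewrite !ffunE mulrDr; congr (_ + _); exact: mulrCA.
have TT a c w : T a (T c w) = s c a *: T (c * a)%g w.
  apply/ffunP=> b; rewrite !ffunE mulgA mulrA -scoc -mulrA.
  by [].
have TC a c w : T a (T c w) = T c (T a w) by rewrite !TT ssym abG.
have s11 b : s 1%g b = s 1%g 1%g.
  by have := scoc 1%g 1%g b; rewrite !mul1g => /(mulIf (s0 _ _)).
have T1 w : T 1%g w = s 1%g 1%g *: w.
  by apply/ffunP=> b; rewrite !ffunE mul1g s11.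
have TX a n w : exists c, iter n.+1 (T a) w = c *: T (a ^+ n.+1)%g w.
  elim: n => [|n [c IHn]]; first by exists 1; rewrite scale1r expg1.
  exists (c * s (a ^+ n.+1)%g a).
  by rewrite iterS IHn (lin_scale (lT a)) TT scalerA -expgSr.
have Tn a w : exists c, iter #|gT| (T a) w = c *: w.
  have G0 : (0 < #|gT|)%N by apply/card_gt0P; exists 1%g.
  have [c ec] := TX a #|gT|.-1 w; exists (c * s 1%g 1%g).
  by move: ec; rewrite prednK // -cardsT expg_cardG ?inE // T1 scalerA.
(* The elements of [G] are treated one at a time; the inheritance clause of [eigen_of_iter] keeps
   the earlier eigenvalues. *)
have [v [v0 hv]] : exists v : W, v != 0 /\
    forall a, a \in enum gT -> exists z, T a v = z *: v.
  elim: (enum gT) => [|a l [w [w0 hw]]].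
    exists [ffun=> 1]; split=> //; apply/eqP=> /ffunP/(_ 1%g)/eqP.
    by rewrite !ffunE oner_eq0.
  have G0 : (0 < #|gT|)%N by apply/card_gt0P; exists 1%g.
  have [c ec] := Tn a w.
  have [v [z [v0 fv inh]]] := eigen_of_iter (lT a) G0 w0 ec.
  exists v; split=> // b; rewrite inE => /orP[/eqP->|/hw [y yE]]; first by exists z.
  by exists y; apply: inh => // x; exact: TC.
have /choice [g gE] : forall a, exists z, T a v = z *: v.
  by move=> a; apply: hv; rewrite mem_enum.
have gM a c : g a * g c = s a c * g (a * c)%g.
  have := TT c a v; rewrite !gE (lin_scale (lT c)) gE !scalerA => /eqP.
  rewrite -subr_eq0 -scalerBl scaler_eq0 (negPf v0) orbF subr_eq0.
  by move/eqP.
have g1 : g 1%g != 0.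
  apply/eqP=> g1; have := gE 1%g; rewrite T1 g1 scale0r => /eqP.
  by rewrite scaler_eq0 (negPf v0) (negPf (s0 _ _)).
have g0 a : g a != 0.
  apply/eqP=> ga; have := gM a a^-1%g; rewrite ga mul0r mulgV => /esym/eqP.
  by rewrite mulf_eq0 (negPf (s0 _ _)) (negPf g1).
by exists g; split=> // a c; rewrite gM mulfK.
Qed.

Section CocycleForm.
Variables (k : fieldType) (gT : finGroupType) (J : gT -> gT -> k).
Hypothesis abG : forall a c : gT, (a * c = c * a)%g.
Hypothesis J0 : forall a c, J a c != 0.
Hypothesis Jcoc : forall a b c, J a b * J (a * b)%g c = J b c * J a (b * c)%g.

Definition alternation a c := J a c / J c a.

Lemma alternation_swap a c : alternation a c = (alternation c a)^-1.
Proof. by rewrite /alternation invf_div. Qed.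

(** The three equations are the cocycle identity at [(a, b, c)], [(c, a, b)] and [(a, c, b)]; with
    them both sides become the same quotient. *)
Lemma alternationMl a b c :
  alternation (a * b)%g c = alternation a c * alternation b c.
Proof.
have e1 : J (a * b)%g c = J b c * J a (b * c)%g / J a b.
  by rewrite -Jcoc mulrC mulKf.
have e2 : J c (a * b)%g = J c a * J (c * a)%g b / J a b.
  by rewrite Jcoc mulrC mulKf.
have e3 : J (c * a)%g b = J c b * J a (b * c)%g / J a c.
  by rewrite (abG b c) -Jcoc abG mulrC mulKf.
rewrite /alternation e1 e2 e3; field.
by rewrite !J0.
Qed.

Lemma Alt_alternation : Alt alternation.
Proof.
split=> [a c|||a]; last by rewrite /alternation divff.
- by rewrite mulf_neq0 // invr_eq0.
- exact: alternationMl.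
- move=> a b c; rewrite alternation_swap alternationMl invfM.
  by rewrite -!alternation_swap.
Qed.

End CocycleForm.

(** * The normalised generator of an extension *)

Section Normalisation.
Variables (k : closedFieldType) (cT gT : finGroupType) (t : cT).
Variable act : gT -> cT -> gT.
Local Notation p := #[t]%g.
Hypothesis hact : right_aut_action act.
Hypothesis genT : forall x, exists i, (t ^+ i)%g = x.
Hypothesis pr_p : prime p.
Hypothesis oddG : odd #|gT|.
Hypothesis abG : forall a c : gT, (a * c = c * a)%g.
Hypothesis small : (#|cT| <= pdiv #|gT|)%N.
Variables (H : hopfAlgType k).
Variables (iota : fun_algebra k gT -> H) (pi : H -> group_algebra k cT).
Hypothesis fr : framed iota pi.
Variables (G G' : cT -> H).
Hypothesis GG' : forall x, G x * G' x = 1.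
Hypothesis G'G : forall x, G' x * G x = 1.
Hypothesis Ghom : forall x, rcomp pi x (G x) = G x.
Local Notation e a := (iota (fun_delta k a)).
Local Notation rc := (rcomp pi).
Local Notation lc := (lcomp pi).
Let hi := fr_iota fr.
Let hp := fr_pi fr.
Let li : linear iota. Proof. by case: hi. Qed.

Lemma iota_dual_basis : exists phi : gT -> H -> k^o,
  (forall a, linear (phi a)) /\ forall a f, phi a (e a * iota f) = f a.
Proof.
have ex a : exists phi : H -> k^o, linear phi /\ phi (e a) = 1.
  by have [phi lphi phi1] := exists_functional (framed_delta_neq0 fr a); exists phi.
have [phi phiP] := choice ex; exists phi; split=> a; first by case: (phiP a).
have [lphi phi1] := phiP a => f.
by rewrite (iota_deltaM hi) (lin_scale lphi) phi1 [_ *: 1]mulr1.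
Qed.

Section Coordinates.
Variables (g g' : H).
Hypotheses (gg' : g * g' = 1).
Variable phi : gT -> H -> k^o.
Hypothesis lphi : forall a, linear (phi a).
Hypothesis phiE : forall a f, phi a (e a * iota f) = f a.

(** A functional on all of [H] that reads [f a] off [iota f * g]; pairs of them extract the
    coefficients of a twist. *)
Definition coord a h : k^o := phi a (e a * (h * g')).

Lemma coord_linear a : linear (coord a).
Proof. by rewrite /coord; have := lphi a; lin. Qed.

Lemma coord_iotaM a f : coord a (iota f * g) = f a.
Proof. by rewrite /coord -mulrA gg' mulr1 phiE. Qed.

Lemma coord2_bilin a c : bilin (fun m n => coord a m *: coord c n : k^o).
Proof. by have := coord_linear a; have := coord_linear c; lin. Qed.

Lemma twisted_coef J f a c : twisted_grouplike iota g J ->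
  sweedler (fun m n => coord a m *: coord c n : k^o) (iota f * g) = f (a * c)%g * J a c.
Proof.
move=> hJ; rewrite (twisted_iotaM hi _ hJ); last exact: coord2_bilin.
rewrite (bigD1 a) //= [X in _ + X]big1 ?addr0; last first.
  move=> d nd; rewrite big1 // => x _.
  by rewrite coord_iotaM ffunE eq_sym (negPf nd) scale0r; exact: mulr0.
rewrite (bigD1 c) //= [X in _ + X]big1 ?addr0; last first.
  by move=> d nd; rewrite !coord_iotaM !ffunE [c == d]eq_sym (negPf nd) scaler0; exact: mulr0.
by rewrite !coord_iotaM !ffunE !eqxx scale1r; exact: mulr1.
Qed.

(** Coassociativity at [g], read in the coordinates [a], [b], [c]. *)
Lemma twisted_cocycle J a b c : twisted_grouplike iota g J ->
  J a b * J (a * b)%g c = J b c * J a (b * c)%g.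
Proof.
move=> hJ; have la := coord_linear a; have lb := coord_linear b.
have lcc := coord_linear c.
have lab : linear (sweedler (fun m n => coord a m *: coord b n : k^o)).
  exact/sweedler_linear/coord2_bilin.
have lbc : linear (sweedler (fun m n => coord b m *: coord c n : k^o)).
  exact/sweedler_linear/coord2_bilin.
have := sweedlerA (b := fun x y z => coord a x *: (coord b y *: coord c z) : k^o) g _.
have -> // : sweedler (fun m n => sweedler (fun x y =>
    coord a x *: (coord b y *: coord c n) : k^o) m) g = J a b * J (a * b)%g c.
  transitivity (sweedler (fun m n => sweedler (fun x y => coord a x *: coord b y : k^o) m *: coord c n : k^o) g).
    apply: eq_sweedler => m n.
    rewrite (lin_sweedler (g := fun z : k^o => z *: coord c n : k^o)); last lin.
    by apply: eq_sweedler => x y; exact: mulrA.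
  rewrite hJ; last lin.
  rewrite (bigD1 (a * b)%g) //= [X in _ + X]big1 ?addr0; last first.
    move=> d nd; rewrite big1 // => x _.
    by rewrite (twisted_coef _ _ _ hJ) ffunE eq_sym (negPf nd) mul0r scale0r scaler0.
  rewrite (bigD1 c) //= [X in _ + X]big1 ?addr0; last first.
    by move=> d nd; rewrite coord_iotaM ffunE eq_sym (negPf nd) !scaler0.
  rewrite (twisted_coef _ _ _ hJ) coord_iotaM !ffunE !eqxx mul1r.
  by rewrite [_ *: 1]mulr1; exact: mulrC.
have -> // : sweedler (fun m n => sweedler (fun x y =>
    coord a m *: (coord b x *: coord c y) : k^o) n) g = J b c * J a (b * c)%g.
  transitivity (sweedler (fun m n => coord a m *: sweedler (fun x y => coord b x *: coord c y : k^o) n : k^o) g).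
    by apply: eq_sweedler => m n; rewrite sweedlerZ.
  rewrite hJ; last lin.
  rewrite (bigD1 a) //= [X in _ + X]big1 ?addr0; last first.
    move=> d nd; rewrite big1 // => x _.
    by rewrite coord_iotaM ffunE eq_sym (negPf nd) scale0r scaler0.
  rewrite (bigD1 (b * c)%g) //= [X in _ + X]big1 ?addr0; last first.
    move=> d nd; rewrite (twisted_coef _ _ _ hJ) ffunE eq_sym (negPf nd) mul0r.
    by rewrite !scaler0.
  rewrite (twisted_coef _ _ _ hJ) coord_iotaM !ffunE !eqxx mul1r scale1r.
  exact: mulrC.
by apply; lin.
Qed.

(** If [J a c = 0], then [e a (x) e c] would annihilate [Delta(g)], hence also
    [Delta(g g') = 1 (x) 1]. *)
Lemma twisted_neq0 J a c : twisted_grouplike iota g J -> J a c != 0.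
Proof.
move=> hJ; apply/eqP=> z.
have phie d : phi d (e d) = 1.
  by rewrite -[e d]mulr1 -(iota1 hi) phiE ffunE.
pose b m n : k^o := phi a (e a * m) *: phi c (e c * n).
have la := lphi a; have lcc := lphi c.
have hb : bilin b by rewrite /b; lin.
have : sweedler b (g * g') = 1.
  by rewrite gg' sweedler1 // /b !mulr1 !phie; exact: mulr1.
rewrite sweedlerM // sweedler_exchange /sweedler big1 => [/esym/eqP|w _].
  by rewrite oner_eq0.
transitivity (sweedler (fun m n => b (m * w.1) (n * w.2)) g) => //.
rewrite hJ; last lin.
rewrite big1 // => d _; rewrite big1 // => f _; rewrite /b !mulrA !(iota_deltaM hi) !ffunE.
have [<-|nd] := eqVneq a d; last by rewrite scale0r !mul0r (lin_zero la) scale0r scaler0.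
have [<-|nf] := eqVneq c f; last by rewrite scale0r !mul0r (lin_zero lcc) !scaler0.
by rewrite z scale0r.
Qed.

End Coordinates.

(** [G x] has degree [x] on both sides. The second leg of [Delta(G x)] may thus be projected to
    right degree [x], the first to left degree [x], which by [cocentral] is right degree [x]. Both
    legs then lie in [iota(k^G) G x]. *)
Lemma exists_twist x : exists J, twisted_grouplike iota (G x) J.
Proof.
have [phi [lphi phiE]] := iota_dual_basis.
pose xi := coord (G' x) phi.
have lxi a : linear (xi a) by exact: coord_linear.
have xiE a f : xi a (iota f * G x) = f a by exact: coord_iotaM.
have rcE h : rc x h = \sum_a (xi a (rc x h) : k) *: (e a * G x).
  have [|f ->] := hom_factor fr GG' G'G Ghom (x := x) (h := rc x h).
    by rewrite (rcomp_rcomp hp) eqxx scale1r.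
  rewrite {1}(iota_expand hi f) mulr_suml; apply: eq_bigr => a _.
  by rewrite xiE -scalerAl.
have lrc := rcomp_linear hp x.
have both (W : lmodType k) (b : H -> H -> W) : bilin b ->
    sweedler b (G x) = sweedler (fun m n => b (rc x m) (rc x n)) (G x).
  move=> hb; rewrite -{1}(Ghom x) (sweedler_rcomp fr hb) -{1}(Ghom x).
  rewrite -(cocentral fr GG' G'G Ghom abG small) (sweedler_lcomp fr); last lin.
  by apply: eq_sweedler => m n; rewrite (cocentral fr GG' G'G Ghom abG small).
exists (fun a c => sweedler (fun m n => xi a m *: xi c n : k^o) (G x)).
move=> W b hb; rewrite both //.
transitivity (sweedler (fun m n => \sum_a \sum_c
    (xi a (rc x m) *: xi c (rc x n) : k) *: b (e a * G x) (e c * G x)) (G x)).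
  apply: eq_sweedler => m n; rewrite {1}(rcE m) {1}(rcE n) (lin_sum (hb.2 _)).
  apply: eq_bigr => a _; rewrite (lin_scale (hb.2 _)) (lin_sum (hb.1 _)) scaler_sumr.
  by apply: eq_bigr => c _; rewrite (lin_scale (hb.1 _)) scalerA.
rewrite sweedler_sum; apply: eq_bigr => a _; rewrite sweedler_sum; apply: eq_bigr => c _.
have la := lxi a; have lcc := lxi c.
rewrite (both _ (fun m n => xi a m *: xi c n : k^o)); last lin.
by rewrite (lin_sweedler (g := fun z : k^o => (z : k) *: b _ _)); last lin.
Qed.

Variable x0 : cT.
Hypothesis x01 : x0 != 1%g.
Hypothesis cu : commutes_as iota act t (G x0).

Lemma exists_half_twist : exists (beta : gT -> gT -> k) (f : fun_algebra k gT),
  [/\ Alt beta, forall a, f a != 0 & twisted_grouplike iota (iota f * G x0) (half_form beta)].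
Proof.
have [phi [lphi phiE]] := iota_dual_basis.
have [J hJ] := exists_twist x0.
have J0 a c : J a c != 0 by exact: (twisted_neq0 (GG' x0) lphi phiE a c hJ).
have Jcoc a b c : J a b * J (a * b)%g c = J b c * J a (b * c)%g.
  exact: (twisted_cocycle (GG' x0) lphi phiE a b c hJ).
pose beta := alternation J; have hb : Alt beta by exact: Alt_alternation.
have hh := Alt_half hb; have [h0 _ _ _] := hh.
(* [J] and [half_form beta] have the same alternation, so their quotient is a symmetric cocycle;
   rescaling by a function splitting it leaves [half_form beta]. *)
pose s a c := J a c / half_form beta a c.
have s0 a c : s a c != 0 by rewrite mulf_neq0 ?invr_eq0.
have ssym a c : s a c = s c a.
  apply/eqP; rewrite eqr_div // [half_form beta c a](_ : _ = half_form beta a c / beta a c).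
    have -> : beta a c = J a c / J c a by [].
    by apply/eqP; field; rewrite !J0.
  by rewrite -(half_form_div oddG a c hb) invf_div mulrC divfK.
have scoc a b c : s a b * s (a * b)%g c = s b c * s a (b * c)%g.
  by rewrite /s !mulf_div Jcoc (Alt_cocycle _ _ _ hh).
have [g [g0 gE]] := symmetric_cocycle_split abG s0 ssym scoc.
exists beta, [ffun a => g a]; split=> // [a|]; first by rewrite ffunE.
apply: (eq_twisted _ (twisted_scale hi hJ _)) => [a c|a]; rewrite !ffunE //.
have -> : J a c = half_form beta a c * (g a * g c / g (a * c)%g).
  by rewrite -gE /s mulrC divfK.
rewrite -mulrA -[RHS]mulr1; congr (_ * _).
by field; rewrite !g0.
Qed.

Lemma exists_presentation : exists (chi : gT -> k) (beta : gT -> gT -> k),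
  [/\ dual_fixed act chi, Alt_N t act beta & presented t act H chi beta].
Proof.
have [phi [lphi phiE]] := iota_dual_basis.
have [beta [f [hb f0 hu]]] := exists_half_twist.
set u := iota f * G x0 in hu; pose u' := G' x0 * iota [ffun a => (f a)^-1].
have uu' : u * u' = 1.
  rewrite /u /u' mulrA -(mulrA (iota f)) GG' mulr1 -(iotaM hi) -(iota1 hi).
  by congr iota; apply/ffunP=> a; rewrite !ffunE mulfV.
have cut : commutes_as iota act t u by exact: commutes_as_iotaM.
have uhom : rc x0 u = u by rewrite (rcomp_iotaM fr) Ghom.
have uXhom n : rc (x0 ^+ n)%g (u ^+ n) = u ^+ n.
  elim: n => [|n IHn]; first by rewrite expr0 (rcomp1 fr) eqxx scale1r.
  by rewrite exprS expgS (rcomp_homM fr _ _ uhom) mulKg IHn.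
have uXX' n : u ^+ n * u' ^+ n = 1.
  elim: n => [|n IHn]; first by rewrite mulr1.
  by rewrite exprSr exprS mulrA -(mulrA _ u) uu' mulr1.
have [chi chiE] : exists chi, u ^+ p = iota chi.
  by apply: (fr_coinv fr); rewrite -{1}(expgp genT x0) uXhom.
have chi0 a : chi a != 0.
  apply/eqP=> z; have := congr1 (fun h => e a * h) (uXX' p).
  rewrite /= mulrA chiE (iota_deltaM hi) z scale0r mul0r mulr1 => /esym/eqP.
  by rewrite (negPf (framed_delta_neq0 fr a)).
have hup := twistedX hi hact p cut hu.
(* The coefficient of [Delta(u ^+ p)] at [e a (x) e c], computed from [u ^+ p = iota chi] and from
   the twisted powers of [u]; the coordinates are those for the unit 1. *)
have chiM a c : chi (a * c)%g =
    phi_beta t act p (half_form beta) a c * (chi a * chi c).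
  have one1 : (1 : H) * 1 = 1 by rewrite mulr1.
  have := twisted_coef one1 lphi phiE chi a c (twisted_one hi).
  rewrite !mulr1 -chiE => <-; rewrite hup; last exact: coord2_bilin.
  have cE d b : coord 1 phi d (e b * u ^+ p) = (d == b)%:R * chi d.
    by rewrite chiE -(iotaM hi) -[iota _]mulr1 coord_iotaM ?mulr1 // !ffunE.
  rewrite (bigD1 a) //= [X in _ + X]big1 ?addr0; last first.
    move=> d nd; rewrite big1 // => x _.
    by rewrite !cE eq_sym (negPf nd) mul0r scale0r; exact: mulr0.
  rewrite (bigD1 c) //= [X in _ + X]big1 ?addr0; last first.
    by move=> d nd; rewrite !cE [c == d]eq_sym (negPf nd) mul0r scaler0; exact: mulr0.
  by rewrite !cE !eqxx !mul1r.
have hbp := Alt_phi t hact p hb.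
(* [chi (a * c)] is symmetric in [a] and [c], so by [chiM] the norm of the half form is symmetric as
   well as alternating. *)
have bN : forall a c, phi_beta t act p beta a c = 1.
  apply: (Alt_sym_eq1 oddG hbp) => a c; rewrite -!half_form_phi.
  have cc : chi a * chi c != 0 by rewrite mulf_neq0.
  by apply: (mulIf cc); rewrite -chiM abG chiM [chi a * _]mulrC.
have chiM' a c : chi (a * c)%g = chi a * chi c.
  by rewrite chiM half_form_phi half_form1 ?mul1r.
(* [u] commutes with its own [p]-th power. *)
have chit a : chi (act a t) = chi a.
  have := cut chi; rewrite -chiE -exprS exprSr chiE => /(congr1 (fun h => h * u')) /=.
  rewrite -!(mulrA _ u u') uu' !mulr1 => /(fr_inj fr)/ffunP/(_ a).
  by rewrite ffunE.
have chifix a x : chi (act a x) = chi a.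
  have [i <-] := genT x; elim: i => [|i IHi]; first by rewrite expg0 (aact1 hact).
  by rewrite expgSr (aactM hact) chit IHi.
exists chi, beta; split=> //.
exists iota, pi, u, x0; split=> //.
  by rewrite chiE; congr iota; apply/ffunP=> a; rewrite ffunE.
split=> //.
have piu := pi_rcomp fr x0 u; rewrite uhom in piu.
have eu : counit u = pi u x0.
  by rewrite -(counit_pi hp) {1}piu; exact: group_counit_scale.
rewrite piu; suff -> : pi u x0 = 1 by rewrite scale1r.
rewrite -eu; apply/eqP.
(* Applying the counit to the first leg of [Delta(u)] leaves the terms with [a = 1], where the half
   form is 1. As [u] is nonzero, its counit is 1. *)
have : counit u *: u = u.
  have := sweedler_counitl u; rewrite hu; last lin.
  rewrite (bigD1 1%g) //= [X in _ + X]big1 ?addr0; last first.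
    move=> a na; rewrite big1 // => c _.
    by rewrite counitM (counit_iota hi) ffunE eq_sym (negPf na) mul0r scale0r scaler0.
  move=> e1; rewrite -[RHS]e1 -{2}[u]mul1r -(iota_sum1 hi) mulr_suml scaler_sumr.
  apply: eq_bigr => c _.
  by rewrite [counit (e 1%g * u)]counitM (counit_iota hi) ffunE eqxx mul1r (Alt1l _ (Alt_half hb)) scale1r.
move/eqP; rewrite -subr_eq0 -{3}[u]scale1r -scalerBl scaler_eq0 subr_eq0.
case/orP=> // /eqP u0; move: uu'; rewrite u0 mul0r => /esym/eqP.
by rewrite oner_eq0.
Qed.

End Normalisation.

(** * Orbits and isomorphism types *)

Lemma Aut_setT (hT : finGroupType) (a : {perm hT}) :
  reflect (forall x y, a (x * y)%g = (a x * a y)%g) (a \in Aut [set: hT]).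
Proof.
apply: (iffP idP) => [|aM].
  by case/setIdP=> _ /morphicP aM x y; apply: aM; rewrite inE.
apply/setIdP; split; first by apply/fintype.subsetP => x _; rewrite inE.
by apply/morphicP => x y _ _; exact: aM.
Qed.

Lemma intertwinersP (cT gT : finGroupType) (act act' : gT -> cT -> gT) (lam : {perm gT}) :
  reflect ((forall a b, lam (a * b)%g = (lam a * lam b)%g) /\
           forall a x, lam (act a x) = act' (lam a) x)
          (lam \in intertwiners act act').
Proof.
rewrite inE; apply: (iffP andP) => [[/Aut_setT lamM h]|[lamM h]].
  by split=> // a x; apply/eqP; move/forallP/(_ a)/forallP/(_ x): h.
split; first exact/Aut_setT.
by apply/forallP=> a; apply/forallP=> x; rewrite h.
Qed.

Section Pairs.
Variables (cT gT : finGroupType) (act : gT -> cT -> gT).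

Lemma calG_pairs_act (g : {perm gT} * {perm cT}) : g \in calG_pairs act ->
  (forall a b, g.1 (a * b)%g = (g.1 a * g.1 b)%g) /\
  forall a x, g.1 (act a x) = act (g.1 a) (g.2 x).
Proof.
case: g => lam alpha; rewrite /calG_pairs; case: ifP => [/forallP triv|_] /=.
  case/setXP => /Aut_setT lamM _; split=> // a x.
  by rewrite !(eqP (forallP (triv _) _)).
by rewrite inE => /andP[_ /intertwinersP].
Qed.

(** In the nontrivial case write [lam = (lam r^-1) r] with [r] the chosen intertwiner for [alpha];
    the first factor intertwines [act] with itself. *)
Lemma mem_calG_pairs (lam : {perm gT}) (alpha : {perm cT}) :
  (forall a b, lam (a * b)%g = (lam a * lam b)%g) ->
  alpha \in Aut [set: cT] ->
  (forall a x, lam (act a x) = act (lam a) (alpha x)) ->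
  (lam, alpha) \in calG_pairs act.
Proof.
move=> lamM aA lam_act; rewrite /calG_pairs; case: ifP => _.
  by apply/setXP; split=> //=; exact/Aut_setT.
have lamI : lam \in intertwiners act (twist act alpha) by exact/intertwinersP.
have invI (r : {perm gT}) : r \in intertwiners act (twist act alpha) ->
    (forall a b, (r^-1)%g (a * b)%g = ((r^-1)%g a * (r^-1)%g b)%g) /\
    forall a x, (r^-1)%g (act a (alpha x)) = act ((r^-1)%g a) x.
  case/intertwinersP=> rM rA; split=> [a b|a x]; apply: (@perm_inj _ r).
    by rewrite rM !permKV.
  by rewrite rA !permKV.
rewrite inE /= lamI andbT; apply/setXP; split=> /=; last first.
  (* The stabilizer asks for an intertwiner from the twisted action to [act], opposite to [lam];
     hence the inverse. *)
  rewrite inE aA /=; apply/set0Pn; exists (lam^-1)%g; apply/intertwinersP.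
  exact: invI.
pose r := repr (intertwiners act (twist act alpha)).
have rI : r \in intertwiners act (twist act alpha) by exact: mem_repr lamI.
have [rM rA] := invI _ rI.
rewrite -[lam](mulgKV r) groupM //; apply: mem_gen; rewrite inE; apply/orP.
  left; apply/intertwinersP; split=> [a b|a x]; rewrite !permM.
    by rewrite lamM rM.
  by rewrite lam_act rA.
right; apply/imsetP; exists alpha => //; rewrite inE aA; apply/set0Pn.
by exists (lam^-1)%g; apply/intertwinersP; exact: invI.
Qed.

End Pairs.

Section Classification.
Variables (k : closedFieldType) (cT gT : finGroupType) (t : cT).
Variable act : groupAction [set: cT] [set: gT].
Local Notation p := #[t]%g.
Hypothesis pr_p : prime p.
Hypothesis odd_p : odd p.
Hypothesis gen : [set: cT]%SET = <[t]>%g.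
Hypothesis abelG : abelian [set: gT].
Hypothesis pdivG : pdiv #|gT| = p.

Lemma group_actionP (to : groupAction [set: cT] [set: gT]) : right_aut_action to.
Proof.
split=> [a|a x y|a b x].
- exact: (@act1 _ [set: cT]%G).
- by apply: actMin; rewrite inE.
- by apply: gactM; rewrite inE.
Qed.

Let hact := group_actionP act.

Let genT (x : cT) : exists i, (t ^+ i)%g = x.
Proof.
have : x \in <[t]>%g by rewrite -gen inE.
by case/cycleP=> i ->; exists i.
Qed.

Let abG (a c : gT) : (a * c = c * a)%g.
Proof. by move/centsP: abelG; apply; rewrite inE. Qed.

Let oddG : odd #|gT|.
Proof.
apply/negPn/negP => ev; have : (2 %| #|gT|)%N by rewrite dvdn2.
move/(pdiv_min_dvd (isT : 1 < 2)%N); rewrite pdivG => le2.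
have p2 : p = 2%N by apply/eqP; rewrite eqn_leq le2 prime_gt1.
by move: odd_p; rewrite p2.
Qed.

Let small : (#|cT| <= pdiv #|gT|)%N.
Proof. by rewrite pdivG (card_gen genT). Qed.

(** An orbit will correspond to the Hopf algebras its points represent. Here [chi] may be any member
    of its coset. *)
Definition represents (z : groupX_point k gT) (H : hopfAlgType k) : Prop :=
  exists chi beta, [/\ z = (norm_coset t act chi, beta), dual_fixed act chi,
    Alt_N t act beta & presented t act H chi beta].

Lemma represents_groupX z H : represents z H -> groupX t act z.
Proof. by case=> chi [beta [-> hchi hbeta _]]; split=> //=; exists chi. Qed.

Lemma represents_model z : groupX t act z ->
  exists (chi : gT -> k) beta r (D : twist_datum k cT gT),
  [/\ z = (norm_coset t act chi, beta), dual_fixed act chi, Alt_N t act beta,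
      scaling t act chi r & datum_for t act r beta D].
Proof.
case: z => z1 z2 [[chi hchi /= ->] /= hbeta].
have [r hr] := exists_scaling pr_p hchi.
have [D hD] := exists_datum hact genT hchi hbeta hr.
by exists chi, z2, r, D.
Qed.

Lemma represents_transport z H H' :
  hopf_iso H H' -> represents z H -> represents z H'.
Proof.
move=> iso [chi [beta [ez hchi hbeta pr]]]; exists chi, beta; split=> //.
exact: presented_transport iso pr.
Qed.

(** A different representative of the coset is absorbed by a character, through [presented_norm];
    both algebras are then isomorphic to the same model. *)
Lemma represents_iso z H H' : represents z H -> represents z H' -> hopf_iso H H'.
Proof.
case=> chi [beta [-> hchi hbeta pr]] [chi' [beta' [[ecos <-] _ _ pr']]].
have {}pr' : presented t act H' chi beta.
  have : norm_coset t act chi' chi by rewrite -ecos; exact: norm_coset_refl.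
  case=> psi dpsi <-; exact: presented_norm.
have [r hr] := exists_scaling pr_p hchi.
have [D hD] := exists_datum hact genT hchi hbeta hr.
apply: (@hopf_iso_trans _ _ (twisted_hopf D)).
  apply: hopf_iso_sym; exact: (presented_iso hact genT pr_p hchi hr hD pr).
exact: (presented_iso hact genT pr_p hchi hr hD pr').
Qed.

Lemma represents_op z z' H :
  represents z H -> groupX_orbit t act z z' -> represents z' H.
Proof.
case=> chi [beta [-> hchi hbeta pr]] [g [n [l [gG gn lp nl ->]]]].
have [lamM lam_act] := calG_pairs_act gG.
have lam_actn a x : g.1 (act a x) = act (g.1 a) (x ^+ n)%g by rewrite lam_act gn.
exists (chi_op t act l g.1 chi), (beta_op t act l g.1 beta); split.
- exact: groupX_opE.
- exact: dual_fixed_op.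
- exact: Alt_N_op.
- exact: presented_op.
Qed.

(** The presentation by [z'] is carried to the model of [z] and recognised there; the accompanying
    automorphism of [C] is the [n]-th power map. *)
Lemma represents_orbit z z' H : represents z H -> represents z' H ->
  ~ (forall a c, z.2 a c = 1) -> groupX_orbit t act z z'.
Proof.
case=> chi [beta [-> hchi hbeta pr]] [chi' [beta' [-> _ [hbeta' _] pr']]] /= nb.
have [r hr] := exists_scaling pr_p hchi.
have [D hD] := exists_datum hact genT hchi hbeta hr.
have iso := presented_iso hact genT pr_p hchi hr hD pr.
have prD := presented_transport (hopf_iso_sym iso) pr'.
have [lam [n [l [psi [lamM lam_act /andP[lp /eqP nl] dpsi [-> ->]]]]]] :=
  recognition hact genT pr_p oddG abG hchi hbeta hr hD hbeta' nb prD.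
rewrite norm_coset_shift // -(groupX_opE hact genT pr_p lamM lam_act nl _ hchi).
have pow_inj : injective (fun x : cT => (x ^+ n)%g).
  apply: (can_inj (g := fun x => (x ^+ l)%g)) => x /=.
  by rewrite -expgnA -[RHS]expg1; exact: (expg_modp genT).
have cC (x y : cT) : commute x y.
  by have [i <-] := genT x; have [j <-] := genT y; exact/commuteX2.
exists (lam, perm pow_inj), n, l; split=> //= [|x]; last by rewrite permE.
apply: mem_calG_pairs => // [|a x]; last by rewrite permE lam_act.
by apply/Aut_setT => x y; rewrite !permE expgMn //; exact: cC.
Qed.

Lemma represents_cocommutative z H : represents z H ->
  (forall a c, z.2 a c = 1) -> cocommutative H.
Proof.
case=> chi [beta [-> hchi hbeta pr]] /= b1.
have [r hr] := exists_scaling pr_p hchi.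
have [D hD] := exists_datum hact genT hchi hbeta hr.
apply: (cocommutative_iso (presented_iso hact genT pr_p hchi hr hD pr)) => h W b br bl.
have hb : bilin b by [].
rewrite [RHS]big_map -[LHS]/(sweedler b h) -[RHS]/(sweedler (fun m n => b n m) h).
rewrite sweedler_tw // sweedler_tw; last lin.
rewrite exchange_big; apply: eq_bigr => a _; apply: eq_bigr => c _ /=.
apply: eq_bigr => x _; rewrite abG; congr (_ * _ *: _).
have [i <-] := genT x; have := datum_swap abG hD i a c.
have h1 d e : half_form (phi_beta t act i beta) d e = 1.
  by rewrite half_form1 // => d' e'; apply: big1 => j _; rewrite b1.
by rewrite !h1 !mulr1.
Qed.

Lemma represents_exists z : groupX t act z ->
  exists H, [/\ represents z H, in_Ext act H
    & cocommutative H -> forall a c, z.2 a c = 1].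
Proof.
move/represents_model => [chi [beta [r [D [-> hchi hbeta hr hD]]]]].
exists (twisted_hopf D); split.
- exists chi, beta; split=> //.
  exact: (model_presented hact pr_p hr hD).
- exists (@tw_iota _ _ _ D), (@tw_pi _ _ _ D), act; split.
  + exact: tw_extension.
  + have := tw_extension_action D; by case: hD => ->.
  + exists 1%g; first exact: group1.
    apply/set0Pn; exists 1%g; apply/intertwinersP.
    by split=> [a b|a x]; rewrite /twist !perm1.
- exact: (model_cocommutative hact genT pr_p oddG abG hbeta hD).
Qed.

Lemma represents_Ext H : in_Ext act H -> exists z, represents z H.
Proof.
case=> iota [pi [act' [hext [gamma [gamma' [clv crs]]] [alpha aA]]]].
case/set0Pn=> lam /intertwinersP[lamM lam_act].
have fr := extension_framed hext.
have hi := fr_iota fr; have hp := fr_pi fr.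
have [lg lg' col conv conv'] := clv.
have hact' := group_actionP act'.
pose G x := gamma (group_elt k x); pose G' x := gamma' (group_elt k x).
have eltE (W : lmodType k) (b : group_algebra k cT -> group_algebra k cT -> W) x :
    bilin b -> sweedler b (group_elt k x) = b (group_elt k x) (group_elt k x).
  move=> hb; rewrite sweedler_group // (bigD1 x) //= big1 ?addr0.
    by rewrite group_eltE eqxx scale1r.
  by move=> y ny; rewrite group_eltE (negPf ny) scale0r.
have cnt x : counit (group_elt k x) = 1.
  by have := group_counit_scale (1 : k) x; rewrite scale1r.
have GG' x : G x * G' x = 1.
  have := conv (group_elt k x); rewrite cnt scale1r => <-.
  by rewrite -[RHS]/(sweedler (fun m n => gamma m * gamma' n) _) eltE //; lin.
have G'G x : G' x * G x = 1.
  have := conv' (group_elt k x); rewrite cnt scale1r => <-.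
  by rewrite -[RHS]/(sweedler (fun m n => gamma' m * gamma n) _) eltE //; lin.
have Ghom x : rcomp pi x (G x) = G x.
  have hb : bilin (fun (m : H) (n : group_algebra k cT) => (n x : k) *: m).
    by split=> u c m n; rewrite /= ?ffun_lin ?scalar_lin ?scale_lin.
  have := col (group_elt k x) _ _ hb.1 hb.2; rewrite [LHS]big_map [RHS]big_map.
  rewrite -[RHS]/(sweedler (fun m n : group_algebra k cT => (n x : k) *: gamma m) _).
  rewrite eltE; last by split=> u c m n; rewrite /= ?ffun_lin ?scalar_lin ?lg ?scale_lin.
  by rewrite group_eltE eqxx scale1r.
have [alpha' alphaK alphaK'] : bijective alpha by exists (alpha^-1)%g; [exact: permK | exact: permKV].
have alpha1 : alpha 1%g = 1%g.
  have aM := elimT (Aut_setT alpha) aA.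
  by apply: (mulgI (alpha 1%g)); rewrite -aM !mulg1.
(* [lam] carries [act'] to the twist of [act] by [alpha]; so [x0], with [alpha x0 = t], acts through
   [iota \o pull lam] as [t] does under [act]. *)
pose x0 := alpha' t.
have x01 : x0 != 1%g.
  apply/eqP=> e0; have := alphaK' t; rewrite -/x0 e0 alpha1 => t1.
  by move: pr_p; rewrite -t1 order1.
have fr2 := framed_pull lamM fr.
have cu : commutes_as (iota \o pull lam) act t (G x0).
  move=> f /=.
  have := crs (group_elt k x0) (pull lam f).
  rewrite -[RHS]/(sweedler (fun m n => gamma m * iota (pull lam f) * gamma' n) _) eltE; last lin.
  move=> e1; have {e1} := congr1 (fun h => h * G x0) e1.
  rewrite /= -!mulrA -[gamma' _]/(G' x0) G'G mulr1 => <-; congr (iota _ * _).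
  apply/ffunP=> a; rewrite !ffunE (bigD1 x0) //= big1 ?addr0.
    by rewrite group_eltE eqxx mul1r ffunE lam_act /twist alphaK'.
  by move=> y ny; rewrite group_eltE (negPf ny) mul0r.
have [chi [beta [hchi hbeta pr]]] :=
  exists_presentation hact genT oddG abG small fr2 GG' G'G Ghom x01 cu.
by exists (norm_coset t act chi, beta), chi, beta.
Qed.

Lemma groupX_orbit_refl z H : represents z H ->
  ~ (forall a c, z.2 a c = 1) -> groupX_orbit t act z z.
Proof. by move=> R nb; exact: (represents_orbit R R nb). Qed.

Lemma classification :
  exists F : set (groupX_point k gT) -> (hopfAlgType k -> Prop),
    pred_bij
      (fun O => groupX_orbits t act O /\ ~ (O `<=` groupX_left t act)%classic)
      (noncocommutative_types act)
      F.
Proof.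
(* The orbit of [z] turns out to be the set of all points representing the same
   Hopf algebra as [z], so no choice is needed. *)
exists (fun O H => exists2 z, O z & represents z H).
have orbE (z : groupX_point k gT) H : represents z H -> ~ (forall a c, z.2 a c = 1) ->
    (fun H' => exists2 z', groupX_orbit t act z z' & represents z' H') =
    isomorphism_type H.
  move=> R nb; apply/funext=> H'; apply/propext; split=> [[z' oz' R']|iso].
    exact: (represents_iso (represents_op R oz') R').
  by exists z; [exact: (groupX_orbit_refl R nb) | exact: (represents_transport iso R)].
(* The operation sends [beta = 1] to itself, so an orbit with one such point is contained in
   [groupX_left]. *)
have nontriv (z : groupX_point k gT) : groupX t act z ->
    ~ (groupX_orbit t act z `<=` groupX_left t act)%classic ->
    ~ (forall a c, z.2 a c = 1).
  move=> gz nleft z1; apply: nleft => z' oz'.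
  have [H [R _ _]] := represents_exists gz.
  split; first exact: (represents_groupX (represents_op R oz')).
  case: oz' => g [n [l [_ _ _ _ ->]]] /=.
  by apply/funext=> a; apply/funext=> c; apply: big1 => j _; rewrite z1.
split.
- move=> O [[z gz <-] nleft]; have nb := nontriv z gz nleft.
  have [H [R inE coc]] := represents_exists gz.
  exists H; last exact: orbE.
  by split=> // /coc.
- move=> _ _ [[z gz <-] nleft] [[z' gz' <-] nleft'] eF.
  have nb := nontriv z gz nleft; have nb' := nontriv z' gz' nleft'.
  have [H [R _ _]] := represents_exists gz.
  have [H' [R' _ _]] := represents_exists gz'.
  have e1 : isomorphism_type H = isomorphism_type H'.
    by rewrite -(orbE z H R nb) -(orbE z' H' R' nb'); exact: eF.
  have iso : hopf_iso H' H.
    rewrite -/(isomorphism_type H' H) -e1; exists id; last by exists id.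
    split=> // x W b br bl; rewrite big_map.
    by apply: eq_bigr.
  have R2 : represents z' H := represents_transport iso R'.
  (* Each of the two orbits contains every point representing [H], so they coincide. *)
  apply/seteqP; split=> w ow.
    exact: (represents_orbit R2 (represents_op R ow) nb').
  exact: (represents_orbit R (represents_op R2 ow) nb).
- move=> T [H [inE ncoc] ->]; have [z R] := represents_Ext inE.
  have nb : ~ (forall a c, z.2 a c = 1).
    by move=> b1; apply: ncoc; exact: (represents_cocommutative R b1).
  exists (groupX_orbit t act z); last exact: orbE.
  split; first by exists z => //; exact: (represents_groupX R).
  move=> /(_ z (groupX_orbit_refl R nb)) [_ e1]; apply: nb => a c.
  by rewrite e1.
Qed.

End Classification.

Theorem mainTheorem2 (k : closedFieldType) (p : nat) (cT gT : finGroupType)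
    (t : cT) (act : groupAction [set: cT] [set: gT]) :
  [pchar k] =i pred0 ->
  prime p -> odd p ->
  [set: cT]%SET = <[t]>%g -> #[t]%g = p ->
  abelian [set: gT] -> pdiv #|gT| = p ->
  exists F : set (groupX_point k gT) -> (hopfAlgType k -> Prop),
    pred_bij
      (fun O => groupX_orbits t act O /\ ~ (O `<=` groupX_left t act)%classic)
      (noncocommutative_types act)
      F.
Proof.
move=> _ pr_p odd_p gen tp abelG pdivG.
by apply: classification; rewrite ?tp.
Qed.
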